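(* (One boundary control.) Let $g>0$, $l_1>0$, $(K,\gamma)\in(0,+\infty)\times(0,1)$, and let $H_1^*,V_1^*$ be real numbers with $H_1^*>0$ and $0<V_1^*<\sqrt{gH_1^*}$. Let $c>0$ be any number such that $\sqrt{gH_1^*}-V_1^*>2c$. Then there exist a number $\delta_0>0$ and a function $t^*=t^*(H_1^*,V_1^*,c,\delta,K,\gamma)$ with $\lim_{\delta\to0}t^*=0$ such that, for every $\delta\in(0,\delta_0]$ and all $(H_{1,0},V_{1,0})\in\mathrm{Lip}([0,l_1])^2$ with $$\max\big(\|H_{1,0}-H_1^*\|_{W^{1,\infty}(0,l_1)},\|V_{1,0}-V_1^*\|_{W^{1,\infty}(0,l_1)}\big)<\delta,\qquad H_{1,0}(0)V_{1,0}(0)=H_1^*V_1^*,$$ the following holds. For any $T>0$ there exists a unique solution $(H_1,V_1)\in\mathrm{Lip}([0,T]\times[0,l_1])^2$ of $$\partial_tH_1+\partial_x(H_1V_1)=0,\qquad \partial_tV_1+\partial_x\Big(\frac{V_1^2}{2}+gH_1\Big)=0,\qquad 0<x<l_1,$$ $$H_1(0,x)=H_{1,0}(x),\qquad V_1(0,x)=V_{1,0}(x),$$ with the uncontrolled boundary condition at $x=0$ $$H_1(t,0)V_1(t,0)=H_1^*V_1^*$$ and the feedback boundary condition at $x=l_1$ $$H_1(t,l_1)V_1(t,l_1)=H_1(t,l_1)\Big(v_1(t,l_1)+2\sqrt{gH_1(t,l_1)}+V_1^*-2\sqrt{gH_1^*}\Big),$$ where the control state $v_1(\cdot,l_1)$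 solves $$\frac{d}{dt}v_1(t,l_1)=-K\,\mathrm{sgn}(v_1(t,l_1))|v_1(t,l_1)|^\gamma,\qquad v_1(0,l_1)=V_{1,0}(l_1)-2\sqrt{gH_{1,0}(l_1)}-V_1^*+2\sqrt{gH_1^*}.$$ Furthermore, $$H_1(t,x)=H_1^*,\quad V_1(t,x)=V_1^*\qquad\text{for all } t\ge\frac{2l_1}{c}+t^*,\ x\in(0,l_1).$$ Finally, the equilibrium point $(H_1^*,V_1^* )$ is stable in $\mathrm{Lip}([0,l_1])^2$ for this closed-loop system.
   Context: $\mathrm{Lip}([0,l_1])=W^{1,\infty}(0,l_1)$ denotes the Lipschitz continuous functions on $[0,l_1]$ with norm $\|u\|_\infty+\|u'\|_\infty$. Here $H_1$ is the water depth, $V_1$ the water velocity in a channel $[0,l_1]$, and $g$ the gravitation constant. A solution is a pair of Lipschitz functions satisfying the partial differential equations in the distributional sense on $(0,T)\times(0,l_1)$, and the initial and boundary conditions pointwise. Stability of $(H_1^*,V_1^* )$ in $\mathrm{Lip}([0,l_1])^2$ means: $\|(H_1-H_1^*,V_1-V_1^* )\|_{L^\infty(\mathbb R^+;\mathrm{Lip}([0,l_1])^2)}\to0$ as $\|(H_{1,0}-H_1^*,V_{1,0}-V_1^* )\|_{\mathrm{Lip}([0,l_1])^2}\to0$ (for initial data satisfying the compatibility condition $H_{1,0}(0)V_{1,0}(0)=H_1^*V_1^*$). *)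

(* Defs.v *)
From HB Require Import structures.
From mathcomp Require Import all_boot all_order all_algebra.
From mathcomp Require Import all_classical all_reals all_analysis.

Set Implicit Arguments.
Unset Strict Implicit.
Unset Printing Implicit Defensive.

Import Order.TTheory GRing.Theory Num.Theory.
Import numFieldNormedType.Exports.

Local Open Scope classical_set_scope.
Local Open Scope ring_scope.

(* MathComp-Analysis.  Functions on an interval or a rectangle are represented
   by total functions, only the values on that set being relevant; points of
   space-time are pairs (t, x). *)

Definition Linfty_norm (R : realType) (D : set R) (f : R -> \bar R) : \bar R :=
  'N[lebesgue_measure]_+oo[f \_ D].

(* Norm of Lip([0,l]) = W^{1,oo}(0,l).  The classical derivative [derive1 u] of a
   Lipschitz function exists almost everywhere and is its weak derivative. *)
Definition Lip_norm (R : realType) (l : R) (u : R -> R) : \bar R :=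
  (Linfty_norm `]0%R, l[ (EFin \o u) + Linfty_norm `]0%R, l[ (EFin \o derive1 u))%E.

Definition Lip2_norm (R : realType) (l : R) (u v : R -> R) : \bar R :=
  Order.max (Lip_norm l u) (Lip_norm l v).

Definition is_Lip (R : realType) (l : R) (u : R -> R) : Prop :=
  [lipschitz u x | x in `[0, l]].

Definition partial_t (R : realType) (phi : R * R -> R) (p : R * R) : R :=
  'D_((1, 0) : R * R) phi p.

Definition partial_x (R : realType) (phi : R * R -> R) (p : R * R) : R :=
  'D_((0, 1) : R * R) phi p.

Fixpoint is_Cn (R : realType) (n : nat) (phi : R * R -> R) : Prop :=
  continuous phi /\
  if n is m.+1 then
    [/\ forall p, derivable phi p ((1, 0) : R * R),
        forall p, derivable phi p ((0, 1) : R * R),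
        is_Cn m (partial_t phi) & is_Cn m (partial_x phi)]
  else True.

Definition test_function (R : realType) (Omega : set (R * R))
    (phi : R * R -> R) : Prop :=
  [/\ forall n, is_Cn n phi,
      compact (closure [set p | phi p != 0]) &
      closure [set p | phi p != 0] `<=` Omega].

(* d_t u + d_x f = 0 in the distributional sense on Omega. *)
Definition weak_conservation_law (R : realType) (Omega : set (R * R))
    (u f : R * R -> R) : Prop :=
  forall phi : R * R -> R, test_function Omega phi ->
    (\int[(lebesgue_measure \x lebesgue_measure)%E]_(p in Omega)
       (u p * partial_t phi p + f p * partial_x phi p)%:E = 0)%E.

(* v' = - K sgn(v) |v|^gamma on [0,T], v(0) = v0. *)
Definition control_state (R : realType) (K gamma T v0 : R) (v : R -> R) : Prop :=
  [/\ {within `[0, T], continuous v},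
      forall t : R, t \in `]0, T[ ->
        is_derive t (1 : R) v (- K * Num.sg (v t) * `|v t| `^ gamma) &
      v 0 = v0].

(* [Num.sqrt] is 0 on negative numbers: [cls_depth] expresses that the square
   root in [cls_feedback] is a genuine one. *)
Record closed_loop_solution (R : realType) (g l K gamma Hs Vs : R)
    (H0 V0 : R -> R) (T : R) (H V : R * R -> R) : Prop := {
  cls_lip_H : [lipschitz H p | p in `[0, T] `*` `[0, l]];
  cls_lip_V : [lipschitz V p | p in `[0, T] `*` `[0, l]];
  cls_mass : weak_conservation_law (`]0, T[ `*` `]0, l[) H (fun p => H p * V p);
  cls_momentum : weak_conservation_law (`]0, T[ `*` `]0, l[) V
                   (fun p => V p ^+ 2 / 2 + g * H p);
  cls_init_H : forall x : R, x \in `[0, l] -> H (0, x) = H0 x;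
  cls_init_V : forall x : R, x \in `[0, l] -> V (0, x) = V0 x;
  cls_left : forall t : R, t \in `[0, T] -> H (t, 0) * V (t, 0) = Hs * Vs;
  cls_depth : forall t : R, t \in `[0, T] -> 0 <= H (t, l);
  cls_feedback : exists2 v : R -> R,
    control_state K gamma T
      (V0 l - 2 * Num.sqrt (g * H0 l) - Vs + 2 * Num.sqrt (g * Hs)) v &
    forall t : R, t \in `[0, T] ->
      H (t, l) * V (t, l) =
      H (t, l) * (v t + 2 * Num.sqrt (g * H (t, l)) + Vs
                  - 2 * Num.sqrt (g * Hs)) }.

Definition global_solution (R : realType) (g l K gamma Hs Vs : R)
    (H0 V0 : R -> R) (H V : R * R -> R) : Prop :=
  forall T : R, 0 < T -> closed_loop_solution g l K gamma Hs Vs H0 V0 T H V.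

Definition Lip_stable (R : realType) (g l K gamma Hs Vs : R) : Prop :=
  forall e : R, 0 < e -> exists2 eta : R, 0 < eta &
  forall H0 V0 : R -> R, is_Lip l H0 -> is_Lip l V0 ->
    H0 0 * V0 0 = Hs * Vs ->
    (Lip2_norm l (fun x => (H0 x - Hs)%R) (fun x => (V0 x - Vs)%R) < eta%:E)%E ->
    (exists H V, global_solution g l K gamma Hs Vs H0 V0 H V) /\
    forall H V, global_solution g l K gamma Hs Vs H0 V0 H V ->
      (Linfty_norm `[0%R, +oo[
         (fun t => Lip2_norm l (fun x => (H (t, x) - Hs)%R)
                               (fun x => (V (t, x) - Vs)%R)) <= e%:E)%E.

(* Main.v *)
Require Import Defs.
From HB Require Import structures.
From mathcomp Require Import all_boot all_order all_algebra.
From mathcomp Require Import all_classical all_reals all_analysis.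
From mathcomp Require Import measurable_realfun ess_sup_inf ring lra.
Set Implicit Arguments.
Unset Strict Implicit.
Unset Printing Implicit Defensive.
Import Order.TTheory GRing.Theory Num.Theory.
Import numFieldNormedType.Exports.
Local Open Scope classical_set_scope.
Local Open Scope ring_scope.

(** Why the theorem holds.

    In the Riemann invariants r = V + 2 sqrt(g H) and s = V - 2 sqrt(g H),
    shifted so as to vanish at the equilibrium, the system is diagonal: [r]
    travels to the right at speed V + sqrt(g H), and [s] to the left at speed
    sqrt(g H) - V. The feedback law says that the incoming invariant at [l] is
    the control state, s(t, l) = v(t). At the uncontrolled end, H V = Hs Vs
    reads r = phi(s) where phi(0) = 0 and phi does not increase distances
    ([inflow_lip]). As gamma < 1, [v] vanishes after a finite time t1, small
    with the data; then [s] vanishes after one crossing of the channel, and [r]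
    after a second one. For small data both speeds are at least 2 c, so that
    the two crossings last at most l / c together; and t1 <= l / c as well. The
    state is thus at rest from 2 l / c on, and t* = 0 is a valid choice.

    Existence and uniqueness rest on a notion of solution in which derivatives
    do not appear: along a line of slope k, from (t, x), during a time h, [r]
    varies by at most C (h + |lam - k|) h, where lam is its speed at (t, x),
    and similarly for [s] ([csol]). Such solutions are the limits of an
    explicit scheme that follows the characteristic lines of frozen speed
    during each step ([csol_exists]). Slopes satisfy a Riccati inequality,
    hence remain bounded for a time inverse to their initial size; for small
    data this is longer than t1 plus the two crossings, after which nothing is
    left, so that the solution is global. A step of the scheme is stable, and
    consistent with any solution to second order, whence uniqueness
    ([csol_unique]).

    The link with the weak equations goes both ways. A characteristic solution
    satisfies the equations almost everywhere, the x-derivatives of Lipschitz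
    functions existing almost everywhere ([klip_ftc]); integration against test
    functions gives the weak form ([weak_of_ae], [csol_closed_loop]).
    Conversely, the weak equations tested on thin parallelograms show that the
    linearised invariants are transported along lines ([weak_transport]), so
    that a weak solution near the equilibrium is characteristic
    ([window_csol]). An arbitrary Lipschitz solution is not known beforehand to
    stay near the equilibrium, but it does so for a definite time whenever it
    agrees with the constructed one, and uniqueness propagates from one time
    step to the next ([closed_loop_unique]). Stability follows from the bounds
    of the scheme on values and slopes. *)

(** * Lipschitz functions are integrals of their derivatives *)

Section lip_ftc.
Context {R : realType}.
Implicit Types (L : R) (u : R -> R).

Definition klip L u := forall x y, `|u x - u y| <= L * `|x - y|.

Lemma klip_continuous L u : klip L u -> continuous u.
Proof.
move=> lu x; apply/cvgrPdist_le => e e0.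
near=> y.
rewrite (le_trans (lu _ _))//.
have L1 : 0 < `|L| + 1 by rewrite ltr_pwDr.
apply: (@le_trans _ _ ((`|L| + 1) * `|x - y|)).
  by apply: ler_wpM2r => //; rewrite (le_trans (ler_norm L))// lerDl.
rewrite mulrC -ler_pdivlMr//.
near: y.
by apply: cvgr_dist_le; [exact: cvg_id|rewrite divr_gt0].
Unshelve. all: by end_near. Qed.

(** For [u] with constant 1, the identity is the sum of the two nondecreasing
    functions [half_up u] and [half_up (\- u)]. Their Stieltjes measures
    therefore add up to Lebesgue measure, so that each is absolutely
    continuous, and a Lipschitz function has a density by Radon-Nikodym. *)
Definition half_up u (x : R) := (x + u x) / 2.

Lemma half_up_nd u : klip 1 u -> nondecreasing (half_up u).
Proof.
move=> lu x y xy; rewrite /half_up ler_pM2r ?invr_gt0//.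
have := lu x y; rewrite mul1r => /ler_normlP[h1 h2].
rewrite ler0_norm ?subr_le0// in h1 h2; lra.
Qed.

Lemma half_up_rc u : klip 1 u -> right_continuous (half_up u).
Proof.
move=> lu; apply: right_continuousW => x; rewrite /half_up.
apply: cvgM; last exact: cvg_cst.
by apply: cvgD; [exact: cvg_id|exact: (klip_continuous lu)].
Qed.


Definition half_up_cumulative u (lu : klip 1 u) : cumulative R R :=
  HB.pack (half_up u)
    (isCumulative.Build R _ R (half_up u) (half_up_nd lu) (half_up_rc lu)).

Lemma stieltjes_itvoc (f : cumulative R R) a b : a <= b ->
  lebesgue_stieltjes_measure f `]a, b]%classic = (f b - f a)%:E.
Proof.
move=> ab; rewrite /lebesgue_stieltjes_measure/= /measure_extension/=.
by rewrite measurable_mu_extE/=; [rewrite wlength_itv_bnd|exact: is_ocitv].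
Qed.

Lemma klip_opp L u : klip L u -> klip L (\- u).
Proof. by move=> lu x y /=; rewrite -opprD normrN; exact: lu. Qed.

Local Notation mu := (@lebesgue_measure R).

(** Both sides give an interval its length, hence agree on Borel sets. *)
Lemma lebesgue_half_up u (lu : klip 1 u) (A : set R) : measurable A ->
  (mu A = lebesgue_stieltjes_measure (half_up_cumulative lu) A
   + lebesgue_stieltjes_measure (half_up_cumulative (klip_opp lu)) A)%E.
Proof.
move=> mA; rewrite -[RHS]measure_addE.
apply: lebesgue_measure_unique => // X /ocitvP[->|[[a b] /= ab ->]].
  by rewrite !measure0.
rewrite [RHS]measure_addE lebesgue_measure_itv /= lte_fin ab.
rewrite (stieltjes_itvoc (half_up_cumulative lu) (ltW ab)).
rewrite (stieltjes_itvoc (half_up_cumulative (klip_opp lu)) (ltW ab)).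
by rewrite -!EFinD; congr EFin; rewrite /half_up_cumulative /= /half_up /=; lra.
Qed.

(** The density of the Stieltjes measure of [half_up u], restricted to a
    bounded interval so as to be finite. *)
Lemma half_up_density u a b : klip 1 u -> a < b ->
  exists h : R -> R, mu.-integrable setT (EFin \o h) /\
    forall x, x \in `[a, b] ->
      half_up u x - half_up u a = (\int[mu]_(t in `]a, x]) h t)%R.
Proof.
move=> lu ab.
pose nu := lebesgue_stieltjes_measure (half_up_cumulative lu).
pose D : set R := `]a, b]%classic.
have mD : measurable (D : set (measurableTypeR R)) by exact: measurable_itv.
have nuD : (nu D < +oo)%E by rewrite /nu /D stieltjes_itvoc ?ltry// ltW.
have ac : mfrestr mD nuD `<< mu.
  apply/null_content_dominatesP => A mA A0.
  apply/eqP; rewrite eq_le measure_ge0 andbT.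
  have nuA0 : (nu A <= 0)%E.
    have E := etrans (esym A0) (lebesgue_half_up lu mA).
    by rewrite [leRHS]E leeDl// measure_ge0.
  apply: le_trans nuA0; apply: le_measure; rewrite ?inE//.
  exact: measurableI.
have [f [f0 ffin fint fE]] := radon_nikodym_sigma_finite ac.
exists (fine \o f); split.
  by apply: eq_integrable fint => // x _ /=; rewrite fineK.
move=> x; rewrite in_itv/= => /andP[ax xb].
have DE : (`]a, x] `&` D = `]a, x])%classic.
  apply: setIidl => y; rewrite /D /= !in_itv/= => /andP[-> yx].
  exact: le_trans xb.
have E : nu (`]a, x] `&` D)%classic = (\int[mu]_(t in `]a, x]) f t)%E.
  by have := fE `]a, x]%classic (measurable_itv _).
have E2 : nu (`]a, x] `&` D)%classic = (half_up u x - half_up u a)%:E.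
  exact: etrans (congr1 nu DE) (stieltjes_itvoc (half_up_cumulative lu) ax).
rewrite /Rintegral.
have -> : (\int[mu]_(t in `]a, x]) ((fine \o f) t)%:E
           = \int[mu]_(t in `]a, x]) f t)%E.
  by apply: eq_integral => y _ /=; rewrite fineK.
by rewrite -E E2.
Qed.

Lemma continuous_itv_integrable u a b : continuous u ->
  mu.-integrable `[a, b] (EFin \o u).
Proof.
move=> cu; apply: continuous_compact_integrable; first exact: segment_compact.
exact: continuous_subspaceT.
Qed.

Lemma klip_ftc1 u a b : klip 1 u -> a < b ->
  exists d : R -> R,
  [/\ mu.-integrable `[a, b] (EFin \o d),
     {ae mu, forall x, x \in `]a, b[ -> is_derive x (1:R) u (d x)} &
     forall x, x \in `[a, b] -> u x - u a = (\int[mu]_(t in `]a, x]) d t)%R].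
Proof.
move=> lu ab; have [h [inth hE]] := half_up_density lu ab.
have mab : measurable (`[a, b]%classic : set R) by exact: measurable_itv.
have int1 : mu.-integrable `[a, b] (EFin \o cst 1%R : R -> \bar R).
  by apply: continuous_itv_integrable => y; exact: cst_continuous.
have inthab : mu.-integrable `[a, b] (EFin \o h).
  exact: integrableS inth.
exists (fun x => 2 * h x - 1); split.
- rewrite (_ : EFin \o _ = (fun x => 2%:E * (EFin \o h) x) \- (EFin \o cst 1%R))%E //.
  by apply: integrableB => //; exact: integrableZl.
- pose F x := (\int[mu]_(t in `]a, x]) h t)%R.
  have locf : locally_integrable setT h.
    by apply: open_integrable_locally => //; exact: openT.
  have inty y : mu.-integrable [set` Interval (BRight a) (BRight y)] (EFin \o h).
    exact: integrableS inth.
  have := FTC1 inty locf.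
  apply: filterS; first exact: (ae_filter_ringOfSetsType mu).
  move=> x /= Hx; rewrite in_itv/= => /andP[ax xb].
  have [dF F'E] : derivable F x 1 /\ derive1 F x = h x := Hx ax.
  have uE : \forall y \near x, u a + a - y + 2 * F y = u y.
    near=> y.
    have yab : y \in `[a, b].
      rewrite in_itv/=; apply/andP; split; apply: ltW; near: y.
        exact: lt_nbhsr.
      exact: lt_nbhsl.
    by rewrite /F -hE// /half_up; lra.
  apply: (near_eq_is_derive uE).
  have Fx : is_derive x (1:R) F (h x).
    clear -dF F'E; clearbody F.
    by apply: DeriveDef => //; rewrite -derive1E.
  have H : is_derive x (1:R) ((cst (u a + a) - id) + (2 *: F)) (0 - 1 + 2 *: h x).
    by apply: is_deriveD.
  have -> : 2 * h x - 1 = 0 - 1 + 2 *: h x by rewrite sub0r addrC.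
  exact: H.
- move=> x xab; have := hE x xab.
  rewrite /half_up => E.
  have xab' := xab; rewrite in_itv/= in xab'; case/andP: xab' => ax xb.
  have mx : measurable (`]a, x]%classic : set R) by exact: measurable_itv.
  rewrite RintegralB//=; last 2 first.
  + rewrite (_ : EFin \o _ = fun x => 2%:E * (EFin \o h) x)%E//.
    by apply: integrableZl => //; exact: integrableS inth.
  + apply: integrableS int1 => // y /=; rewrite !in_itv/= => /andP[/ltW-> yx].
    exact: le_trans xb.
  rewrite RintegralZl//; last exact: integrableS inth.
  have muax : mu `]a, x]%classic = (x - a)%:E.
    rewrite lebesgue_measure_itv/= lte_fin; case: ltP => [_|xa].
      by rewrite -EFinB.
    by rewrite (_ : x = a) ?subrr//; apply/eqP; rewrite eq_le ax xa.
  rewrite -E Rintegral_cst// (congr1 fine muax)/=; lra.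
Unshelve. all: by end_near. Qed.

(** A Lipschitz function is the integral of its almost everywhere derivative.
    It links the norm of the data and the weak equations with pointwise
    statements. *)
Lemma klip_ftc L u a b : 0 < L -> klip L u -> a < b ->
  exists d : R -> R,
  [/\ mu.-integrable `[a, b] (EFin \o d),
     {ae mu, forall x, x \in `]a, b[ -> is_derive x (1:R) u (d x)} &
     forall x y, a <= x -> x <= y -> y <= b ->
       u y - u x = (\int[mu]_(t in `]x, y]) d t)%R].
Proof.
move=> L0 lu ab.
have lv : klip 1 (L^-1 *: u).
  move=> x y; rewrite mul1r /= -scalerBr normrZ gtr0_norm ?invr_gt0//.
  by rewrite ler_pdivrMl.
have [d [intd dE dI]] := klip_ftc1 lv ab.
have intLd : mu.-integrable `[a, b] (EFin \o (fun x => L * d x)).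
  rewrite (_ : EFin \o _ = fun x => L%:E * (EFin \o d) x)%E//.
  by apply: integrableZl.
exists (fun x => L * d x); split => //.
  apply: filterS dE; first exact: (ae_filter_ringOfSetsType mu).
  move=> x /= H /H Hx.
  have : is_derive x (1:R) (L *: (L^-1 *: u)) (L *: d x) by apply: is_deriveZ.
  by rewrite scalerA mulfV ?gt_eqF// scale1r.
move=> x y ax xy yb.
have sub z : z <= b -> `]a, z]%classic `<=` (`[a, b]%classic : set R).
  by move=> zb t /=; rewrite !in_itv/= => /andP[/ltW -> /le_trans]; apply.
have E z : z \in `[a, b] -> u z - u a = (\int[mu]_(t in `]a, z]) (L * d t))%R.
  move=> zab; have := dI z zab.
  rewrite RintegralZl//; last first.
    move: zab; rewrite in_itv/= => /andP[_ zb].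
    apply: integrableS intd => //; exact: sub.
  by move=> <- /=; rewrite -mulrBr mulrA mulfV ?gt_eqF// mul1r.
have -> : u y - u x = (u y - u a) - (u x - u a) by lra.
rewrite !E ?in_itv/= ?ax ?yb ?(le_trans ax)// ?(le_trans xy)//.
rewrite Rintegral_itvB//.
by apply: integrableS intLd => //; exact: sub.
Qed.
End lip_ftc.

(** * The norm of Lip([0, l]) *)

Section clamp.
Context {R : realType}.
Implicit Types (l x : R).

(** Functions on [0, l] are extended to the line by composition with the
    projection on [0, l], which keeps Lipschitz constants. *)
Definition clamp l x : R := Num.max 0 (Num.min l x).

Lemma clamp_id l x : 0 <= x -> x <= l -> clamp l x = x.
Proof. by move=> x0 xl; rewrite /clamp (min_idPr xl) (max_idPr x0). Qed.

Lemma clamp_ge0 l x : 0 <= clamp l x.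
Proof. by rewrite /clamp le_max lexx. Qed.

Lemma clamp_le l x : 0 <= l -> clamp l x <= l.
Proof. by move=> l0; rewrite /clamp ge_max l0 ge_min lexx. Qed.

Lemma clamp_in l x : 0 <= l -> clamp l x \in `[0, l].
Proof. by move=> l0; rewrite in_itv/= clamp_ge0 clamp_le. Qed.

Lemma clampK l x : 0 <= l -> clamp l (clamp l x) = clamp l x.
Proof. by move=> l0; rewrite clamp_id ?clamp_ge0 ?clamp_le. Qed.

Lemma clamp_lip l x y : `|clamp l x - clamp l y| <= `|x - y|.
Proof.
wlog yx : x y / y <= x => [H|].
  by have [/H//|/ltW/H] := leP y x; rewrite distrC (distrC x).
rewrite [leRHS]ger0_norm ?subr_ge0// /clamp.
case: (lerP l x) => lx; case: (lerP l y) => ly;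
  case: (lerP 0 l) => l0; case: (lerP 0 x) => x0; case: (lerP 0 y) => y0;
  rewrite ler_norml; apply/andP; split; lra.
Qed.
End clamp.

Section lip_itv.
Context {R : realType}.
Implicit Types (L l : R) (u : R -> R).
Local Notation mu := (@lebesgue_measure R).

Definition lip_itv L l u :=
  forall x y, x \in `[0, l] -> y \in `[0, l] -> `|u x - u y| <= L * `|x - y|.

Lemma is_LipP l u : is_Lip l u -> exists2 L, 0 < L & lip_itv L l u.
Proof.
move=> [M [Mr H]]; exists (`|M| + 1); first by rewrite ltr_pwDr.
have /H K : M < `|M| + 1 by rewrite (le_lt_trans (ler_norm M))// ltrDl.
by move=> x y xl yl; exact: (K (x, y)).
Qed.

Lemma lip_itv_clamp L l u : 0 <= l -> 0 <= L -> lip_itv L l u -> klip L (u \o clamp l).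
Proof.
move=> l0 L0 H x y /=; apply: le_trans (H _ _ _ _) _; rewrite ?clamp_in//.
by apply: ler_wpM2l => //; exact: clamp_lip.
Qed.

Lemma ae_imply (P Q : R -> Prop) : (forall x, P x -> Q x) ->
  {ae mu, forall x, P x} -> {ae mu, forall x, Q x}.
Proof.
move=> PQ; apply: negligibleS => x /=; apply: contra_not; exact: PQ.
Qed.

Lemma ae_conj (P Q : R -> Prop) :
  {ae mu, forall x, P x} -> {ae mu, forall x, Q x} -> {ae mu, forall x, P x /\ Q x}.
Proof.
move=> p q; have := negligibleU p q; apply: negligibleS => x /= PQ.
have [Px|nPx] := pselect (P x); last by left.
by right => Qx; apply: PQ.
Qed.

Lemma mu_setT_gt0 : (0 < mu setT)%E.
Proof. by rewrite -set_itvNyy lebesgue_measure_itv/= ltry. Qed.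

Lemma Linfty_norm_le (D : set R) (f : R -> \bar R) (m : R) : (0 <= m) ->
  (forall x, D x -> `|f x| <= m%:E)%E -> (Linfty_norm D f <= m%:E)%E.
Proof.
move=> m0 H; rewrite /Linfty_norm unlock /Lnorm.
case: ifPn => _; last by rewrite lee_fin.
apply/ess_supP; apply: aeW => x /=; rewrite patchE.
case: ifPn; first by rewrite inE => /H.
by rewrite abse0 lee_fin.
Qed.

Lemma Linfty_norm_lt_ae (D : set R) (f : R -> R) (m : R) :
  (Linfty_norm D (EFin \o f) < m%:E)%E ->
  {ae mu, forall x, D x -> `|f x| <= m}.
Proof.
rewrite /Linfty_norm unlock /Lnorm mu_setT_gt0 => /ltW /ess_supP.
apply: ae_imply => x /=; rewrite patchE => + Dx.
by rewrite mem_set//= lee_fin.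
Qed.

Lemma is_derive_interval_eq (l x d : R) (u v : R -> R) :
  {in `]0, l[, u =1 v} -> x \in `]0, l[ -> is_derive x (1:R) u d ->
  is_derive x (1:R) v d.
Proof.
move=> uv xl; apply: near_eq_is_derive.
near=> y; apply: uv; near: y.
exact: near_in_itvoo.
Unshelve. all: by end_near. Qed.

Lemma ae_itv_ex (P : R -> Prop) a b : a < b -> {ae mu, forall x, P x} ->
  exists2 x, x \in `]a, b[ & P x.
Proof.
move=> ab [N [mN N0 PN]]; apply: contrapT => H.
have sub : (`]a, b[%classic : set R) `<=` N.
  by move=> x xab; apply: PN => /= Px; apply: H; exists x.
have := @measurable_itv R `]a, b[.
move=> mab.
have : (mu `]a, b[%classic <= 0)%E.
  rewrite -[leRHS]N0; apply: le_measure => //; rewrite inE //.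
have -> : mu `]a, b[%classic = (b - a)%:E by rewrite lebesgue_measure_itv/= lte_fin ab -EFinB.
by rewrite lee_fin leNgt subr_gt0 ab.
Qed.

Lemma ae_neq (a : R) : {ae mu, forall x, x <> a}.
Proof.
exists [set a]; split => //; first exact: lebesgue_measure_set1.
by move=> x /= /contrapT.
Qed.

(** An almost everywhere bound holds at some point of every small interval, and
    continuity carries it everywhere. *)
Lemma Linfty_norm_sup L l m u : 0 < l -> 0 < L -> lip_itv L l u ->
  (Linfty_norm `]0%R, l[ (EFin \o u) < m%:E)%E ->
  forall x, x \in `[0, l] -> `|u x| <= m.
Proof.
move=> l0 L0 lu /Linfty_norm_lt_ae ae x xl; apply/ler_addgt0Pr => e e0.
have [x0 xl'] : 0 <= x /\ x <= l by move: xl; rewrite in_itv/= => /andP.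
have eL : 0 < e / L by rewrite divr_gt0.
have ab : Num.max 0 (x - e / L) < Num.min l (x + e / L).
  by rewrite lt_min !gt_max; apply/andP; split; apply/andP; split; lra.
have [y yab yP] := ae_itv_ex ab ae.
move: yab; rewrite in_itv/= gt_max lt_min => /andP[/andP[y0 xy] /andP[yl yx]].
have yl' : y \in `]0, l[ by rewrite in_itv/= y0 yl.
have H2 := yP yl'.
have H1 : `|u x - u y| <= L * `|x - y|.
  by apply: lu => //; rewrite in_itv/= (ltW y0) (ltW yl).
have H3 : L * `|x - y| <= e.
  rewrite mulrC -ler_pdivlMr// ler_norml; apply/andP; split; lra.
have := ler_normD (u x - u y) (u y); rewrite subrK; lra.
Qed.

(** A bound on the derivative almost everywhere becomes a Lipschitz constant by
    integration, [u] being the integral of its derivative. *)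
Lemma Linfty_norm_derive_lip L l m u : 0 < l -> 0 < L -> lip_itv L l u ->
  (Linfty_norm `]0%R, l[ (EFin \o derive1 u) < m%:E)%E ->
  lip_itv m l u.
Proof.
move=> l0 L0 lu /Linfty_norm_lt_ae ae.
have m0 : 0 <= m.
  have [y yl yP] := ae_itv_ex l0 ae; exact: le_trans (yP yl).
have kv := lip_itv_clamp (ltW l0) (ltW L0) lu.
have [d [intd dE dI]] := klip_ftc L0 kv l0.
have uv : {in `]0, l[, u \o clamp l =1 u}.
  by move=> x; rewrite in_itv/= => /andP[x0 xl] /=; rewrite clamp_id// ltW.
have dm : {ae mu, forall x, x \in `]0, l[ -> `|d x| <= m}.
  apply: ae_imply (ae_conj dE ae) => x [H1 H2] xl.
  have Dx := is_derive_interval_eq uv xl (H1 xl).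
  by have := H2 xl; rewrite derive1E derive_val.
have main x y : 0 <= x -> x <= y -> y <= l -> `|u y - u x| <= m * (y - x).
  move=> x0 xy yl.
  have := dI _ _ x0 xy yl; rewrite /= !clamp_id ?(le_trans x0)// ?(le_trans xy)// => ->.
  have mxy : measurable (`]x, y]%classic : set R) by exact: measurable_itv.
  have sub : (`]x, y]%classic : set R) `<=` `[0, l]%classic.
    move=> t /=; rewrite !in_itv/= => /andP[xt ty].
    by rewrite (le_trans x0 (ltW xt)) (le_trans ty).
  have intxy : mu.-integrable `]x, y] (EFin \o d) by apply: integrableS intd.
  have muxy : mu `]x, y]%classic = (y - x)%:E.
    rewrite lebesgue_measure_itv/= lte_fin; case: ltP => [_|xa].
      by rewrite -EFinB.
    by rewrite (_ : x = y) ?subrr//; apply/eqP; rewrite eq_le xy xa.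
  apply: le_trans (le_normr_Rintegral _ _) _ => //.
  rewrite -lee_fin /Rintegral fineK; last first.
    have /integrableP[mf ifi] := intxy.
    by rewrite ge0_fin_numE//; apply: integral_ge0 => t _; rewrite lee_fin.
  apply: (@le_trans _ _ (\int[mu]_(t in `]x, y]) m%:E)%E).
    apply: ae_ge0_le_integral => //.
    - have /integrableP[/measurable_EFinP mf _] := intxy.
      by apply/measurable_EFinP; exact: measurableT_comp.
    - apply: ae_imply (ae_conj dm (ae_neq l)) => t [H1 tl].
      rewrite /= in_itv/= => /andP[xt ty]; rewrite lee_fin; apply: H1.
      rewrite in_itv/= (le_lt_trans x0 xt) lt_neqAle (le_trans ty yl) andbT.
      exact/eqP.
  by rewrite integral_cst//= muxy -EFinM.
move=> x y; rewrite !in_itv/= => /andP[x0 xl] /andP[y0 yl].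
case: (leP x y) => [xy|/ltW yx].
  by rewrite distrC (distrC x) (ger0_norm (_ : 0 <= y - x)) ?subr_ge0//; exact: main.
by rewrite (ger0_norm (_ : 0 <= x - y)) ?subr_ge0//; exact: main.
Qed.
End lip_itv.

Section lip_norm.
Context {R : realType}.
Implicit Types (L l m : R) (u : R -> R).

Lemma Linfty_norm_ge0 (D : set R) (f : R -> \bar R) : (0 <= Linfty_norm D f)%E.
Proof. exact: Lnorm_ge0. Qed.

(** The form in which smallness of the data is used: pointwise bounds, and a
    small Lipschitz constant. *)
Lemma Lip_norm_lt L l m u : 0 < l -> 0 < L -> lip_itv L l u ->
  (Lip_norm l u < m%:E)%E ->
  (forall x, x \in `[0, l] -> `|u x| <= m) /\ lip_itv m l u.
Proof.
move=> l0 L0 lu um; split.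
  apply: (Linfty_norm_sup l0 L0 lu); apply: le_lt_trans um.
  by rewrite leeDl// Linfty_norm_ge0.
apply: (Linfty_norm_derive_lip l0 L0 lu); apply: le_lt_trans um.
by rewrite leeDr// Linfty_norm_ge0.
Qed.

(** The bound also holds where [u] is not derivable: [derive1 u x] is then the
    limit of a divergent filter, which is 0. *)
Lemma lip_derive1_le L l u x : 0 <= L -> lip_itv L l u -> x \in `]0, l[ ->
  `|derive1 u x| <= L.
Proof.
move=> L0 lu xl; rewrite /derive1.
set q := fun h => _.
have [cq|ncq] := pselect (cvg (q h @[h --> 0^'])); last first.
  by rewrite (dvgP ncq) normr0.
have nq : `|q h| @[h --> 0^'] --> `|lim (q h @[h --> 0^'])| by exact: cvg_norm.
apply: (cvgr_to_le nq).
have [x0 xl'] : 0 < x /\ x < l by move: xl; rewrite in_itv/= => /andP.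
near=> h; rewrite /q.
have h0 : h != 0 by near: h; exact: nbhs_dnbhs_neq.
have hx : `|h| < Num.min x (l - x).
  near: h; apply: dnbhs0_lt; rewrite lt_min x0 subr_gt0; exact: xl'.
move: hx; rewrite lt_min !ltr_norml => /andP[/andP[h1 h2] /andP[h3 h4]].
rewrite normrZ normfV ler_pdivrMl ?normr_gt0// mulrC.
have := lu (h + x) x; rewrite addrK; apply; rewrite in_itv/=; apply/andP; split; lra.
Unshelve. all: by end_near. Qed.

Lemma Lip_norm_le L l m u : 0 <= L -> 0 <= m -> lip_itv L l u ->
  (forall x, x \in `[0, l] -> `|u x| <= m) -> (Lip_norm l u <= (m + L)%:E)%E.
Proof.
move=> L0 m0 lu um; rewrite /Lip_norm EFinD; apply: leeD.
  apply: Linfty_norm_le => // x /=; rewrite in_itv/= => /andP[x0 xl].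
  by rewrite lee_fin; apply: um; rewrite in_itv/= !ltW.
by apply: Linfty_norm_le => // x xl /=; rewrite lee_fin; exact: lip_derive1_le lu _.
Qed.
End lip_norm.

(** * Smooth bumps *)

Section smooth.
Context {R : realType}.
Implicit Types (f g : R -> R).

Lemma is_derive_rval f (x d d' : R) :
  is_derive x (1:R) f d -> d = d' -> is_derive x (1:R) f d'.
Proof. by move=> + <-. Qed.

(** The one-variable counterpart of [is_Cn]; the test functions below are
    products of such functions. *)
Fixpoint Cn1 (n : nat) f : Prop :=
  if n is m.+1 then (forall x, derivable f x 1) /\ Cn1 m (derive1 f)
  else continuous f.

Lemma derivable_continuous f : (forall x, derivable f x 1) -> continuous f.
Proof.
by move=> df x; apply: differentiable_continuous; exact/derivable1_diffP.
Qed.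

Lemma Cn1_continuous n f : Cn1 n f -> continuous f.
Proof. by case: n => // n [/derivable_continuous]. Qed.

Lemma Cn1W n f : Cn1 n.+1 f -> Cn1 n f.
Proof.
elim: n f => [|n IH] f [df H]; first exact: derivable_continuous.
by split => //; exact: IH.
Qed.

Lemma Cn1_cst n (c : R) : Cn1 n (cst c).
Proof.
elim: n c => [|n IH] c; first by move=> x; exact: cst_continuous.
split=> [x|]; first exact: derivable_cst.
by rewrite (_ : derive1 _ = cst 0)//; apply/funext => x; rewrite derive1_cst.
Qed.

Lemma Cn1D n f g : Cn1 n f -> Cn1 n g -> Cn1 n (f \+ g).
Proof.
elim: n f g => [|n IH] f g; first by move=> cf cg x; apply: cvgD; [exact: cf|exact: cg].
move=> [df Cf] [dg Cg]; split=> [x|]; first by apply: derivableD.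
rewrite (_ : derive1 _ = derive1 f \+ derive1 g); first exact: IH.
apply/funext => x; rewrite derive1E deriveD; [|exact: df|exact: dg].
by rewrite -!derive1E.
Qed.

Lemma Cn1M n f g : Cn1 n f -> Cn1 n g -> Cn1 n (f \* g).
Proof.
elim: n f g => [|n IH] f g; first by move=> cf cg x; apply: cvgM; [exact: cf|exact: cg].
move=> Cf Cg; have [df df'] := Cf; have [dg dg'] := Cg.
split=> [x|]; first by apply: derivableM.
rewrite (_ : derive1 _ = (f \* derive1 g) \+ (g \* derive1 f)).
  by apply: Cn1D; apply: IH => //; exact: Cn1W.
apply/funext => x; rewrite derive1E deriveM; [|exact: df|exact: dg].
by rewrite -!derive1E.
Qed.

Lemma Cn1V n f : (forall x, f x != 0) -> Cn1 n f -> Cn1 n (fun x => (f x)^-1).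
Proof.
move=> f0; elim: n => [|n IH]; first by move=> cf x; apply: cvgV => //; exact: cf.
move=> Cf; have [df df'] := Cf.
split=> [x|]; first by apply: derivableV.
rewrite (_ : derive1 _ =
  (cst (-1) \* (derive1 f \* ((fun x => (f x)^-1) \* (fun x => (f x)^-1))))).
  apply: Cn1M; first exact: Cn1_cst.
  by apply: Cn1M => //; apply: Cn1M; apply: IH; exact: Cn1W.
apply/funext => x; rewrite derive1E deriveV//= derive1E -exprVn expr2 mulN1r.
by rewrite /GRing.scale/= mulNr mulrC.
Qed.

Lemma is_derive_affine f (a b x d : R) : is_derive (a * x + b) (1:R) f d ->
  is_derive x (1:R) (fun y => f (a * y + b)) (a * d).
Proof.
move=> df.
have Dg : is_derive x (1:R) (fun y => a * y + b) a.
  have := is_deriveD (is_deriveZ a (is_derive_id x (1:R))) (is_derive_cst b x (1:R)).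
  by rewrite addr0 /GRing.scale/= mulr1.
by have := @is_derive1_comp _ f _ x _ _ df Dg; rewrite mulrC.
Qed.

Lemma Cn1_affine n f (a b : R) : Cn1 n f -> Cn1 n (fun x => f (a * x + b)).
Proof.
elim: n f => [|n IH] f.
  move=> cf x; apply: continuous_comp; last exact: cf.
  by apply: cvgD; [apply: cvgMr; exact: cvg_id|exact: cvg_cst].
move=> [df df'].
have D x : is_derive x (1:R) (fun y => f (a * y + b)) (a * derive1 f (a * x + b)).
  by apply: is_derive_affine; rewrite derive1E; exact: derivableP.
split=> [x|]; first exact: ex_derive.
rewrite (_ : derive1 _ = cst a \* (fun x => derive1 f (a * x + b))).
  by apply: Cn1M; [exact: Cn1_cst|exact: IH].
by apply/funext => x; rewrite derive1E derive_val.
Qed.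

(** The functions p(1/x) exp(-1/x), prolonged by 0 to x <= 0, are closed under
    derivation, hence infinitely derivable; polynomials [p] are allowed
    precisely for that closure. *)
Definition flat (p : {poly R}) (x : R) : R :=
  if 0 < x then p.[x^-1] * expR (- x^-1) else 0.

Lemma pow_expR_bound n (y : R) : 0 < y -> y ^+ n * expR (- y) <= n%:R ^+ n.
Proof.
move=> y0; rewrite expRN -ler_pdivlMr ?invr_gt0 ?expR_gt0// invrK.
case: n => [|n]; first by rewrite !expr0 mul1r -expR0 ler_expR ltW.
have n0 : 0 < n.+1%:R :> R by [].
have -> : expR y = expR (y / n.+1%:R) ^+ n.+1.
  by rewrite -expRM_natl mulrC divfK// gt_eqF.
rewrite -exprMn; apply: lerXn2r; rewrite ?nnegrE ?mulr_ge0 ?expR_ge0//.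
  exact: ltW.
rewrite -ler_pdivrMl// [leLHS]mulrC; apply: le_trans (expR_ge1Dx _).
by rewrite lerDr.
Qed.

Lemma flat_bound (p : {poly R}) k : exists2 C, 0 <= C &
  forall y, 0 < y -> `|y ^+ k * p.[y] * expR (- y)| <= C * y^-1 ^+ 2.
Proof.
elim/poly_ind: p k => [|p c IH] k.
  by exists 0 => // y y0; rewrite horner0 mulr0 !mul0r normr0.
have [C C0 HC] := IH k.+1.
exists (C + `|c| * k.+2%:R ^+ k.+2); first by rewrite addr_ge0// mulr_ge0.
move=> y y0; rewrite hornerD hornerM hornerX hornerC.
rewrite (_ : y ^+ k * _ * _ = y ^+ k.+1 * p.[y] * expR (- y)
  + c * (y ^+ k * expR (- y))); last by rewrite exprS; ring.
apply: le_trans (ler_normD _ _) _; rewrite mulrDl; apply: lerD; first exact: HC.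
rewrite normrM -mulrA; apply: ler_wpM2l => //.
rewrite ger0_norm; last by rewrite mulr_ge0 ?expR_ge0// exprn_ge0 ?ltW.
rewrite exprVn ler_pdivlMr ?exprn_gt0//.
have := pow_expR_bound k.+2 y0; rewrite !exprS; lra.
Qed.

(** A quadratic bound is all that derivability at 0 requires. *)
Lemma flat_quad (p : {poly R}) : exists2 C, 0 <= C &
  forall x, `|flat p x| <= C * x ^+ 2.
Proof.
have [C C0 H] := flat_bound p 0; exists C => // x; rewrite /flat.
case: ltP => x0; last by rewrite normr0 mulr_ge0// sqr_ge0.
by have := H x^-1; rewrite invr_gt0 expr0 mul1r invrK; exact.
Qed.

Lemma flat_derive_pos (p : {poly R}) (x : R) : 0 < x ->
  is_derive x (1:R) (fun x => p.[x^-1] * expR (- x^-1))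
    (flat ('X^2 * (p - p^`())) x).
Proof.
move=> x0; have xn0 : x != 0 by rewrite gt_eqF.
have dV : is_derive x (1:R) (fun x : R => x^-1) (- x ^- 2).
  have := is_deriveV xn0 (is_derive_id x (1:R)).
  by rewrite /GRing.scale/= mulr1.
have dp : is_derive x^-1 (1:R) (horner p) p^`().[x^-1].
  exact: is_derive_poly.
have d1 := @is_derive1_comp _ (horner p) GRing.inv x _ _ dp dV.
have dN : is_derive x (1:R) (fun x : R => - x^-1) (- - x ^- 2).
  exact: is_deriveN.
have d2 := @is_derive1_comp _ expR (fun x : R => - x^-1) x _ _ (is_derive_expR _) dN.
apply: is_derive_rval (is_deriveM d1 d2) _.
rewrite /flat x0 /= /GRing.scale/= hornerM hornerXn hornerD hornerN; field.
by [].
Qed.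

Lemma flat_derive (p : {poly R}) (x : R) :
  is_derive x (1:R) (flat p) (flat ('X^2 * (p - p^`())) x).
Proof.
case: (ltgtP x 0) => [x0|x0|->].
- rewrite /flat ltNge (ltW x0)/=.
  have E : \forall y \near x, cst 0 y = flat p y.
    near=> y; rewrite /flat ltNge; suff -> : y <= 0 by [].
    by apply: ltW; near: y; exact: lt_nbhsl.
  exact: (near_eq_is_derive E).
- have E : \forall y \near x, p.[y^-1] * expR (- y^-1) = flat p y.
    near=> y; rewrite /flat; suff -> : 0 < y by [].
    by near: y; exact: lt_nbhsr.
  apply: (near_eq_is_derive E); exact: flat_derive_pos.
- rewrite {2}/flat ltxx.
  have [C C0 H] := flat_quad p.
  have cv : h^-1 *: ((flat p \o shift 0) (h *: (1:R)) - flat p 0) @[h --> 0^'] --> (0:R).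
    have -> : flat p 0 = 0 by rewrite /flat ltxx.
    apply/cvgrPdist_le => e e0.
    near=> h.
    have h0 : h != 0 by near: h; exact: nbhs_dnbhs_neq.
    rewrite sub0r normrN subr0 /= addr0 /GRing.scale/= mulr1 normrM normfV.
    rewrite ler_pdivrMl ?normr_gt0//.
    apply: le_trans (H h) _.
    rewrite -(real_normK (num_real h)) expr2 mulrCA.
    apply: ler_wpM2l => //.
    apply: (@le_trans _ _ ((C + 1) * `|h|)).
      by apply: ler_wpM2r => //; rewrite lerDl.
    rewrite -ler_pdivlMl; last by rewrite ltr_pwDr.
    near: h; apply: dnbhs0_le; rewrite mulr_gt0 ?invr_gt0//.
    by rewrite ltr_pwDr.
  by apply: DeriveDef; [apply/cvg_ex; exists 0|exact/cvg_lim].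
Unshelve. all: by end_near. Qed.

Lemma Cn1_flat n p : Cn1 n (flat p).
Proof.
elim: n p => [|n IH] p.
  by apply: derivable_continuous => x; have := flat_derive p x => -[].
split=> [x|]; first by have := flat_derive p x => -[].
rewrite (_ : derive1 _ = flat ('X^2 * (p - p^`())))//.
by apply/funext => x; rewrite derive1E; have := flat_derive p x => -[].
Qed.

(** A smooth step from 0 to 1, constant outside [0, 1]. *)
Definition sstep (x : R) : R := flat 1 x / (flat 1 x + flat 1 (1 - x)).

Lemma flat1_gt0 x : 0 < x -> 0 < flat 1 x.
Proof. by move=> x0; rewrite /flat x0 hornerC mul1r expR_gt0. Qed.

Lemma flat1_ge0 x : 0 <= flat 1 x.
Proof. by rewrite /flat; case: ifP => // _; rewrite hornerC mul1r expR_ge0. Qed.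

Lemma flat_le0 p x : x <= 0 -> flat p x = 0.
Proof. by rewrite /flat ltNge => ->. Qed.

Lemma sstep_den_gt0 x : 0 < flat 1 x + flat 1 (1 - x).
Proof.
have [x0|x0] := ltP 0 x; first by rewrite ltr_pwDl ?flat1_gt0 ?flat1_ge0.
by rewrite ltr_pwDr ?flat1_ge0// flat1_gt0// subr_gt0 (le_lt_trans x0).
Qed.

Lemma Cn1_sstep n : Cn1 n sstep.
Proof.
apply: Cn1M; first exact: Cn1_flat.
apply: Cn1V => [x|]; first by rewrite gt_eqF// sstep_den_gt0.
apply: Cn1D; first exact: Cn1_flat.
rewrite (_ : (fun x => flat 1 (1 - x)) = fun x => flat 1 (-1 * x + 1)).
  exact: Cn1_affine (Cn1_flat _ _).
by apply/funext => x; rewrite mulN1r addrC.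
Qed.

Lemma sstep_le0 x : x <= 0 -> sstep x = 0.
Proof. by move=> x0; rewrite /sstep flat_le0 ?mul0r. Qed.

Lemma sstep_ge1 x : 1 <= x -> sstep x = 1.
Proof.
move=> x1; rewrite /sstep (@flat_le0 _ (1 - x)) ?subr_le0// addr0 mulfV//.
by rewrite gt_eqF// flat1_gt0// (lt_le_trans _ x1).
Qed.

(** As a derivative of a step, the bump has integral 1 without any
    normalisation. *)
Definition bump : R -> R := derive1 sstep.

Lemma Cn1_bump n : Cn1 n bump.
Proof. by have [] := Cn1_sstep n.+1. Qed.

Lemma derive_sstep x : is_derive x (1:R) sstep (bump x).
Proof. by rewrite /bump derive1E; apply: derivableP; have [] := Cn1_sstep 1. Qed.

Lemma locally_cst_derive1 f x c : (\forall y \near x, f y = c) -> derive1 f x = 0.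
Proof.
move=> H; rewrite derive1E (near_eq_derive _ (g := cst c)) ?derive_cst//.
Qed.

Lemma bump_lt0 x : x < 0 -> bump x = 0.
Proof.
move=> x0; apply: (@locally_cst_derive1 _ _ 0).
by near=> y; apply: sstep_le0; apply: ltW; near: y; exact: lt_nbhsl.
Unshelve. all: by end_near. Qed.

Lemma bump_gt1 x : 1 < x -> bump x = 0.
Proof.
move=> x0; apply: (@locally_cst_derive1 _ _ 1).
by near=> y; apply: sstep_ge1; apply: ltW; near: y; exact: lt_nbhsr.
Unshelve. all: by end_near. Qed.

End smooth.

(** * Integrals over the rectangle *)

Section plane.
Context {R : realType}.
Local Notation mu := (@lebesgue_measure R).
Local Notation mu2 := (lebesgue_measure \x lebesgue_measure)%E.
Implicit Types (f : R * R -> R).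

Let rect (a b c d : rat) : set (R * R) :=
  `]ratr a, ratr b[%classic `*` `]ratr c, ratr d[%classic.

(** Continuous functions of the plane are measurable for the product
    sigma-algebra because open sets are countable unions of rational
    rectangles. *)
Lemma open_rect_cover (O : set (R * R)) : open O ->
  O = \bigcup_a \bigcup_b \bigcup_c \bigcup_d
    [set p | rect a b c d p /\ rect a b c d `<=` O].
Proof.
move=> oO; apply/seteqP; split; last first.
  by move=> p [a _ [b _ [c _ [d _ [pr sub]]]]]; exact: sub.
move=> [t x] Op.
have : nbhs (t, x) O by apply: open_nbhs_nbhs.
move=> /nbhs_ballP[e /= e0 sub].
have rat_between (y : R) (z : R) : y < z -> exists q : rat, y < ratr q /\ ratr q < z.
  by move=> /rat_in_itvoo[q]; rewrite in_itv/= => /andP[? ?]; exists q.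
have [a [a1 a2]] : exists q : rat, t - e < ratr q /\ ratr q < t by apply: rat_between; lra.
have [b [b1 b2]] : exists q : rat, t < ratr q /\ ratr q < t + e by apply: rat_between; lra.
have [c [c1 c2]] : exists q : rat, x - e < ratr q /\ ratr q < x by apply: rat_between; lra.
have [d [d1 d2]] : exists q : rat, x < ratr q /\ ratr q < x + e by apply: rat_between; lra.
exists a => //; exists b => //; exists c => //; exists d => //; split.
  by rewrite /rect/= !in_itv/= a2 b1 c2 d1.
move=> [t' x']; rewrite /rect/= !in_itv/= => -[/andP[h1 h2] /andP[h3 h4]].
apply: sub; split; rewrite /ball/= ltr_norml; apply/andP; split; lra.
Qed.

Lemma continuous_measurable2 f : continuous f -> measurable_fun setT f.
Proof.
move=> cf; apply: (measurability _ (RGenOInfty.measurableE R)) => //= _ [_ [r ->] <-].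
rewrite setTI.
have oO : open (f @^-1` `]r, +oo[%classic).
  by apply: open_comp => [p _|]; [exact: cf|exact: interval_open].
rewrite (open_rect_cover oO).
apply: bigcupT_measurable_rat => a; apply: bigcupT_measurable_rat => b.
apply: bigcupT_measurable_rat => c; apply: bigcupT_measurable_rat => d.
have [H|H] := pselect (rect a b c d `<=` f @^-1` `]r, +oo[).
  rewrite (_ : [set _ | _] = rect a b c d); last by apply/seteqP; split => p //= [].
  by apply: measurableX; exact: measurable_itv.
rewrite (_ : [set _ | _] = set0); last by apply/seteqP; split => p //= [].
exact: measurable0.
Qed.

Lemma continuous_slice f t : continuous f -> continuous (fun x => f (t, x)).
Proof.
move=> cf x; apply: (@continuous_comp _ _ _ (fun x => (t, x)) f); last exact: cf.
by apply: (@cvg_pair _ _ _ _ (nbhs t) (nbhs x) _ _ _ (cst t) id); [exact: cvg_cst|exact: cvg_id].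
Qed.

Lemma continuous_bounded_rect f T l : continuous f ->
  exists2 M, 0 <= M & forall t x, t \in `[0, T] -> x \in `[0, l] -> `|f (t, x)| <= M.
Proof.
move=> cf.
have cK : compact (`[0, T]%classic `*` `[0, l]%classic : set (R * R)).
  by apply: compact_setX; exact: segment_compact.
have /compact_bounded[M [Mr HM]] : compact (f @` (`[0, T]%classic `*` `[0, l]%classic)).
  by apply: continuous_compact => //; exact: continuous_subspaceT.
exists (`|M| + 1); first by rewrite addr_ge0.
move=> t x tT xl; apply: HM; first by rewrite (le_lt_trans (ler_norm M))// ltrDl.
by exists (t, x).
Qed.

Lemma mu_oo (a b : R) : a <= b -> mu `]a, b[%classic = (b - a)%:E.
Proof.
move=> ab; rewrite lebesgue_measure_itv/= lte_fin; case: ltP => [_|ba].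
  by rewrite -EFinB.
by rewrite (_ : a = b) ?subrr//; apply/eqP; rewrite eq_le ab ba.
Qed.

Lemma continuous_integrable_oo (u : R -> R) a b : continuous u ->
  mu.-integrable `]a, b[ (EFin \o u).
Proof.
move=> cu; apply: integrableS (continuous_itv_integrable a b cu) => //.
by move=> x /=; rewrite !in_itv/= => /andP[/ltW-> /ltW->].
Qed.

Definition Om (T l : R) : set (R * R) := `]0, T[%classic `*` `]0, l[%classic.

Lemma measurable_Om T l : measurable (Om T l).
Proof. by apply: measurableX; exact: measurable_itv. Qed.

Lemma mu2_Om T l : 0 < T -> 0 < l -> mu2 (Om T l) = (T * l)%:E.
Proof.
move=> T0 l0; rewrite product_measure1E; [|exact: measurable_itv..].
by have := congr2 mule (mu_oo (ltW T0)) (mu_oo (ltW l0)); rewrite !subr0.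
Qed.

Lemma integrable_Om T l f : 0 < T -> 0 < l -> continuous f ->
  mu2.-integrable (Om T l) (EFin \o f).
Proof.
move=> T0 l0 cf; apply: measurable_bounded_integrable.
- exact: measurable_Om.
- apply: (@le_lt_trans _ _ (T * l)%:E); last exact: ltry.
  by have <- := mu2_Om T0 l0.
- exact: measurable_funTS (continuous_measurable2 cf).
- have [M M0 HM] := continuous_bounded_rect T l cf.
  exists M; split; first exact: num_real.
  move=> z Mz [t x] []; rewrite /= !in_itv/= => /andP[t0 tT] /andP[x0 xl].
  by apply: ltW; apply: le_lt_trans Mz; apply: HM; rewrite in_itv/= !ltW.
Qed.

Definition slice_int (l : R) f (t : R) : R := \int[mu]_(x in `]0, l[) f (t, x).

(** From here on, integrals over the rectangle are iterated ones, for which the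
    fundamental theorem of calculus is available. *)
Lemma fubini_Om T l f : 0 < T -> 0 < l -> continuous f ->
  mu.-integrable `]0, T[ (EFin \o slice_int l f) /\
  (\int[mu2]_(p in Om T l) (f p)%:E =
   (\int[mu]_(t in `]0, T[) slice_int l f t)%:E)%E.
Proof.
move=> T0 l0 cf.
have mO := measurable_Om T l.
have fint := integrable_Om T0 l0 cf.
pose F : R * R -> \bar R := (EFin \o f) \_ (Om T l).
have Fint : mu2.-integrable setT F by rewrite /F -integrable_mkcond.
have inner t : (\int[mu]_x F (t, x))%E = ((EFin \o slice_int l f) \_ `]0, T[) t.
  rewrite patchE; case: ifPn => tT.
    rewrite /= /slice_int /Rintegral fineK; last first.
      have := continuous_integrable_oo 0 l (continuous_slice (t := t) cf).
      by move=> /integrable_fin_num; apply.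
    rewrite [RHS]integral_mkcond; apply: eq_integral => x _.
    rewrite /F !patchE; congr (if _ then _ else _).
    by rewrite /Om in_setX tT.
  rewrite (eq_integral (cst 0%E)) ?integral0// => x _.
  by rewrite /F patchE /Om in_setX (negbTE tT).
have E := integral12_prod_meas1 Fint.
have I := integrable_fubini_F Fint.
have I2 : mu.-integrable `]0, T[ (EFin \o slice_int l f).
  rewrite integrable_mkcond; last exact: measurable_itv.
  by apply: eq_integrable I => // t _; exact: inner.
split => //.
rewrite [LHS]integral_mkcond -[LHS]E.
rewrite /Rintegral fineK; last exact: integrable_fin_num I2.
rewrite [RHS]integral_mkcond; apply: eq_integral => t _; exact: inner.
Qed.
End plane.

(** * Test functions carried at constant speed *)

Section test_functions.
Context {R : realType}.
Local Notation mu := (@lebesgue_measure R).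
Implicit Types (A B : R -> R) (phi : R * R -> R).

Lemma ftc_oo (F f : R -> R) a b : a < b -> (forall x, is_derive x (1:R) F (f x)) ->
  continuous f -> (\int[mu]_(x in `]a, b[) f x = F b - F a)%R.
Proof.
move=> ab dF cf.
have dF' x : derivable F x 1 by have [] := dF x.
have cF := derivable_continuous dF'.
rewrite Rintegral_itv_bndo_bndc ?Rintegral_itv_obnd_cbnd; last 2 first.
- apply: integrableS (continuous_itv_integrable a b cf) => //.
  by move=> x /=; rewrite !in_itv/= => /andP[/ltW-> ->].
- exact: continuous_integrable_oo.
rewrite /Rintegral (@continuous_FTC2 R f F)//.
- exact: continuous_subspaceT.
- split.
  + by move=> x _; exact: dF'.
  + by apply: cvg_at_right_filter; exact: cF.
  + by apply: cvg_at_left_filter; exact: cF.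
- by move=> x _; rewrite derive1E; have [] := dF x.
Qed.

Lemma int_supp_bound (g : R -> R) (a b s0 s1 m : R) : 0 <= m -> s0 <= s1 ->
  mu.-integrable `]a, b[ (EFin \o g) ->
  (forall t, t \in `]a, b[ -> `|g t| <= m) ->
  (forall t, t \in `]a, b[ -> t < s0 \/ s1 < t -> g t = 0) ->
  `|\int[mu]_(t in `]a, b[) g t| <= m * (s1 - s0).
Proof.
move=> m0 s01 ig gm g0.
have mD : measurable (`]a, b[%classic : set R) by exact: measurable_itv.
apply: le_trans (le_normr_Rintegral _ _) _ => //.
rewrite -lee_fin /Rintegral fineK; last first.
  have /integrableP[mf ifi] := ig.
  by rewrite ge0_fin_numE//; apply: integral_ge0 => t _; rewrite lee_fin.
apply: (@le_trans _ _ (\int[mu]_(t in `]a, b[) (m%:E * (\1_`[s0, s1] t)%:E))%E).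
  apply: ge0_le_integral => //.
  - have /integrableP[/measurable_EFinP mf _] := ig.
    by apply/measurable_EFinP; exact: measurableT_comp.
  - apply/measurable_EFinP; apply: measurable_funM; first exact: measurable_cst.
    by apply: measurable_indic; exact: measurable_itv.
  - move=> t tab; rewrite -EFinM lee_fin indicE.
    have [ts|ts] := boolP (t \in `[s0, s1]).
      by rewrite mem_set//= mulr1; exact: gm.
    rewrite memNset//= ?mulr0; last by move=> /= ts'; rewrite ts' in ts.
    rewrite (g0 t tab) ?normr0//.
    by move: ts; rewrite in_itv/= negb_and -!ltNge => /orP.
rewrite ge0_integralZl//; last first.
  apply/measurable_EFinP; apply: measurable_indic; exact: measurable_itv.
rewrite integral_indic//.
rewrite EFinM; apply: lee_wpmul2l; first by rewrite lee_fin.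
have -> : (s1 - s0)%:E = mu `[s0, s1]%classic.
  rewrite lebesgue_measure_itv/= lte_fin; case: ltP => [_|s10].
    by rewrite -EFinB.
  by rewrite (_ : s0 = s1) ?subrr//; apply/eqP; rewrite eq_le s01 s10.
apply: le_measure; rewrite ?inE; last exact: subIsetl.
- by apply: measurableI; exact: measurable_itv.
- exact: measurable_itv.
Qed.

Lemma is_derive_partial_t phi t x d :
  is_derive t (1:R) (fun s => phi (s, x)) d -> is_derive (t, x) ((1, 0) : R * R) phi d.
Proof.
have E h : (phi \o shift (t, x)) (h *: ((1, 0) : R * R)) =
  ((fun s => phi (s, x)) \o shift t) (h *: (1:R)).
  by rewrite /= /GRing.scale/= /scale_pair/= /GRing.add/= /add_pair/= /GRing.scale/= mulr0 add0r.
move=> [df <-]; split.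
  by move: df; rewrite /derivable; under eq_fun do rewrite -E.
by rewrite /derive; congr (lim _); under eq_fun do rewrite E.
Qed.

Lemma is_derive_partial_x phi t x d :
  is_derive x (1:R) (fun y => phi (t, y)) d -> is_derive (t, x) ((0, 1) : R * R) phi d.
Proof.
have E h : (phi \o shift (t, x)) (h *: ((0, 1) : R * R)) =
  ((fun y => phi (t, y)) \o shift x) (h *: (1:R)).
  by rewrite /= /GRing.scale/= /scale_pair/= /GRing.add/= /add_pair/= /GRing.scale/= mulr0 add0r.
move=> [df <-]; split.
  by move: df; rewrite /derivable; under eq_fun do rewrite -E.
by rewrite /derive; congr (lim _); under eq_fun do rewrite E.
Qed.

(** A profile [B] carried at speed [k], with amplitude [A] in time. *)
Definition moving A B (k : R) : R * R -> R := fun p => A p.1 * B (p.2 - k * p.1).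

Lemma moving_partial_x A B (k : R) (p : R * R) (d : R) : is_derive (p.2 - k * p.1) (1:R) B d ->
  is_derive p ((0, 1) : R * R) (moving A B k) (A p.1 * d).
Proof.
case: p => t x /= dB; apply: is_derive_partial_x; rewrite /moving/=.
have := is_derive_affine (a := 1) (b := - (k * t)) (x := x).
rewrite mul1r => /(_ _ _ dB) H.
have := is_deriveZ (A t) H; rewrite mul1r; congr (is_derive _ _ _ _).
by apply/funext => y /=; rewrite mul1r.
Qed.

Lemma moving_partial_t A B (k : R) (p : R * R) (dA dB : R) : is_derive p.1 (1:R) A dA ->
  is_derive (p.2 - k * p.1) (1:R) B dB ->
  is_derive p ((1, 0) : R * R) (moving A B k)
    (dA * B (p.2 - k * p.1) - k * (A p.1 * dB)).
Proof.
case: p => t x /= HA HB; apply: is_derive_partial_t; rewrite /moving/=.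
have := is_derive_affine (a := - k) (b := x) (x := t).
rewrite mulNr addrC => /(_ _ _ HB) H.
have := is_deriveM HA H => H2.
have E : (A * (fun y => B (- k * y + x))) = (fun s => A s * B (x - k * s)).
  by apply/funext => y; rewrite (_ : x - k * y = - k * y + x)//; ring.
rewrite E in H2; apply: is_derive_rval H2 _.
by rewrite /GRing.scale/= (_ : - k * t + x = x - k * t); ring.
Qed.

Lemma continuous_moving A B k : continuous A -> continuous B -> continuous (moving A B k).
Proof.
move=> cA cB p; rewrite /moving; apply: cvgM.
  by apply: (@continuous_comp _ _ _ fst A); [exact: cvg_fst|exact: cA].
apply: (@continuous_comp _ _ _ (fun p : R * R => p.2 - k * p.1) B); last exact: cB.
apply: cvgB; first exact: cvg_snd.
by apply: cvgMr; exact: cvg_fst.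
Qed.

Lemma is_Cn_add n phi psi : is_Cn n phi -> is_Cn n psi -> is_Cn n (phi \+ psi).
Proof.
elim: n phi psi => [|n IH] phi psi /= [c1 H1] [c2 H2].
  by split => // p; apply: cvgD; [exact: c1|exact: c2].
split; first by move=> p; apply: cvgD; [exact: c1|exact: c2].
have [t1 x1 T1 X1] := H1; have [t2 x2 T2 X2] := H2; split.
- by move=> p; apply: derivableD.
- by move=> p; apply: derivableD.
- rewrite (_ : partial_t _ = partial_t phi \+ partial_t psi); first exact: IH.
  by apply/funext => p; rewrite /partial_t deriveD.
- rewrite (_ : partial_x _ = partial_x phi \+ partial_x psi); first exact: IH.
  by apply/funext => p; rewrite /partial_x deriveD.
Qed.

Lemma partial_x_moving A B k : (forall x, derivable B x 1) ->
  partial_x (moving A B k) = moving A (derive1 B) k.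
Proof.
move=> dB; apply/funext => p; rewrite /partial_x /moving derive1E.
by have [_ ->] := moving_partial_x A (derivableP (dB (p.2 - k * p.1))).
Qed.

Lemma partial_t_moving A B k : (forall x, derivable A x 1) -> (forall x, derivable B x 1) ->
  partial_t (moving A B k) =
  moving (derive1 A) B k \+ moving (cst (- k) \* A) (derive1 B) k.
Proof.
move=> dA dB; apply/funext => p; rewrite /partial_t.
have [_ ->] := moving_partial_t (derivableP (dA p.1)) (derivableP (dB (p.2 - k * p.1))).
by rewrite /moving/= !derive1E !mulNr -mulrA.
Qed.

(** Both partial derivatives of such a product are sums of products of the same
    form, whence the induction. *)
Lemma is_Cn_moving n A B k : (forall m, Cn1 m A) -> (forall m, Cn1 m B) ->
  is_Cn n (moving A B k).
Proof.
elim: n A B => [|n IH] A B CA CB.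
  by split=> //; apply: continuous_moving; [exact: CA 0%N|exact: CB 0%N].
have dA := (CA 1%N).1; have dB := (CB 1%N).1.
have CA' m : Cn1 m (derive1 A) by have [] := CA m.+1.
have CB' m : Cn1 m (derive1 B) by have [] := CB m.+1.
split; first by apply: continuous_moving; [exact: CA 0%N|exact: CB 0%N].
split.
- move=> p.
  by have [] := moving_partial_t (derivableP (dA p.1)) (derivableP (dB (p.2 - k * p.1))).
- by move=> p; have [] := moving_partial_x A (derivableP (dB (p.2 - k * p.1))).
- rewrite partial_t_moving//; apply: is_Cn_add; apply: IH => // m.
  by apply: Cn1M => //; exact: Cn1_cst.
- by rewrite partial_x_moving//; exact: IH.
Qed.

End test_functions.

Section plane_integral.
Context {R : realType}.
Local Notation mu := (@lebesgue_measure R).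
Implicit Types (f g : R * R -> R) (A B : R -> R).

Lemma continuous2D f g : continuous f -> continuous g -> continuous (fun p => f p + g p).
Proof. by move=> cf cg p; apply: cvgD; [exact: cf|exact: cg]. Qed.

Lemma continuous2B f g : continuous f -> continuous g -> continuous (fun p => f p - g p).
Proof. by move=> cf cg p; apply: cvgB; [exact: cf|exact: cg]. Qed.

Lemma continuous2M f g : continuous f -> continuous g -> continuous (fun p => f p * g p).
Proof. by move=> cf cg p; apply: cvgM; [exact: cf|exact: cg]. Qed.

Lemma continuous2C (c : R) : continuous (fun _ : R * R => c).
Proof. by move=> p; exact: cvg_cst. Qed.

Lemma continuous2_1 A : continuous A -> continuous (fun p : R * R => A p.1).
Proof.
by move=> cA p; apply: (@continuous_comp _ _ _ fst A); [exact: cvg_fst|exact: cA].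
Qed.

Lemma continuous2_mv B (k : R) : continuous B ->
  continuous (fun p : R * R => B (p.2 - k * p.1)).
Proof.
move=> cB p; apply: (@continuous_comp _ _ _ (fun p : R * R => p.2 - k * p.1) B); last exact: cB.
apply: cvgB; first exact: cvg_snd.
by apply: cvgMr; exact: cvg_fst.
Qed.

Definition int2 (T l : R) f : R := \int[mu]_(t in `]0, T[) slice_int l f t.

Lemma int2_Om T l f : 0 < T -> 0 < l -> continuous f ->
  (\int[lebesgue_measure \x lebesgue_measure]_(p in Om T l) (f p)%:E = (int2 T l f)%:E)%E.
Proof. by move=> T0 l0 cf; have [_ ->] := fubini_Om T0 l0 cf. Qed.

Lemma int2D T l f g : 0 < T -> 0 < l -> continuous f -> continuous g ->
  int2 T l (fun p => f p + g p) = int2 T l f + int2 T l g.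
Proof.
move=> T0 l0 cf cg; apply: EFin_inj.
apply: etrans (esym (int2_Om T0 l0 (continuous2D cf cg))) _.
apply: (@etrans _ _ (\int[lebesgue_measure \x lebesgue_measure]_(p in Om T l) (f p)%:E + \int[lebesgue_measure \x lebesgue_measure]_(p in Om T l) (g p)%:E)%E);
  last by rewrite (int2_Om T0 l0 cf) (int2_Om T0 l0 cg) EFinD.
rewrite -integralD; first by apply: eq_integral => p _; rewrite EFinD.
- exact: measurable_Om.
- exact: integrable_Om.
- exact: integrable_Om.
Qed.

Lemma int2Z T l (c : R) f : 0 < T -> 0 < l -> continuous f ->
  int2 T l (fun p => c * f p) = c * int2 T l f.
Proof.
move=> T0 l0 cf; apply: EFin_inj.
apply: etrans (esym (int2_Om T0 l0 (continuous2M (@continuous2C c) cf))) _.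
apply: (@etrans _ _ (c%:E * \int[lebesgue_measure \x lebesgue_measure]_(p in Om T l) (f p)%:E)%E);
  last by rewrite (int2_Om T0 l0 cf) EFinM.
rewrite -integralZl; first by apply: eq_integral => p _; rewrite EFinM.
- exact: measurable_Om.
- exact: integrable_Om.
Qed.

(** An integrand supported in a time interval and in a strip of slope [k] and
    width [e]: the strip has width [e] on each time slice, whatever [k]. *)
Lemma int2_bound T l f (k s0 s1 c e m : R) : 0 < T -> 0 < l -> continuous f ->
  0 <= m -> 0 <= e -> s0 <= s1 -> (forall p, `|f p| <= m) ->
  (forall p, p.1 < s0 \/ s1 < p.1 -> f p = 0) ->
  (forall p, p.2 - k * p.1 < c \/ c + e < p.2 - k * p.1 -> f p = 0) ->
  `|int2 T l f| <= m * e * (s1 - s0).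
Proof.
move=> T0 l0 cf m0 e0 s01 fm ft fx; have [fi _] := fubini_Om T0 l0 cf.
apply: int_supp_bound => //; first exact: mulr_ge0.
- move=> t _.
  have -> : e = (c + k * t + e) - (c + k * t) by lra.
  apply: int_supp_bound => //.
  + lra.
  + exact: continuous_integrable_oo (continuous_slice (t := t) cf).
  + by move=> x _ [h|h]; apply: fx => /=; [left|right]; lra.
- move=> t _ H; rewrite /slice_int.
  have -> : (fun x => f (t, x)) = cst 0 by apply/funext => x; exact: ft.
  by rewrite Rintegral_cst ?mul0r//; exact: measurable_itv.
Qed.

End plane_integral.

(** * From the weak equations to transport along lines *)

Section weak_transport.
Context {R : realType}.
Local Notation mu := (@lebesgue_measure R).
Implicit Types (H V : R * R -> R).

Lemma sstep_ge0 (x : R) : 0 <= sstep x.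
Proof. by rewrite /sstep divr_ge0 ?flat1_ge0// ltW// sstep_den_gt0. Qed.

Lemma sstep_le1 (x : R) : sstep x <= 1.
Proof. by rewrite /sstep ler_pdivrMr ?sstep_den_gt0// mul1r lerDl flat1_ge0. Qed.

Lemma bounded_support01 (f : R -> R) : continuous f ->
  (forall x, x < 0 -> f x = 0) -> (forall x, 1 < x -> f x = 0) ->
  exists2 C, 0 <= C & forall x, `|f x| <= C.
Proof.
move=> cf f0 f1.
have /compact_bounded[M [Mr HM]] : compact (f @` `[0, 1]%classic).
  by apply: continuous_compact; [exact: continuous_subspaceT|exact: segment_compact].
exists (`|M| + 1); first by rewrite addr_ge0.
move=> x; have [x0|x0] := ltP x 0; first by rewrite f0// normr0 addr_ge0.
have [x1|x1] := ltP 1 x; first by rewrite f1// normr0 addr_ge0.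
apply: HM; first by rewrite (le_lt_trans (ler_norm M))// ltrDl.
by exists x => //=; rewrite in_itv/= x0.
Qed.

Lemma bump_bounded : exists2 C : R, 0 <= C &
  forall x : R, `|bump x| <= C /\ `|derive1 bump x| <= C.
Proof.
have [C C0 HC] := bounded_support01 (Cn1_continuous (Cn1_bump 0)) (@bump_lt0 R) (@bump_gt1 R).
have c1 : continuous (derive1 (bump : R -> R)).
  by have [_] := @Cn1_bump R 1.
have [||D D0 HD] := bounded_support01 c1.
- move=> x x0; apply: (@locally_cst_derive1 _ _ _ 0).
  by near=> y; apply: bump_lt0; near: y; exact: lt_nbhsl.
- move=> x x0; apply: (@locally_cst_derive1 _ _ _ 0).
  by near=> y; apply: bump_gt1; near: y; exact: lt_nbhsr.
exists (C + D); first exact: addr_ge0.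
move=> x; split; [apply: le_trans (HC x) _|apply: le_trans (HD x) _].
- by rewrite lerDl.
- by rewrite lerDr.
Unshelve. all: by end_near. Qed.

Lemma derive1_bump_out (x : R) : x < 0 \/ 1 < x -> derive1 bump x = 0.
Proof.
case=> x0; apply: (@locally_cst_derive1 _ _ _ 0); near=> y.
- by apply: bump_lt0; near: y; exact: lt_nbhsl.
- by apply: bump_gt1; near: y; exact: lt_nbhsr.
Unshelve. all: by end_near. Qed.

Lemma bump_out (x : R) : x < 0 \/ 1 < x -> bump x = 0.
Proof. by case=> [/bump_lt0|/bump_gt1]. Qed.

Lemma derive_bump (x : R) : is_derive x (1:R) bump (derive1 bump x).
Proof. by rewrite derive1E; apply: derivableP; have [] := @Cn1_bump R 1. Qed.

Definition glip (L : R) H :=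
  forall p q, `|H p - H q| <= L * (`|p.1 - q.1| + `|p.2 - q.2|).

Lemma glip_continuous L H : glip L H -> continuous H.
Proof.
move=> HL p; apply/cvgrPdist_le => e e0.
have L1 : 0 < `|L| + 1 by rewrite ltr_pwDr.
have d0 : 0 < e / (2 * (`|L| + 1)) by rewrite divr_gt0// mulr_gt0.
near=> q.
have : ball p (e / (2 * (`|L| + 1))) q by near: q; exact: (nbhsx_ballx p _ d0).
move=> [h1 h2].
apply: le_trans (HL _ _) _.
apply: (@le_trans _ _ ((`|L| + 1) * (`|p.1 - q.1| + `|p.2 - q.2|))).
  apply: ler_wpM2r; first by rewrite addr_ge0.
  by rewrite (le_trans (ler_norm L))// lerDl.
rewrite mulrC -ler_pdivlMr//.
have -> : e / (`|L| + 1) = e / (2 * (`|L| + 1)) + e / (2 * (`|L| + 1)).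
  by field; rewrite gt_eqF.
by apply: lerD; apply: ltW.
Unshelve. all: by end_near. Qed.

Lemma convex_gt0 (s u v : R) : 0 <= s -> s <= 1 -> 0 < u -> 0 < v ->
  0 < (1 - s) * u + s * v.
Proof.
rewrite le_eqVlt => /orP[/eqP<- _ u0 _|s0 s1 u0 v0]; first by rewrite subr0 mul0r addr0 mul1r.
by rewrite ltr_wpDl ?mulr_gt0// mulr_ge0 ?subr_ge0// ltW.
Qed.

(** A smooth cut-off of the thin parallelogram of slope [k] which joins (t0,
    x0) to (t1, x0 + k (t1 - t0)). Its profile [cutB] across the strip has
    width [eps] and integral 1; its amplitude [cutA] rises near [t0] and falls
    near [t1], over a time [eps], the derivatives [rho0] and [rho1] of the two
    ramps having integral 1 as well. As [eps] tends to 0, its time derivative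
    sees the values at both ends of the segment, and its derivative across the
    strip integrates to 0 against constants. *)
Section cutoff.
Variables (k t0 t1 x0 eps : R).
Let e := eps^-1.
Let b := - (e * (x0 - k * t0)).

Definition rho0 t := e * bump (e * t + - (e * t0)).
Definition rho1 t := e * bump (e * t + (1 - e * t1)).
Definition cutA t := sstep (e * t + - (e * t0)) - sstep (e * t + (1 - e * t1)).
Definition cutB y := e * bump (e * y + b).
Definition cutB1 y := e * (e * derive1 bump (e * y + b)).
Definition cutSB y := sstep (e * y + b).

Hypothesis eps0 : 0 < eps.
Hypothesis teps : t0 + eps <= t1.

Let e0 : 0 < e. Proof. by rewrite invr_gt0. Qed.
Let eeps : e * eps = 1. Proof. by rewrite mulVf// gt_eqF. Qed.

Let lt0_scale s : s < 0 -> e * s < 0. Proof. by move=> s0; rewrite pmulr_rlt0. Qed.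
Let gt1_scale s : eps < s -> 1 < e * s. Proof. by move=> s0; rewrite -eeps ltr_pM2l. Qed.
Let ge1_scale s : eps <= s -> 1 <= e * s. Proof. by move=> s0; rewrite -eeps ler_pM2l. Qed.
Let le0_scale s : s <= 0 -> e * s <= 0. Proof. by move=> s0; rewrite pmulr_rle0. Qed.

Lemma rho0_out t : t < t0 \/ t0 + eps < t -> rho0 t = 0.
Proof.
move=> h; rewrite /rho0 bump_out ?mulr0// -mulrBr.
by case: h => h; [left; apply: lt0_scale|right; apply: gt1_scale]; lra.
Qed.

Lemma rho1_out t : t < t1 - eps \/ t1 < t -> rho1 t = 0.
Proof.
move=> h; rewrite /rho1 bump_out ?mulr0//.
have -> : e * t + (1 - e * t1) = e * (t - (t1 - eps)) by rewrite -[X in X - _]eeps; ring.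
by case: h => h; [left; apply: lt0_scale|right; apply: gt1_scale]; lra.
Qed.

Lemma cutA_arg1 t : e * t + (1 - e * t1) = e * (t - (t1 - eps)).
Proof. by rewrite -[X in X - _]eeps; ring. Qed.

Lemma cutA_out t : t <= t0 \/ t1 <= t -> cutA t = 0.
Proof.
have teps' := teps; move=> h.
rewrite /cutA cutA_arg1 -mulrBr; case: h => h.
  have -> : sstep (e * (t - t0)) = 0 by apply: sstep_le0; apply: le0_scale; lra.
  have -> : sstep (e * (t - (t1 - eps))) = 0 by apply: sstep_le0; apply: le0_scale; lra.
  exact: subrr.
have -> : sstep (e * (t - t0)) = 1 by apply: sstep_ge1; apply: ge1_scale; lra.
have -> : sstep (e * (t - (t1 - eps))) = 1 by apply: sstep_ge1; apply: ge1_scale; lra.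
exact: subrr.
Qed.

Lemma cutA_le1 t : `|cutA t| <= 1.
Proof.
rewrite /cutA ler_norml; apply/andP; split.
- have := sstep_ge0 (e * t + - (e * t0)); have := sstep_le1 (e * t + (1 - e * t1)); lra.
- have := sstep_le1 (e * t + - (e * t0)); have := sstep_ge0 (e * t + (1 - e * t1)); lra.
Qed.

Lemma cutB_out y : y < x0 - k * t0 \/ x0 - k * t0 + eps < y -> cutB y = 0 /\ cutB1 y = 0.
Proof.
move=> h; have h' : e * y + b < 0 \/ 1 < e * y + b.
  rewrite /b -mulrBr.
  by case: h => h; [left; apply: lt0_scale|right; apply: gt1_scale]; lra.
by rewrite /cutB /cutB1 bump_out// derive1_bump_out// !mulr0.
Qed.

Lemma derive_cutA t : is_derive t (1:R) cutA (rho0 t - rho1 t).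
Proof.
by apply: is_deriveB; apply: is_derive_affine; exact: derive_sstep.
Qed.

Lemma derive_cutSB y : is_derive y (1:R) cutSB (cutB y).
Proof. by apply: is_derive_affine; exact: derive_sstep. Qed.

Lemma derive_cutB y : is_derive y (1:R) cutB (cutB1 y).
Proof.
have H := is_deriveZ e (is_derive_affine (derive_bump (e * y + b))).
exact: H.
Qed.

Lemma Cn1_cutA n : Cn1 n cutA.
Proof.
have := Cn1D (Cn1_affine (n := n) e (- (e * t0)) (Cn1_sstep n))
  (Cn1M (Cn1_cst n (-1)) (Cn1_affine (n := n) e (1 - e * t1) (Cn1_sstep n))).
by congr Cn1; apply/funext => t /=; rewrite mulN1r.
Qed.

Lemma Cn1_cutB n : Cn1 n cutB.
Proof. exact: Cn1M (Cn1_cst n e) (Cn1_affine e b (Cn1_bump n)). Qed.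

Lemma continuous_cutA : continuous cutA.
Proof. exact: Cn1_continuous (Cn1_cutA 0). Qed.

Lemma continuous_cutB : continuous cutB.
Proof. exact: Cn1_continuous (Cn1_cutB 0). Qed.

Lemma continuous_cutB1 : continuous cutB1.
Proof.
have -> : cutB1 = derive1 cutB.
  by apply/funext => y; rewrite derive1E; have [_ ->] := derive_cutB y.
by have [_] := Cn1_cutB 1.
Qed.

Lemma continuous_rho0 : continuous rho0.
Proof. exact: Cn1_continuous (Cn1M (Cn1_cst 0 e) (Cn1_affine e _ (Cn1_bump 0))). Qed.

Lemma continuous_rho1 : continuous rho1.
Proof. exact: Cn1_continuous (Cn1M (Cn1_cst 0 e) (Cn1_affine e _ (Cn1_bump 0))). Qed.

Lemma cut_test (T l : R) : 0 < t0 -> t1 < T -> 0 < x0 -> x0 + eps < l ->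
  0 < x0 + k * (t1 - t0) -> x0 + k * (t1 - t0) + eps < l ->
  test_function (Om T l) (moving cutA cutB k).
Proof.
move=> t00 t1T x00 x0l x10 x1l.
pose K : set (R * R) := [set p | t0 <= p.1 <= t1 /\
  x0 - k * t0 <= p.2 - k * p.1 <= x0 - k * t0 + eps].
have supK : [set p | moving cutA cutB k p != 0] `<=` K.
  move=> [t x] /=; rewrite /moving/= => H; split => /=.
  - apply/andP; split; rewrite leNgt; apply/negP => h.
    + by move: H; rewrite cutA_out ?mul0r ?eqxx//; left; exact: ltW.
    + by move: H; rewrite cutA_out ?mul0r ?eqxx//; right; exact: ltW.
  - apply/andP; split; rewrite leNgt; apply/negP => h.
    + by move: H; have [-> _] := cutB_out (or_introl h); rewrite mulr0 eqxx.
    + by move: H; have [-> _] := cutB_out (or_intror h); rewrite mulr0 eqxx.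
have clK : closed K.
  have -> : K = (fst @^-1` `[t0, t1]%classic) `&`
     ((fun p : R * R => p.2 - k * p.1) @^-1` `[x0 - k * t0, x0 - k * t0 + eps]%classic).
    by apply/seteqP; split => -[t x]; rewrite /K /= !in_itv/=.
  apply: closedI; apply: closed_comp => //; try exact: interval_closed.
  - by move=> p _; exact: cvg_fst.
  - move=> p _; apply: cvgB; first exact: cvg_snd.
    by apply: cvgMr; exact: cvg_fst.
have clsub : closure [set p | moving cutA cutB k p != 0] `<=` K.
  by rewrite [X in _ `<=` X]((closure_id K).1 clK); exact: closure_subset.
have KOm : K `<=` Om T l.
  have teps' := teps; have eps0' := eps0.
  move=> [t x] []; rewrite /= => /andP[h1 h2] /andP[h3 h4].
  split; rewrite /= in_itv/=; apply/andP; first by split; lra.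
  have tt : 0 < t1 - t0 by lra.
  have conv : k * (t - t0) = (t - t0) / (t1 - t0) * (k * (t1 - t0)).
    by field; rewrite gt_eqF.
  set s := (t - t0) / (t1 - t0) in conv.
  have s0 : 0 <= s by rewrite divr_ge0//; lra.
  have s1 : s <= 1 by rewrite ler_pdivrMr//; lra.
  have x1 : x0 + k * (t - t0) <= x by lra.
  have x2 : x <= x0 + k * (t - t0) + eps by lra.
  rewrite conv in x1 x2.
  split.
  - apply: lt_le_trans x1.
    have -> : x0 + s * (k * (t1 - t0)) = (1 - s) * x0 + s * (x0 + k * (t1 - t0)) by ring.
    exact: convex_gt0.
  - apply: (le_lt_trans x2); rewrite -subr_gt0.
    have -> : l - (x0 + s * (k * (t1 - t0)) + eps)
      = (1 - s) * (l - (x0 + eps)) + s * (l - (x0 + k * (t1 - t0) + eps)) by ring.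
    by apply: convex_gt0; rewrite ?subr_gt0.
split.
- by move=> n; apply: is_Cn_moving; [exact: Cn1_cutA|exact: Cn1_cutB].
- apply: (@subclosed_compact _ _ (`[0, T]%classic `*` `[0, l]%classic)).
  + exact: closed_closure.
  + by apply: compact_setX; exact: segment_compact.
  + move=> p /clsub/KOm [] /=; rewrite !in_itv/= => /andP[? ?] /andP[? ?].
    by split=> /=; rewrite ?in_itv/= !ltW.
- by move=> p /clsub; exact: KOm.
Qed.

End cutoff.
End weak_transport.

Section weak_transport2.
Context {R : realType}.
Local Notation mu := (@lebesgue_measure R).
Implicit Types (H V : R * R -> R).

(** The rectangle is convex. *)
Lemma segment_gt0 (k t0 t1 t x0 : R) : t0 < t1 -> t0 <= t -> t <= t1 ->
  0 < x0 -> 0 < x0 + k * (t1 - t0) -> 0 < x0 + k * (t - t0).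
Proof.
move=> t01 h1 h2 x00 x10.
have conv : k * (t - t0) = (t - t0) / (t1 - t0) * (k * (t1 - t0)).
  by field; rewrite subr_eq0 gt_eqF.
have tt : 0 < t1 - t0 by rewrite subr_gt0.
rewrite conv; set s := (t - t0) / (t1 - t0).
have -> : x0 + s * (k * (t1 - t0)) = (1 - s) * x0 + s * (x0 + k * (t1 - t0)) by ring.
apply: convex_gt0 => //; first by rewrite divr_ge0//; lra.
by rewrite ler_pdivrMr//; lra.
Qed.

Lemma int2_window (T l : R) (D : R * R -> R) (r B : R -> R) (k s0 s1 c eps m mr mB : R) :
  0 < T -> 0 < l -> continuous (fun p => D p * (r p.1 * B (p.2 - k * p.1))) ->
  0 <= eps -> s0 <= s1 -> 0 <= m ->
  (forall t, `|r t| <= mr) -> (forall t, t < s0 \/ s1 < t -> r t = 0) ->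
  (forall y, `|B y| <= mB) -> (forall y, y < c \/ c + eps < y -> B y = 0) ->
  (forall p, s0 <= p.1 <= s1 -> c <= p.2 - k * p.1 <= c + eps -> `|D p| <= m) ->
  `|int2 T l (fun p => D p * (r p.1 * B (p.2 - k * p.1)))|
    <= m * (mr * mB) * eps * (s1 - s0).
Proof.
move=> T0 l0 cf eps0 s01 m0 rm r0 Bm B0 Dm.
have mr0 : 0 <= mr := le_trans (normr_ge0 _) (rm 0).
have mB0 : 0 <= mB := le_trans (normr_ge0 _) (Bm 0).
have ft p : p.1 < s0 \/ s1 < p.1 -> D p * (r p.1 * B (p.2 - k * p.1)) = 0.
  by move=> /r0 ->; rewrite mul0r mulr0.
have fx p : p.2 - k * p.1 < c \/ c + eps < p.2 - k * p.1 ->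
    D p * (r p.1 * B (p.2 - k * p.1)) = 0.
  by move=> /B0 ->; rewrite !mulr0.
apply: (int2_bound T0 l0 cf _ eps0 s01 _ ft fx); first by rewrite !mulr_ge0.
move=> p; have [tin|] := boolP (s0 <= p.1 <= s1); last first.
  rewrite negb_and -!ltNge => /orP /ft ->.
  by rewrite normr0 !mulr_ge0.
have [xin|] := boolP (c <= p.2 - k * p.1 <= c + eps); last first.
  rewrite negb_and -!ltNge => /orP /fx ->.
  by rewrite normr0 !mulr_ge0.
rewrite !normrM; apply: ler_pM => //; first exact: Dm.
by apply: ler_pM.
Qed.

(** The flux of the combination a H + V, relative to the speed [k], once its
    affine part at the reference state is removed: what is left is quadratic,
    but for the mismatch [s] between [k] and the speed of the invariant. *)
Lemma flux_remainder_bound (a s d n u u' v v' : R) :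
  `|u'| <= d -> `|v| <= d -> `|v'| <= d -> `|u - u'| <= n -> `|v - v'| <= n ->
  `|(a * (u * v) + v ^+ 2 / 2 + s * (a * u + v))
    - (a * (u' * v') + v' ^+ 2 / 2 + s * (a * u' + v'))|
  <= n * ((2 * `|a| + 1) * d + `|s| * (`|a| + 1)).
Proof.
move=> hu' hv hv' hu hdv.
have d0 : 0 <= d := le_trans (normr_ge0 _) hv.
have -> : (a * (u * v) + v ^+ 2 / 2 + s * (a * u + v))
    - (a * (u' * v') + v' ^+ 2 / 2 + s * (a * u' + v'))
  = a * ((u - u') * v + u' * (v - v')) + (v - v') * ((v + v') / 2)
    + s * (a * (u - u') + (v - v')) by field.
have -> : n * ((2 * `|a| + 1) * d + `|s| * (`|a| + 1)) =
  `|a| * (n * d + d * n) + n * d + `|s| * (`|a| * n + n) by ring.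
have h1 : `|(u - u') * v| <= n * d by rewrite normrM; apply: ler_pM.
have h2 : `|u' * (v - v')| <= d * n by rewrite normrM; apply: ler_pM.
have h3 : `|(v - v') * ((v + v') / 2)| <= n * d.
  rewrite normrM; apply: ler_pM => //.
  move: hv hv'; rewrite !ler_norml => /andP[? ?] /andP[? ?]; apply/andP; split; lra.
apply: le_trans (ler_normD _ _) _; apply: lerD.
  apply: le_trans (ler_normD _ _) _; apply: lerD => //.
  rewrite normrM; apply: ler_wpM2l => //.
  by apply: le_trans (ler_normD _ _) _; apply: lerD.
rewrite normrM; apply: ler_wpM2l => //.
apply: le_trans (ler_normD _ _) _; apply: lerD => //.
by rewrite normrM; apply: ler_wpM2l.
Qed.

Lemma strip_dist (k t x ts xs eps : R) : `|t - ts| <= eps ->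
  `|x - k * t - (xs - k * ts)| <= eps -> `|t - ts| + `|x - xs| <= (2 + `|k|) * eps.
Proof.
move=> ht hx.
have -> : x - xs = (x - k * t - (xs - k * ts)) + k * (t - ts) by ring.
have h := ler_normD (x - k * t - (xs - k * ts)) (k * (t - ts)).
have h2 : `|k * (t - ts)| <= `|k| * eps by rewrite normrM; apply: ler_wpM2l.
lra.
Qed.

Lemma glip_comb (L a : R) H V p q : 0 <= L -> glip L H -> glip L V ->
  `|(a * H p + V p) - (a * H q + V q)| <= (`|a| + 1) * L * (`|p.1 - q.1| + `|p.2 - q.2|).
Proof.
move=> L0 HL VL.
have -> : (a * H p + V p) - (a * H q + V q) = a * (H p - H q) + (V p - V q) by ring.
apply: le_trans (ler_normD _ _) _.
have := VL p q; have := HL p q; set w := _ + _ => h1 h2.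
rewrite -mulrA mulrDl mul1r; apply: lerD => //.
by rewrite normrM; apply: ler_wpM2l.
Qed.

(** The first equation times [a], plus the second one, tested against the
    cut-off of a parallelogram. With a^2 H0 = g, the combination a H + V is the
    linearisation at (H0, V0) of a Riemann invariant, of speed V0 + a H0: [a]
    is positive for the invariant that travels to the right, and negative for
    the other. Near the reference state its flux relative to the strip is the
    quadratic function [Fk] up to the constant [K0], so that only the two ends
    of the segment count. The errors are the variation of a H + V over the two
    ramps, and that of [Fk] across the strip. *)
Lemma weak_transport_eps (T l L g : R) H V (a H0 V0 k t0 t1 x0 eps d Cb : R) :
  0 < T -> 0 < l -> 0 <= L -> glip L H -> glip L V ->
  weak_conservation_law (Om T l) H (fun p => H p * V p) ->
  weak_conservation_law (Om T l) V (fun p => V p ^+ 2 / 2 + g * H p) ->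
  a ^+ 2 * H0 = g ->
  0 < eps -> t0 + eps <= t1 -> 0 < t0 -> t1 < T -> 0 < x0 -> x0 + eps < l ->
  0 < x0 + k * (t1 - t0) -> x0 + k * (t1 - t0) + eps < l ->
  0 <= Cb -> (forall x : R, `|bump x| <= Cb /\ `|derive1 bump x| <= Cb) ->
  `|H (t0, x0) - H0| + `|V (t0, x0) - V0| + L * ((1 + `|k|) * (t1 - t0) + eps) <= d ->
  `|a * (H (t1, x0 + k * (t1 - t0)) - H (t0, x0))
    + (V (t1, x0 + k * (t1 - t0)) - V (t0, x0))|
  <= 2 * ((`|a| + 1) * L * (2 + `|k|) * Cb ^+ 2 * eps)
     + L * ((2 * `|a| + 1) * d + `|V0 + a * H0 - k| * (`|a| + 1)) * Cb * (t1 - t0).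
Proof.
move=> T0 l0 L0 HL VL wH wV aH0 eps0 teps t00 t1T x00 x0l x10 x1l Cb0 HCb Hd.
pose phi := moving (cutA t0 t1 eps) (cutB k t0 x0 eps) k.
have tphi : test_function (Om T l) phi by exact: cut_test.
set x1 := x0 + k * (t1 - t0) in x10 x1l *.
pose e := eps^-1.
have e0 : 0 < e by rewrite invr_gt0.
have eeps : e * eps = 1 by rewrite mulVf// gt_eqF.
pose A := cutA t0 t1 eps; pose B := cutB k t0 x0 eps; pose B1 := cutB1 k t0 x0 eps.
pose r0 := rho0 t0 eps; pose r1 := rho1 t1 eps.
pose y p : R := p.2 - k * p.1.
have cA : continuous A by exact: continuous_cutA.
have cB : continuous B by exact: continuous_cutB.
have cB1 : continuous B1 by exact: continuous_cutB1.
have cr0 : continuous r0 by exact: continuous_rho0.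
have cr1 : continuous r1 by exact: continuous_rho1.
have cH := glip_continuous HL; have cV := glip_continuous VL.
have phit p : partial_t phi p = (r0 p.1 - r1 p.1) * B (y p) - k * (A p.1 * B1 (y p)).
  by have [_ <-] := moving_partial_t (derive_cutA t0 t1 eps p.1) (derive_cutB k t0 x0 eps (y p)).
have phix p : partial_x phi p = A p.1 * B1 (y p).
  by have [_ <-] := moving_partial_x A (derive_cutB k t0 x0 eps (y p)).
pose U p := a * H p + V p.
pose Fk p := a * ((H p - H0) * (V p - V0)) + (V p - V0) ^+ 2 / 2
  + (V0 + a * H0 - k) * (a * (H p - H0) + (V p - V0)).
pose K0 := a * H0 * V0 + V0 ^+ 2 / 2 + g * H0 - k * (a * H0 + V0).
pose X t := x0 + k * (t - t0).
pose Up := U (t0, x0); pose Uq := U (t1, x1).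
pose J0 p := (Up * r0 p.1 - Uq * r1 p.1) * B (y p) + (Fk (p.1, X p.1) + K0) * (A p.1 * B1 (y p)).
pose R0 p := (U p - Up) * (r0 p.1 * B (y p)).
pose R1 p := (Uq - U p) * (r1 p.1 * B (y p)).
pose R2 p := (Fk p - Fk (p.1, X p.1)) * (A p.1 * B1 (y p)).
have cC c : continuous (fun _ : R * R => c) := @continuous2C R c.
have cU : continuous U := continuous2D (continuous2M (cC a) cH) cV.
have cH' : continuous (fun p => H p - H0) := continuous2B cH (cC H0).
have cV' : continuous (fun p => V p - V0) := continuous2B cV (cC V0).
have cFk : continuous Fk := continuous2D (continuous2D
    (continuous2M (cC a) (continuous2M cH' cV'))
    (continuous2M (continuous2M cV' cV') (cC 2^-1)))
  (continuous2M (cC (V0 + a * H0 - k)) (continuous2D (continuous2M (cC a) cH') cV')).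
have cFX : continuous (fun p : R * R => Fk (p.1, X p.1)).
  apply: (@continuous2_1 _ (fun t => Fk (t, X t))) => t.
  apply: (@continuous_comp _ _ _ (fun t => (t, X t)) Fk); last exact: cFk.
  apply: (@cvg_pair _ _ _ _ (nbhs t) (nbhs (X t)) _ _ _ id X); first exact: cvg_id.
  rewrite /X; apply: cvgD; first exact: cvg_cst.
  by apply: cvgMr; apply: cvgB; [exact: cvg_id|exact: cvg_cst].
have cBy : continuous (fun p => B (y p)) := continuous2_mv (k := k) cB.
have cB1y : continuous (fun p => B1 (y p)) := continuous2_mv (k := k) cB1.
have cA1 : continuous (fun p : R * R => A p.1) := continuous2_1 cA.
have cr01 : continuous (fun p : R * R => r0 p.1) := continuous2_1 cr0.
have cr11 : continuous (fun p : R * R => r1 p.1) := continuous2_1 cr1.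
have cAB1 := continuous2M cA1 cB1y.
have cJ0 : continuous J0 := continuous2D
  (continuous2M (continuous2B (continuous2M (cC Up) cr01) (continuous2M (cC Uq) cr11)) cBy)
  (continuous2M (continuous2D cFX (cC K0)) cAB1).
have cR0 : continuous R0 := continuous2M (continuous2B cU (cC Up)) (continuous2M cr01 cBy).
have cR1 : continuous R1 := continuous2M (continuous2B (cC Uq) cU) (continuous2M cr11 cBy).
have cR2 : continuous R2 := continuous2M (continuous2B cFk cFX) cAB1.
have cphit : continuous (partial_t phi).
  rewrite (funext phit).
  exact: continuous2B (continuous2M (continuous2B cr01 cr11) cBy) (continuous2M (cC k) cAB1).
have cphix : continuous (partial_x phi) by rewrite (funext phix).
pose JH p := H p * partial_t phi p + H p * V p * partial_x phi p.
pose JV p := V p * partial_t phi p + (V p ^+ 2 / 2 + g * H p) * partial_x phi p.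
have cJH : continuous JH :=
  continuous2D (continuous2M cH cphit) (continuous2M (continuous2M cH cV) cphix).
have cJV : continuous JV := continuous2D (continuous2M cV cphit)
  (continuous2M (continuous2D (continuous2M (continuous2M cV cV) (cC 2^-1))
     (continuous2M (cC g) cH)) cphix).
have iH : int2 T l JH = 0.
  by apply: EFin_inj; rewrite -(int2_Om T0 l0 cJH); exact: wH.
have iV : int2 T l JV = 0.
  by apply: EFin_inj; rewrite -(int2_Om T0 l0 cJV); exact: wV.
have caJH : continuous (fun p => a * JH p) := continuous2M (cC a) cJH.
(* the weak equations, split into a part [J0] computed exactly, where the flux
   is frozen on the axis of the strip, and three errors *)
have tot : int2 T l J0 + int2 T l R0 + int2 T l R1 + int2 T l R2 = 0.
  have c01 := continuous2D cJ0 cR0; have c012 := continuous2D c01 cR1.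
  rewrite -(int2D T0 l0 cJ0 cR0) -(int2D T0 l0 c01 cR1) -(int2D T0 l0 c012 cR2).
  have <- : int2 T l (fun p => a * JH p + JV p) = 0.
    by rewrite (int2D T0 l0 caJH cJV) (int2Z a T0 l0 cJH) iH iV mulr0 addr0.
  congr (int2 T l); apply/funext => p.
  rewrite /J0 /R0 /R1 /R2 /JH /JV phit phix /Fk /K0 /U -aH0.
  by field.
(* on each time slice [J0] is an exact x-derivative up to the ramps *)
have J0E : int2 T l J0 = Up - Uq.
  rewrite /int2.
  have slJ t : t \in `]0, T[ -> slice_int l J0 t = Up * r0 t - Uq * r1 t.
    move=> tT.
    pose c1 := Up * r0 t - Uq * r1 t; pose c2 := (Fk (t, X t) + K0) * A t.
    pose P x := c1 * cutSB k t0 x0 eps (1 * x + - (k * t)) + c2 * B (1 * x + - (k * t)).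
    have dP x : is_derive x (1:R) P (J0 (t, x)).
      have h1 := is_deriveZ c1 (is_derive_affine (derive_cutSB k t0 x0 eps (1 * x + - (k * t)))).
      have h2 := is_deriveZ c2 (is_derive_affine (derive_cutB k t0 x0 eps (1 * x + - (k * t)))).
      apply: is_derive_rval (is_deriveD h1 h2) _.
      rewrite /J0 /GRing.scale/= /y/= !mul1r /c1 /c2 /B /B1; ring.
    rewrite /slice_int (ftc_oo l0 dP (continuous_slice (t := t) cJ0)).
    have [tin|tout] := boolP (t0 <= t <= t1); last first.
      have tout' : t < t0 \/ t1 < t by move: tout; rewrite negb_and -!ltNge => /orP.
      have o0 : t < t0 \/ t0 + eps < t.
        by clear -teps eps0 tout'; case: tout' => h; [left|right]; lra.
      have o1 : t < t1 - eps \/ t1 < t.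
        by clear -teps eps0 tout'; case: tout' => h; [left|right]; lra.
      have oA : t <= t0 \/ t1 <= t.
        by clear -teps eps0 tout'; case: tout' => h; [left|right]; lra.
      have z0 : r0 t = 0 := rho0_out eps0 o0.
      have z1 : r1 t = 0 := rho1_out eps0 o1.
      have zA : A t = 0 := cutA_out eps0 teps oA.
      have c10 : c1 = 0 by rewrite /c1 z0 z1 !mulr0 subrr.
      have c20 : c2 = 0 by rewrite /c2 zA mulr0.
      by rewrite -/c1 /P c10 c20 !mul0r addr0 subrr.
    have [tin0 tin1] : t0 <= t /\ t <= t1 by apply/andP.
    have t01 : t0 < t1 by clear -teps eps0; lra.
    have in0 : - (k * t) < x0 - k * t0.
      have := segment_gt0 t01 tin0 tin1 x00 x10; clear; lra.
    have inl : x0 - k * t0 + eps < l - k * t.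
      have hl0 : 0 < l - x0 - eps by clear -x0l; lra.
      have hl1 : 0 < l - x0 - eps + - k * (t1 - t0) by clear -x1l; rewrite /x1 in x1l; lra.
      have := segment_gt0 t01 tin0 tin1 hl0 hl1; clear; lra.
    have ol : 1 * l + - (k * t) < x0 - k * t0 \/ x0 - k * t0 + eps < 1 * l + - (k * t).
      by clear -inl; right; lra.
    have o0 : 1 * 0 + - (k * t) < x0 - k * t0 \/ x0 - k * t0 + eps < 1 * 0 + - (k * t).
      by clear -in0; left; lra.
    have Bl : B (1 * l + - (k * t)) = 0 := (cutB_out eps0 ol).1.
    have B0 : B (1 * 0 + - (k * t)) = 0 := (cutB_out eps0 o0).1.
    have S0 : cutSB k t0 x0 eps (1 * 0 + - (k * t)) = 0.
      rewrite /cutSB -mulrBr; apply: sstep_le0; apply: mulr_ge0_le0; first exact: ltW.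
      clear -in0; lra.
    have Sl : cutSB k t0 x0 eps (1 * l + - (k * t)) = 1.
      rewrite /cutSB -mulrBr; apply: sstep_ge1; rewrite -[leLHS]eeps (ler_pM2l e0).
      clear -inl; lra.
    by rewrite /P Bl B0 S0 Sl !mulr0 mulr1 !addr0 subr0.
  have -> : \int[mu]_(t in `]0, T[) slice_int l J0 t
          = \int[mu]_(t in `]0, T[) (Up * r0 t - Uq * r1 t).
    by apply: eq_Rintegral => t; rewrite inE => /slJ.
  pose Q t := Up * sstep (e * t + - (e * t0)) - Uq * sstep (e * t + (1 - e * t1)).
  have dQ t : is_derive t (1:R) Q (Up * r0 t - Uq * r1 t).
    have h0 := is_deriveZ Up (is_derive_affine (derive_sstep (e * t + - (e * t0)))).
    have h1 := is_deriveZ Uq (is_derive_affine (derive_sstep (e * t + (1 - e * t1)))).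
    exact: is_deriveB h0 h1.
  have cq : continuous (fun t => Up * r0 t - Uq * r1 t).
    move=> t; apply: cvgB; apply: cvgMr; [exact: cr0|exact: cr1].
  rewrite (ftc_oo T0 dQ cq) /Q.
  have -> : sstep (e * T + - (e * t0)) = 1.
    rewrite -mulrBr; apply: sstep_ge1; rewrite -[leLHS]eeps (ler_pM2l e0).
    clear -teps t1T; lra.
  have -> : sstep (e * T + (1 - e * t1)) = 1.
    apply: sstep_ge1; have : e * t1 <= e * T by rewrite (ler_pM2l e0) ltW.
    clear; lra.
  have -> : sstep (e * 0 + - (e * t0)) = 0.
    by rewrite -mulrBr; apply: sstep_le0; apply: mulr_ge0_le0; [exact: ltW|rewrite sub0r oppr_le0 ltW].
  have -> : sstep (e * 0 + (1 - e * t1)) = 0.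
    apply: sstep_le0; rewrite -[X in X - _]eeps.
    have : e * eps <= e * t1 by rewrite (ler_pM2l e0); clear -teps t00; lra.
    clear; lra.
  by rewrite !mulr1 !mulr0 !subr0.
have scale_bump (f : R -> R) : (forall x, `|f x| <= Cb) -> forall x, `|e * f x| <= e * Cb.
  by move=> fb x; rewrite normrM (gtr0_norm e0) (ler_pM2l e0).
have B0 q : q < x0 - k * t0 \/ x0 - k * t0 + eps < q -> B q = 0.
  by move=> h; exact: (cutB_out eps0 h).1.
have B10 q : q < x0 - k * t0 \/ x0 - k * t0 + eps < q -> B1 q = 0.
  by move=> h; exact: (cutB_out eps0 h).2.
have Bb q : `|B q| <= e * Cb by apply: scale_bump => z; exact: (HCb _).1.
have B1b q : `|B1 q| <= e * (e * Cb).
  rewrite /B1 /cutB1 normrM (gtr0_norm e0) (ler_pM2l e0).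
  by apply: scale_bump => z; exact: (HCb _).2.
have r0b t : `|r0 t| <= e * Cb by apply: scale_bump => z; exact: (HCb _).1.
have r1b t : `|r1 t| <= e * Cb by apply: scale_bump => z; exact: (HCb _).1.
have r00 t : t < t0 \/ t0 + eps < t -> r0 t = 0 by exact: rho0_out.
have r10 t : t < t1 - eps \/ t1 < t -> r1 t = 0 by exact: rho1_out.
have mU0 : 0 <= (`|a| + 1) * L * ((2 + `|k|) * eps).
  by rewrite !mulr_ge0 ?addr_ge0// ltW.
have bR0 : `|int2 T l R0| <= (`|a| + 1) * L * (2 + `|k|) * Cb ^+ 2 * eps.
  have s01 : t0 <= t0 + eps by clear -eps0; lra.
  have DU p : t0 <= p.1 <= t0 + eps -> x0 - k * t0 <= p.2 - k * p.1 <= x0 - k * t0 + eps ->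
      `|U p - Up| <= (`|a| + 1) * L * ((2 + `|k|) * eps).
    move=> /andP[h1 h2] /andP[h3 h4].
    apply: le_trans (glip_comb a p (t0, x0) L0 HL VL) _.
    apply: ler_wpM2l; first by rewrite mulr_ge0 ?addr_ge0.
    apply: strip_dist => /=; rewrite ler_norml; apply/andP.
      by clear -h1 h2 eps0; split; lra.
    by clear -h3 h4 eps0; split; lra.
  have := int2_window T0 l0 cR0 (ltW eps0) s01 mU0 r0b r00 Bb B0 DU.
  suff -> : (`|a| + 1) * L * ((2 + `|k|) * eps) * (e * Cb * (e * Cb)) * eps * (t0 + eps - t0)
    = (`|a| + 1) * L * (2 + `|k|) * Cb ^+ 2 * eps by [].
  rewrite -[RHS]mulr1 -[X in _ = _ * X](mulr1 1) -eeps; clear; ring.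
have bR1 : `|int2 T l R1| <= (`|a| + 1) * L * (2 + `|k|) * Cb ^+ 2 * eps.
  have s01 : t1 - eps <= t1 by clear -eps0; lra.
  have DU p : t1 - eps <= p.1 <= t1 -> x0 - k * t0 <= p.2 - k * p.1 <= x0 - k * t0 + eps ->
      `|Uq - U p| <= (`|a| + 1) * L * ((2 + `|k|) * eps).
    move=> /andP[h1 h2] /andP[h3 h4]; rewrite distrC.
    apply: le_trans (glip_comb a p (t1, x1) L0 HL VL) _.
    apply: ler_wpM2l; first by rewrite mulr_ge0 ?addr_ge0.
    apply: strip_dist => /=; rewrite ler_norml; apply/andP.
      by clear -h1 h2 eps0; split; lra.
    by clear -h3 h4 eps0; rewrite /x1; split; lra.
  have := int2_window T0 l0 cR1 (ltW eps0) s01 mU0 r1b r10 Bb B0 DU.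
  suff -> : (`|a| + 1) * L * ((2 + `|k|) * eps) * (e * Cb * (e * Cb)) * eps * (t1 - (t1 - eps))
    = (`|a| + 1) * L * (2 + `|k|) * Cb ^+ 2 * eps by [].
  rewrite -[RHS]mulr1 -[X in _ = _ * X](mulr1 1) -eeps; clear; ring.
have bR2 : `|int2 T l R2| <= L * ((2 * `|a| + 1) * d + `|V0 + a * H0 - k| * (`|a| + 1)) * Cb * (t1 - t0).
  have s01 : t0 <= t1 by clear -teps eps0; lra.
  set W := (2 * `|a| + 1) * d + `|V0 + a * H0 - k| * (`|a| + 1).
  have d0 : 0 <= d.
    have h1 : 0 <= t1 - t0 by clear -s01; lra.
    have h2 : 0 <= (1 + `|k|) * (t1 - t0) by apply: mulr_ge0 => //; exact: addr_ge0.
    have h3 : 0 <= (1 + `|k|) * (t1 - t0) + eps by apply: addr_ge0 => //; exact: ltW.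
    by apply: le_trans Hd; apply: addr_ge0; [exact: addr_ge0|exact: mulr_ge0].
  have W0 : 0 <= W by rewrite /W addr_ge0// mulr_ge0 ?addr_ge0// ?mulr_ge0.
  have m0 : 0 <= L * eps * W by rewrite !mulr_ge0// ltW.
  have Ab t : `|A t| <= 1 by exact: cutA_le1.
  have A0 t : t < t0 \/ t1 < t -> A t = 0.
    by move=> h; apply: cutA_out => //; case: h => /ltW; [left|right].
  have DF p : t0 <= p.1 <= t1 -> x0 - k * t0 <= p.2 - k * p.1 <= x0 - k * t0 + eps ->
      `|Fk p - Fk (p.1, X p.1)| <= L * eps * W.
    move=> /andP[h1 h2] /andP[h3 h4].
    have far (Z : R * R -> R) z0 x : glip L Z -> 
        `|x - X p.1| <= eps -> `|Z (t0, x0) - z0| + L * ((1 + `|k|) * (t1 - t0) + eps) <= d ->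
        `|Z (p.1, x) - z0| <= d.
      move=> ZL hx; apply: le_trans.
      have -> : Z (p.1, x) - z0 = (Z (t0, x0) - z0) + (Z (p.1, x) - Z (t0, x0)) by clear; ring.
      apply: le_trans (ler_normD _ _) _; apply: lerD => //.
      apply: le_trans (ZL _ _) _; apply: ler_wpM2l => //=.
      have -> : x - x0 = (x - X p.1) + k * (p.1 - t0) by rewrite /X; clear; ring.
      have := ler_normD (x - X p.1) (k * (p.1 - t0)).
      have : `|k * (p.1 - t0)| <= `|k| * (t1 - t0).
        rewrite normrM; apply: ler_wpM2l => //.
        by rewrite ler_norml; apply/andP; clear -h1 h2; split; lra.
      have : `|p.1 - t0| <= t1 - t0.
        by rewrite ler_norml; apply/andP; clear -h1 h2; split; lra.
      clear -hx; lra.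
    have dx : `|p.2 - X p.1| <= eps.
      by rewrite ler_norml /X; apply/andP; clear -h3 h4 eps0; split; lra.
    have dXX : `|X p.1 - X p.1| <= eps by rewrite subrr normr0 ltW.
    have nn1 := normr_ge0 (H (t0, x0) - H0); have nn2 := normr_ge0 (V (t0, x0) - V0).
    have HdH : `|H (t0, x0) - H0| + L * ((1 + `|k|) * (t1 - t0) + eps) <= d.
      by clear -Hd nn2; lra.
    have HdV : `|V (t0, x0) - V0| + L * ((1 + `|k|) * (t1 - t0) + eps) <= d.
      by clear -Hd nn1; lra.
    have pE : p = (p.1, p.2) by case: p {h1 h2 h3 h4 far dx dXX}.
    have dZ (Z : R * R -> R) : glip L Z -> `|Z p - Z (p.1, X p.1)| <= L * eps.
      move=> ZL; apply: le_trans (ZL _ _) _ => /=; rewrite subrr normr0 add0r.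
      exact: ler_wpM2l.
    apply: flux_remainder_bound.
    - exact: far HL dXX HdH.
    - by rewrite {1}pE; exact: far VL dx HdV.
    - exact: far VL dXX HdV.
    - by have := dZ _ HL; congr (`|_| <= _); clear; ring.
    - by have := dZ _ VL; congr (`|_| <= _); clear; ring.
  have := int2_window T0 l0 cR2 (ltW eps0) s01 m0 Ab A0 B1b B10 DF.
  suff -> : L * eps * W * (1 * (e * (e * Cb))) * eps * (t1 - t0) = L * W * Cb * (t1 - t0) by [].
  transitivity (L * W * Cb * (t1 - t0) * (e * eps * (e * eps))); first by clear; ring.
  by rewrite eeps !mulr1.
have -> : a * (H (t1, x1) - H (t0, x0)) + (V (t1, x1) - V (t0, x0)) = Uq - Up.
  rewrite /Uq /Up /U; ring.
move: tot bR0 bR1 bR2; rewrite J0E.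
generalize (int2 T l R0) (int2 T l R1) (int2 T l R2) Up Uq => i0 i1 i2 vp vq.
generalize ((`|a| + 1) * L * (2 + `|k|) * Cb ^+ 2 * eps) => m1.
generalize (L * ((2 * `|a| + 1) * d + `|V0 + a * H0 - k| * (`|a| + 1)) * Cb * (t1 - t0)) => m2.
clear => tot b0 b1 b2.
have -> : vq - vp = i0 + i1 + i2 by lra.
have n1 := ler_normD (i0 + i1) i2.
have n2 := ler_normD i0 i1.
lra.
Qed.

(** The limit of thin parallelograms. The variation of a linearised invariant
    along a line is of second order when the line has the speed of that
    invariant. *)
Lemma weak_transport (T l L g M : R) H V : 0 < T -> 0 < l -> 0 <= L -> 0 <= M ->
  glip L H -> glip L V ->
  weak_conservation_law (Om T l) H (fun p => H p * V p) ->
  weak_conservation_law (Om T l) V (fun p => V p ^+ 2 / 2 + g * H p) ->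
  exists2 C : R, 0 <= C & forall a H0 V0 k t0 t1 x0 : R,
  a ^+ 2 * H0 = g -> `|a| <= M -> `|k| <= M ->
  0 < t0 -> t0 < t1 -> t1 < T -> 0 < x0 -> x0 < l ->
  0 < x0 + k * (t1 - t0) -> x0 + k * (t1 - t0) < l ->
  `|a * (H (t1, x0 + k * (t1 - t0)) - H (t0, x0))
    + (V (t1, x0 + k * (t1 - t0)) - V (t0, x0))|
  <= C * (`|H (t0, x0) - H0| + `|V (t0, x0) - V0| + (t1 - t0) + `|V0 + a * H0 - k|) * (t1 - t0).
Proof.
move=> T0 l0 L0 M0 HL VL wH wV.
have [Cb Cb0 HCb] := @bump_bounded R.
pose C := L * (2 * M + 1) * Cb * (1 + L * (1 + M)).
exists C.
  have h1 : 0 <= L * (1 + M) by rewrite mulr_ge0 ?addr_ge0.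
  by rewrite /C !mulr_ge0 ?addr_ge0// mulr_ge0.
move=> a H0 V0 k t0 t1 x0 aH aM kM t00 t01 t1T x00 x0l x10 x1l.
set w := `|H (t0, x0) - H0| + `|V (t0, x0) - V0|.
set s := `|V0 + a * H0 - k|.
pose d0 := w + L * ((1 + `|k|) * (t1 - t0)).
pose K1 := 2 * ((`|a| + 1) * L * (2 + `|k|) * Cb ^+ 2) + L * (2 * `|a| + 1) * L * Cb * (t1 - t0).
set lhs := `|_|.
have main : lhs <= L * ((2 * `|a| + 1) * d0 + s * (`|a| + 1)) * Cb * (t1 - t0).
  apply/ler_addgt0Pr => r r0.
  have K10 : 0 <= K1.
    have tt : 0 <= t1 - t0 by rewrite subr_ge0 ltW.
    have a1 : 0 <= `|a| + 1 by rewrite addr_ge0.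
    have a2 : 0 <= 2 + `|k| by rewrite addr_ge0.
    have a3 : 0 <= 2 * `|a| + 1 by rewrite addr_ge0// mulr_ge0.
    have a4 : 0 <= Cb ^+ 2 by exact: sqr_ge0.
    by rewrite /K1; apply: addr_ge0; do ?apply: mulr_ge0.
  pose eps := Num.min (Num.min (t1 - t0) (r / (K1 + 1)))
    (Num.min (l - x0) (l - (x0 + k * (t1 - t0)))) / 2.
  have m0 : 0 < Num.min (Num.min (t1 - t0) (r / (K1 + 1)))
    (Num.min (l - x0) (l - (x0 + k * (t1 - t0)))).
    by rewrite !lt_min !subr_gt0 t01 x0l x1l divr_gt0// ltr_pwDr.
  have eps0 : 0 < eps by rewrite divr_gt0.
  have [e1 e2 e3 e4] : [/\ eps <= t1 - t0, K1 * eps <= r, x0 + eps < l &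
      x0 + k * (t1 - t0) + eps < l].
    have : 2 * eps = Num.min (Num.min (t1 - t0) (r / (K1 + 1)))
      (Num.min (l - x0) (l - (x0 + k * (t1 - t0)))) by rewrite /eps mulrC divfK.
    move=> E2; have : 2 * eps <= 2 * eps by []. 
    rewrite {2}E2 !le_min => /andP[/andP[h1 h2] /andP[h3 h4]].
    split; [by clear -h1 eps0; lra| |by clear -h3 eps0; lra|by clear -h4 eps0; lra].
    have h5 : eps <= r / (K1 + 1) by clear -h2 eps0; lra.
    have h6 : (K1 + 1) * eps <= r by rewrite mulrC -ler_pdivlMr// ltr_pwDr.
    by clear -h6 eps0; lra.
  have e1' : t0 + eps <= t1 by clear -e1; lra.
  have := weak_transport_eps (d := w + L * ((1 + `|k|) * (t1 - t0) + eps))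
    T0 l0 L0 HL VL wH wV aH eps0 e1' t00 t1T x00 e3 x10 e4 Cb0 HCb (lexx _).
  move=> Hm; apply: (le_trans Hm).
  rewrite -/s.
  have -> : 2 * ((`|a| + 1) * L * (2 + `|k|) * Cb ^+ 2 * eps) +
    L * ((2 * `|a| + 1) * (w + L * ((1 + `|k|) * (t1 - t0) + eps)) + s * (`|a| + 1)) * Cb * (t1 - t0)
    = L * ((2 * `|a| + 1) * d0 + s * (`|a| + 1)) * Cb * (t1 - t0) + K1 * eps.
    by rewrite /K1 /d0; clear; ring.
  by rewrite lerD2l.
apply: (le_trans main).
have w0 : 0 <= w by rewrite addr_ge0.
have s0 : 0 <= s by rewrite /s.
have tt0 : 0 <= t1 - t0 by rewrite subr_ge0 ltW.
have step1 : (2 * `|a| + 1) * d0 + s * (`|a| + 1)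
  <= (2 * M + 1) * (1 + L * (1 + M)) * (w + (t1 - t0) + s).
  have b1 : d0 + s <= (1 + L * (1 + M)) * (w + (t1 - t0) + s).
    have c1 : (1 + `|k|) * (t1 - t0) <= (1 + M) * (t1 - t0) by apply: ler_wpM2r => //; lra.
    have c2 := ler_wpM2l L0 c1.
    have LM : 0 <= L * (1 + M) by rewrite mulr_ge0// addr_ge0.
    have c3 := mulr_ge0 LM (addr_ge0 w0 s0).
    rewrite /d0; clear -c2 c3 tt0; lra.
  have d00 : 0 <= d0 by rewrite addr_ge0// !mulr_ge0// addr_ge0.
  have b2 : (2 * `|a| + 1) * d0 <= (2 * M + 1) * d0 by apply: ler_wpM2r => //; lra.
  have b3 : s * (`|a| + 1) <= (2 * M + 1) * s.
    rewrite mulrC; apply: ler_wpM2r => //; lra.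
  have M1 : 0 <= 2 * M + 1 by rewrite addr_ge0// mulr_ge0.
  have b4 := ler_wpM2l M1 b1.
  clear -b2 b3 b4; lra.
have -> : C * (w + (t1 - t0) + s) * (t1 - t0) =
  L * ((2 * M + 1) * (1 + L * (1 + M)) * (w + (t1 - t0) + s)) * Cb * (t1 - t0).
  by rewrite /C; clear; ring.
by apply: ler_wpM2r => //; apply: ler_wpM2r => //; apply: ler_wpM2l.
Qed.
End weak_transport2.

(** * From pointwise equations to weak ones *)

Section weak_of_ae.
Context {R : realType}.
Local Notation mu := (@lebesgue_measure R).
Implicit Types (u f phi : R * R -> R).

Definition hseq (n : nat) : R := n.+1%:R^-1.

Lemma hseq_gt0 n : 0 < hseq n. Proof. by rewrite invr_gt0. Qed.

Lemma hseq_cvg0 : hseq n @[n --> \oo] --> (0 : R).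
Proof. exact: cvg_harmonic. Qed.

Lemma seq_derive (w : R -> R) t d : is_derive t (1:R) w d ->
  n.+1%:R * (w (t + hseq n) - w t) @[n --> \oo] --> d.
Proof.
move=> [dw <-].
have /cvg_ex[/= l' Hl] := dw.
have -> : 'D_1 w t = l' by apply/cvg_lim.
have /(_ hseq) := (cvgr_dnbhsP _ _ _).1 Hl.
have hs : (forall n, hseq n != 0) /\ hseq n @[n --> \oo] --> (0 : R).
  by split; [move=> n; rewrite gt_eqF// hseq_gt0|exact: hseq_cvg0].
move=> /(_ hs).
apply: cvg_trans; apply: near_eq_cvg; apply: nearW => n /=.
by rewrite /GRing.scale/= /hseq invrK mulr1 (addrC t).
Qed.

Lemma derivable_slice_t phi t x : derivable phi (t, x) ((1, 0) : R * R) ->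
  is_derive t (1:R) (fun s => phi (s, x)) (partial_t phi (t, x)).
Proof.
have E h : (phi \o shift (t, x)) (h *: ((1, 0) : R * R)) =
  ((fun s => phi (s, x)) \o shift t) (h *: (1:R)).
  by rewrite /= /GRing.scale/= /scale_pair/= /GRing.add/= /add_pair/= /GRing.scale/= mulr0 add0r.
move=> df; split.
  by move: df; rewrite /derivable; under eq_fun do rewrite E.
by rewrite /partial_t /derive; congr (lim _); under [in RHS]eq_fun do rewrite E.
Qed.

Lemma derivable_slice_x phi t x : derivable phi (t, x) ((0, 1) : R * R) ->
  is_derive x (1:R) (fun y => phi (t, y)) (partial_x phi (t, x)).
Proof.
have E h : (phi \o shift (t, x)) (h *: ((0, 1) : R * R)) =
  ((fun y => phi (t, y)) \o shift x) (h *: (1:R)).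
  by rewrite /= /GRing.scale/= /scale_pair/= /GRing.add/= /add_pair/= /GRing.scale/= mulr0 add0r.
move=> df; split.
  by move: df; rewrite /derivable; under eq_fun do rewrite E.
by rewrite /partial_x /derive; congr (lim _); under [in RHS]eq_fun do rewrite E.
Qed.

Lemma compact_supp_bounded (psi : R * R -> R) K : compact K -> continuous psi ->
  (forall p, ~ K p -> psi p = 0) -> exists2 C, 0 <= C & forall p, `|psi p| <= C.
Proof.
move=> cK cpsi psi0.
have /compact_bounded[M [Mr HM]] : compact (psi @` K).
  by apply: continuous_compact => //; exact: continuous_subspaceT.
exists (`|M| + 1); first by rewrite addr_ge0.
move=> p; have [Kp|/psi0->] := pselect (K p); last by rewrite normr0 addr_ge0.
by apply: HM; [rewrite (le_lt_trans (ler_norm M))// ltrDl|exists p].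
Qed.

Lemma test_out Omega phi p : test_function Omega phi -> ~ Omega p -> phi p = 0.
Proof.
move=> [_ _ sub] np; apply: contrapT => /eqP nz; apply: np; apply: sub.
exact: subset_closure.
Qed.

Lemma test_bounded Omega phi : test_function Omega phi ->
  exists2 C, 0 <= C & [/\ forall p, `|phi p| <= C,
    forall p, `|partial_t phi p| <= C & forall p, `|partial_x phi p| <= C].
Proof.
move=> [Cn cK sub]; set K := closure _ in cK sub.
have [cphi [dt dx [ct _] [cx _]]] := Cn 1%N.
have K0 p : ~ K p -> \near p, phi p = 0.
  move=> nK; have oK : open (~` K) by rewrite openC; exact: closed_closure.
  have : \forall q \near p, (~` K) q by apply: open_nbhs_nbhs; split.
  apply: filterS => q nq; apply: contrapT => /eqP nz; apply: nq.
  exact: subset_closure.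
have [C0 C00 H0] := compact_supp_bounded cK cphi (fun p h => nbhs_singleton (K0 p h)).
have [p nKp|C1 C10 H1] := compact_supp_bounded cK ct.
  rewrite /partial_t (near_eq_derive (g := cst 0)) ?derive_cst//; exact: K0.
have [p nKp|C2 C20 H2] := compact_supp_bounded cK cx.
  rewrite /partial_x (near_eq_derive (g := cst 0)) ?derive_cst//; exact: K0.
exists (C0 + C1 + C2); first by rewrite !addr_ge0.
by split=> p; [have := H0 p|have := H1 p|have := H2 p]; lra.
Qed.

Lemma MVT_lip (w dw : R -> R) C : (forall t, is_derive t (1:R) w (dw t)) ->
  (forall t, `|dw t| <= C) -> klip C w.
Proof.
move=> dW bd x y; wlog xy : x y / x <= y => [H|].
  by have [/H//|/ltW/H] := leP x y; rewrite distrC (distrC y).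
have [c _ E] : exists2 c, c \in `[x, y] & w y - w x = dw c * (y - x).
  apply: MVT_segment => //; apply: continuous_subspaceT.
  by apply: derivable_continuous => t; have [] := dW t.
by rewrite distrC E normrM (distrC x); apply: ler_wpM2r.
Qed.

Lemma test_klip Omega phi C : test_function Omega phi ->
  (forall p, `|partial_t phi p| <= C) -> (forall p, `|partial_x phi p| <= C) ->
  (forall x, klip C (fun t => phi (t, x))) /\ (forall t, klip C (fun x => phi (t, x))).
Proof.
move=> [Cn _ _] Ht Hx; have [_ [dt dx _ _]] := Cn 1%N; split=> z.
  by apply: (@MVT_lip _ (fun t => partial_t phi (t, z))) => // t; exact: derivable_slice_t.
by apply: (@MVT_lip _ (fun x => partial_x phi (z, x))) => // t; exact: derivable_slice_x.
Qed.

Lemma klipM L1 L2 M1 M2 (v w : R -> R) : klip L1 v -> klip L2 w ->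
  (forall x, `|v x| <= M1) -> (forall x, `|w x| <= M2) ->
  klip (L1 * M2 + M1 * L2) (fun x => v x * w x).
Proof.
move=> lv lw bv bw x y.
have -> : v x * w x - v y * w y = (v x - v y) * w x + v y * (w x - w y) by ring.
apply: le_trans (ler_normD _ _) _; rewrite !normrM mulrDl; apply: lerD.
  by rewrite mulrAC; apply: ler_pM.
by rewrite -mulrA; apply: ler_pM.
Qed.


Lemma glip_klip_t L u x : glip L u -> klip L (fun t => u (t, x)).
Proof. by move=> uL t t'; have := uL (t, x) (t', x); rewrite /= subrr normr0 addr0. Qed.

Lemma glip_klip_x L u t : glip L u -> klip L (fun x => u (t, x)).
Proof. by move=> uL x x'; have := uL (t, x) (t, x'); rewrite /= subrr normr0 add0r. Qed.

Lemma klip_int_mul C l (w : R * R -> R) : 0 < l -> 0 <= C ->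
  (forall x, klip C (fun t => w (t, x))) -> continuous w ->
  klip (C * l) (slice_int l w).
Proof.
move=> l0 C0 wC cw t t'; rewrite /slice_int.
have ci s : mu.-integrable `]0, l[ (EFin \o (fun x => w (s, x))).
  exact: continuous_integrable_oo (continuous_slice (t := s) cw).
rewrite -RintegralB//.
have -> : C * l * `|t - t'| = (C * `|t - t'|) * (l - 0) by rewrite subr0; ring.
apply: int_supp_bound => //.
- exact: mulr_ge0.
- exact: ltW.
- apply: continuous_integrable_oo => x; apply: cvgB; exact: continuous_slice.
- by move=> x _; exact: wC.
- by move=> x; rewrite in_itv/= => /andP[x0 xl] [h|h]; lra.
Qed.

(** Dominated convergence, for difference quotients. *)
Lemma bounded_cvg_int (a b M : R) (fn : nat -> R -> R) (f0 : R -> R) :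
  (forall n, continuous (fn n)) -> (forall n x, `|fn n x| <= M) ->
  mu.-integrable `]a, b[ (EFin \o f0) ->
  {ae mu, forall x, x \in `]a, b[ -> fn n x @[n --> \oo] --> f0 x} ->
  (\int[mu]_(x in `]a, b[) fn n x) @[n --> \oo] --> \int[mu]_(x in `]a, b[) f0 x.
Proof.
move=> cfn bfn if0 aec.
have mD : measurable (`]a, b[%classic : set R) by exact: measurable_itv.
have iM : mu.-integrable `]a, b[ (EFin \o (cst M : R -> R)).
  by apply: continuous_integrable_oo => x; exact: cvg_cst.
have /integrableP[mf0 _] := if0.
have [|||_ _ H] := @dominated_convergence _ _ _ mu `]a, b[ mD
  (fun n => EFin \o fn n) (EFin \o f0) (EFin \o cst M) _ mf0 _ iM.
- move=> n; apply/measurable_EFinP; apply: measurable_funTS.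
  exact: continuous_measurable_fun.
- apply: ae_imply aec => x Hx xab; apply: cvg_EFin; last exact: Hx.
  by apply: nearW.
- by apply: aeW => x n _ /=; rewrite lee_fin.
- have : fine (\int[mu]_(x in `]a, b[) (EFin \o fn n) x)%E @[n --> \oo]
      --> fine (\int[mu]_(x in `]a, b[) (EFin \o f0) x)%E.
    apply: fine_cvg; rewrite fineK//; exact: integrable_fin_num.
  by [].
Qed.

(** Conversely, a weak equation follows from a pointwise one. The function G(t)
    = int u(t, x) phi(t, x) dx is Lipschitz and vanishes at 0 and T; its right
    derivative is int (u phi_t + f phi_x) dx, by dominated convergence and
    since (f phi)(t, .) has an integrable derivative of zero integral.
    Integrating G' over (0, T) gives the claim. Only difference quotients of
    [u] along the sequence 1/(n+1) are needed, which is what transport along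
    characteristics provides. *)
Lemma weak_of_ae T l L M u f : 0 < T -> 0 < l -> 0 <= L -> 0 <= M ->
  glip L u -> glip L f -> (forall p, `|u p| <= M) -> (forall p, `|f p| <= M) ->
  (forall t : R, t \in `]0, T[ -> {ae mu, forall x : R, x \in `]0, l[ ->
     exists2 d : R, is_derive x (1:R) (fun y => f (t, y)) d &
       n.+1%:R * (u (t + hseq n, x) - u (t, x)) @[n --> \oo] --> - d}) ->
  weak_conservation_law (Om T l) u f.
Proof.
move=> T0 l0 L0 M0 uL fL uM fM H phi tphi.
have [Cn _ _] := tphi; have [cphi [dt dx [ct _] [cx _]]] := Cn 1%N.
have [C C0 [bphi bt bx]] := test_bounded tphi.
have [kt kx] := test_klip tphi bt bx.
have cu := glip_continuous uL; have cf := glip_continuous fL.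
have phi0 p : ~ Om T l p -> phi p = 0 by exact: test_out.
pose J p := u p * partial_t phi p + f p * partial_x phi p.
have cJ : continuous J := continuous2D (continuous2M cu ct) (continuous2M cf cx).
suff E : int2 T l J = 0 by rewrite -[RHS]/(0%:E) -E -(int2_Om T0 l0 cJ).
pose w p := u p * phi p.
pose K := L * C + M * C.
have K0 : 0 <= K by rewrite addr_ge0// mulr_ge0.
have wK x : klip K (fun t => w (t, x)).
  by apply: klipM => //; exact: glip_klip_t.
have cw : continuous w := continuous2M cu cphi.
pose G := slice_int l w.
have GK : klip (K * l + 1) G.
  move=> t t'; apply: le_trans (klip_int_mul l0 K0 wK cw t t') _.
  by apply: ler_wpM2r => //; rewrite lerDl.
have G0 t : t <= 0 \/ T <= t -> G t = 0.
  move=> ht; rewrite /G /slice_int.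
  have -> : (fun x => w (t, x)) = cst 0.
    apply/funext => x; rewrite /w phi0 ?mulr0// => -[/=]; rewrite in_itv/= => /andP[h1 h2] _.
    by case: ht; [rewrite leNgt h1|rewrite leNgt h2].
  by rewrite Rintegral_cst ?mul0r//; exact: measurable_itv.
have K1 : 0 < K * l + 1 by rewrite ltr_wpDl// mulr_ge0// ltW.
have [dG [intdG dGE dGI]] := klip_ftc K1 GK T0.
have Gseq t : t \in `]0, T[ ->
    n.+1%:R * (G (t + hseq n) - G t) @[n --> \oo] --> slice_int l J t.
  move=> tT.
  pose F x := f (t, x) * phi (t, x).
  pose KF := L * C + M * C.
  have FK : klip (KF + 1) F.
    move=> x x'; apply: le_trans (klipM (glip_klip_x t fL) (kx t) (fun x => fM (t, x)) (fun x => bphi (t, x)) x x') _.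
    by apply: ler_wpM2r => //; rewrite lerDl.
  have F0 x : x <= 0 \/ l <= x -> F x = 0.
    move=> hx; rewrite /F phi0 ?mulr0// => -[_ /=]; rewrite in_itv/= => /andP[h1 h2].
    by case: hx; [rewrite leNgt h1|rewrite leNgt h2].
  have KF1 : 0 < KF + 1 by rewrite ltr_pwDr.
  have [dF [intdF dFE dFI]] := klip_ftc KF1 FK l0.
  have sub : (`]0, l[%classic : set R) `<=` `[0, l]%classic.
    by move=> x /=; rewrite !in_itv/= => /andP[/ltW-> /ltW->].
  have idF : mu.-integrable `]0, l[ (EFin \o dF) by apply: integrableS intdF.
  have iJ : mu.-integrable `]0, l[ (EFin \o (fun x => J (t, x))).
    exact: continuous_integrable_oo (continuous_slice (t := t) cJ).
  have ci s : mu.-integrable `]0, l[ (EFin \o (fun x => w (s, x))).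
    exact: continuous_integrable_oo (continuous_slice (t := s) cw).
  have dF0 : \int[mu]_(x in `]0, l[) dF x = 0.
    have := dFI _ _ (lexx 0) (ltW l0) (lexx l).
    rewrite !F0 ?lexx ?subrr; [|by left|by right].
    by move=> E; apply: etrans (esym E); exact: Rintegral_itv_bndo_bndc.
  pose Psi n x := n.+1%:R * (w (t + hseq n, x) - w (t, x)).
  have PsiE n : n.+1%:R * (G (t + hseq n) - G t) = \int[mu]_(x in `]0, l[) Psi n x.
    rewrite /G /slice_int -RintegralB//.
    rewrite -RintegralZl//; exact: (integrableB _ (ci _) (ci _)).
  have limE : slice_int l J t = \int[mu]_(x in `]0, l[) (J (t, x) - dF x).
    by rewrite RintegralB// dF0 subr0.
  rewrite limE (funext PsiE : (fun n => _) = _).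
  apply: (@bounded_cvg_int _ _ K).
  - move=> n x; apply: cvgMr; apply: cvgB; exact: continuous_slice.
  - move=> n x; rewrite /Psi normrM ger0_norm// mulrC -ler_pdivlMr//.
    apply: le_trans (wK x _ _) _; rewrite addrAC subrr add0r.
    by rewrite (ger0_norm (ltW (hseq_gt0 n))).
  - exact: (integrableB _ iJ idF).
  - apply: ae_imply (ae_conj dFE (H t tT)) => x [H1 H2] xl.
    have [d fd ud] := H2 xl.
    have Fd : is_derive x (1:R) F (f (t, x) * partial_x phi (t, x) + phi (t, x) * d).
      exact: is_deriveM fd (derivable_slice_x (dx (t, x))).
    have -> : dF x = f (t, x) * partial_x phi (t, x) + phi (t, x) * d.
      by have [_ <-] := H1 xl; have [_ <-] := Fd.
    have -> : J (t, x) - (f (t, x) * partial_x phi (t, x) + phi (t, x) * d)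
      = - d * phi (t, x) + u (t, x) * partial_t phi (t, x) by rewrite /J; ring.
    have pd := seq_derive (derivable_slice_t (dt (t, x))).
    have pc : phi (t + hseq n, x) @[n --> \oo] --> phi (t, x).
      have th : t + hseq n @[n --> \oo] --> t.
        by rewrite -[X in _ --> X]addr0; apply: cvgD; [exact: cvg_cst|exact: hseq_cvg0].
      have ck : (fun s => phi (s, x)) s @[s --> t] --> phi (t, x) by exact: (klip_continuous (kt x)).
      exact: (cvg_comp _ _ th ck).
    have pdu : u (t, x) * (n.+1%:R * (phi (t + hseq n, x) - phi (t, x))) @[n --> \oo]
        --> u (t, x) * partial_t phi (t, x) by exact: cvgMr pd.
    have Hc := cvgD (cvgM ud pc) pdu.
    have PE : (fun n => Psi n x) = (fun n => n.+1%:R * (u (t + hseq n, x) - u (t, x))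
        * phi (t + hseq n, x) + u (t, x) * (n.+1%:R * (phi (t + hseq n, x) - phi (t, x)))).
      by apply/funext => n; rewrite /Psi /w; ring.
    by rewrite PE; exact: Hc.
have dGJ : {ae mu, forall t, t \in `]0, T[ -> dG t = slice_int l J t}.
  apply: ae_imply dGE => t H1 tT; have := seq_derive (H1 tT).
  by move=> h; have := cvg_unique _ h (Gseq t tT); apply.
have := dGI _ _ (lexx 0) (ltW T0) (lexx T).
rewrite !G0 ?lexx ?subrr; [|by left|by right].
rewrite /int2 => E0; apply: etrans (esym E0).
have [iJ2 _] := fubini_Om T0 l0 cJ.
have sub : (`]0, T[%classic : set R) `<=` `[0, T]%classic.
  by move=> x /=; rewrite !in_itv/= => /andP[/ltW-> /ltW->].
have idG : mu.-integrable `]0, T[ (EFin \o dG) by apply: integrableS intdG.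
rewrite -Rintegral_itv_bndo_bndc//; congr fine.
have /integrableP[m1 _] := iJ2; have /integrableP[m2 _] := idG.
apply: ae_eq_integral => //.
by apply: ae_imply dGJ => t ht tT /=; rewrite ht.
Qed.
End weak_of_ae.

(** * The upwind scheme of a two-wave system *)

(** Data of a two-wave system on [0, l]: [r] travels to the right at speed [lam
    r s] and [s] to the left at speed [mu r s]; the outgoing [s] is reflected
    as [phi s] at 0, and the incoming [s] is prescribed as [S] at [l]. All of
    it is defined and Lipschitz for all states, the speeds being truncated far
    from equilibrium. That mu <= lam and that [phi] is 1-Lipschitz make the
    reflection at 0 harmless: it does not increase slopes. The factor [a], a
    lower bound for the speeds, converts the slope [sg] of [S] in time into a
    slope in space. *)
Record wave_system {R : realType} (l a Lam sg : R) (lam mu : R -> R -> R)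
    (phi S : R -> R) : Prop := {
  ws_l : 0 < l;
  ws_a : 0 < a;
  ws_mu_lo : forall r s, a <= mu r s;
  ws_mu_lam : forall r s, mu r s <= lam r s;
  ws_lam_hi : forall r s, lam r s <= Lam;
  ws_lam_lip : forall e r s r' s',
    `|r - r'| <= e -> `|s - s'| <= e -> `|lam r s - lam r' s'| <= e;
  ws_mu_lip : forall e r s r' s',
    `|r - r'| <= e -> `|s - s'| <= e -> `|mu r s - mu r' s'| <= e;
  ws_phi_lip : forall s s', `|phi s - phi s'| <= `|s - s'|;
  ws_phi0 : phi 0 = 0;
  ws_sg : 0 <= sg;
  ws_S_lip : forall t t', `|S t - S t'| <= sg * `|t - t'| }.

Section scheme.
Context {R : realType}.
Variables (l a Lam sg : R) (lam mu : R -> R -> R) (phi S : R -> R).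
Hypothesis W : wave_system l a Lam sg lam mu phi S.

Let l0 := ws_l W.
Let a0 := ws_a W.
Let mu_lo := ws_mu_lo W.
Let mu_lam := ws_mu_lam W.
Let lam_hi := ws_lam_hi W.
Let lam_lip := ws_lam_lip W.
Let mu_lip := ws_mu_lip W.
Let phi_lip := ws_phi_lip W.
Let phi0 := ws_phi0 W.
Let sg0 := ws_sg W.
Let S_lip := ws_S_lip W.

(** The ratio of the speeds at the left end: in a time that [r] takes to cover
    y, [s] covers [rho] y. *)
Definition rho r s := mu r s / lam r s.

Lemma mu_gt0 r s : 0 < mu r s. Proof. exact: lt_le_trans (mu_lo _ _). Qed.
Lemma lam_gt0 r s : 0 < lam r s. Proof. exact: lt_le_trans (mu_gt0 _ _) (mu_lam _ _). Qed.
Lemma lam_lo r s : a <= lam r s. Proof. exact: le_trans (mu_lo _ _) (mu_lam _ _). Qed.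
Lemma mu_hi r s : mu r s <= Lam. Proof. exact: le_trans (mu_lam _ _) (lam_hi _ _). Qed.
Lemma a_le_Lam : a <= Lam. Proof. exact: le_trans (mu_lo 0 0) (mu_hi 0 0). Qed.
Lemma Lam_gt0 : 0 < Lam. Proof. exact: lt_le_trans a0 a_le_Lam. Qed.
Lemma rho_gt0 r s : 0 < rho r s. Proof. by rewrite divr_gt0 ?mu_gt0 ?lam_gt0. Qed.
Lemma rho_le1 r s : rho r s <= 1.
Proof. by rewrite ler_pdivrMr ?lam_gt0// mul1r. Qed.
Lemma rho_lo r s : a / Lam <= rho r s.
Proof.
rewrite ler_pdivlMr ?lam_gt0// mulrAC ler_pdivrMr ?Lam_gt0//.
by apply: ler_pM => //; rewrite ltW// lam_gt0.
Qed.

Lemma rho_lip e r s r' s' : `|r - r'| <= e -> `|s - s'| <= e ->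
  `|rho r s - rho r' s'| <= 2 * e / a.
Proof.
move=> hr hs; have e0 : 0 <= e := le_trans (normr_ge0 _) hr.
have l1 := lam_gt0 r s; have l2 := lam_gt0 r' s'.
have -> : rho r s - rho r' s' =
  ((mu r s - mu r' s') - rho r' s' * (lam r s - lam r' s')) / lam r s.
  by rewrite /rho; field; rewrite !gt_eqF.
rewrite normrM normfV (gtr0_norm l1).
have h : `|(mu r s - mu r' s') - rho r' s' * (lam r s - lam r' s')| <= 2 * e.
  have := ler_normB (mu r s - mu r' s') (rho r' s' * (lam r s - lam r' s')).
  have := mu_lip hr hs.
  have : `|rho r' s' * (lam r s - lam r' s')| <= 1 * e.
    rewrite normrM (gtr0_norm (rho_gt0 _ _)); apply: ler_pM => //.
    - exact: ltW (rho_gt0 _ _).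
    - exact: rho_le1.
    - exact: lam_lip.
  lra.
apply: ler_pM => //; first by rewrite invr_ge0 ltW.
by rewrite lef_pV2 ?posrE// lam_lo.
Qed.

(** Outside [0, l] the invariants are extended by the boundary conditions, with
    speeds frozen at the end: the value at y < 0 is the one that enters at 0
    when a wave issued from y reaches it. *)
Definition extL (r s : R -> R) y :=
  if 0 <= y then r y else phi (s (- (rho (r 0) (s 0) * y))).

Definition extR t (r s : R -> R) y :=
  if y <= l then s y else S (t + (y - l) / mu (r l) (s l)).

(** One time step [h]: each invariant is read at the foot of the characteristic
    line of its speed at time [t]. *)
Definition stepr h (r s : R -> R) x :=
  extL r s (clamp l x - lam (r (clamp l x)) (s (clamp l x)) * h).

Definition steps h t (r s : R -> R) x :=
  extR t r s (clamp l x + mu (r (clamp l x)) (s (clamp l x)) * h).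

(** The states that the step preserves, at time [t]: slopes at most [L], values
    at most [m], and both boundary conditions. *)
Record st (t L m : R) (r s : R -> R) : Prop := {
  st_rc : forall x, r (clamp l x) = r x;
  st_sc : forall x, s (clamp l x) = s x;
  st_rl : klip L r;
  st_sl : klip L s;
  st_left : r 0 = phi (s 0);
  st_right : s l = S t;
  st_rm : forall x, `|r x| <= m;
  st_sm : forall x, `|s x| <= m }.

Lemma klip_ge0 L (u : R -> R) : klip L u -> 0 <= L.
Proof. by move=> /(_ 1 0); rewrite subr0 normr1 mulr1; exact: le_trans. Qed.

Lemma extL_le0 r s y : r 0 = phi (s 0) -> y <= 0 ->
  extL r s y = phi (s (- (rho (r 0) (s 0) * y))).
Proof.
move=> rs; rewrite le_eqVlt => /orP[/eqP->|y0].
  by rewrite /extL lexx mulr0 oppr0.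
by rewrite /extL leNgt y0.
Qed.

Lemma extL_ge0 r s y : 0 <= y -> extL r s y = r y.
Proof. by rewrite /extL => ->. Qed.

Lemma extR_le t r s y : y <= l -> extR t r s y = s y.
Proof. by rewrite /extR => ->. Qed.

Lemma extR_ge t r s y : s l = S t -> l <= y ->
  extR t r s y = S (t + (y - l) / mu (r l) (s l)).
Proof.
move=> sl; rewrite le_eqVlt => /orP[/eqP<-|y0].
  by rewrite /extR lexx subrr mul0r addr0.
by rewrite /extR leNgt y0.
Qed.

Lemma klip_glue L c (u : R -> R) :
  (forall x y, x <= y -> y <= c -> `|u x - u y| <= L * `|x - y|) ->
  (forall x y, c <= x -> x <= y -> `|u x - u y| <= L * `|x - y|) -> klip L u.
Proof.
move=> h1 h2 x y; wlog xy : x y / x <= y => [H|].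
  by have [/H//|/ltW/H] := leP x y; rewrite distrC (distrC y).
have [yc|cy] := leP y c; first exact: h1.
have [cx|xc] := leP c x; first exact: h2.
have := h1 x c (ltW xc) (lexx c); have := h2 c y (lexx c) (ltW cy).
have := ler_distD (u c) (u x) (u y).
have -> : `|x - c| = c - x by rewrite distrC ger0_norm ?subr_ge0// ltW.
have -> : `|c - y| = y - c by rewrite distrC ger0_norm ?subr_ge0// ltW.
have -> : `|x - y| = y - x by rewrite distrC ger0_norm ?subr_ge0.
lra.
Qed.

Lemma extL_klip L r s : klip L r -> klip L s -> r 0 = phi (s 0) -> klip L (extL r s).
Proof.
move=> rl sl rs; have L0 := klip_ge0 rl; apply: (@klip_glue _ 0) => x y.
  move=> xy y0; rewrite !extL_le0 ?(le_trans xy)//.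
  apply: le_trans (phi_lip _ _) _; apply: le_trans (sl _ _) _.
  apply: ler_wpM2l => //; rewrite -opprD normrN -mulrBr normrM.
  by rewrite (gtr0_norm (rho_gt0 _ _)) ler_piMl// rho_le1.
by move=> x0 xy; rewrite !extL_ge0 ?(le_trans x0)//; exact: rl.
Qed.

Lemma extR_klip t L r s : klip L s -> s l = S t -> sg <= a * L -> klip L (extR t r s).
Proof.
move=> sl sS sgL; have L0 := klip_ge0 sl; apply: (@klip_glue _ l) => x y.
  by move=> xy yl; rewrite !extR_le ?(le_trans xy)//; exact: sl.
move=> lx xy; rewrite !extR_ge ?(le_trans lx)//.
apply: le_trans (S_lip _ _) _.
have -> : t + (x - l) / mu (r l) (s l) - (t + (y - l) / mu (r l) (s l))
  = (x - y) / mu (r l) (s l) by field; rewrite gt_eqF// mu_gt0.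
have m0 := mu_gt0 (r l) (s l).
rewrite normrM normfV (gtr0_norm m0) mulrCA mulrC; apply: ler_wpM2r => //.
rewrite ler_pdivrMr//; apply: le_trans sgL _; rewrite mulrC; exact: ler_wpM2l.
Qed.

Lemma extL_bound m r s y : (forall x, `|r x| <= m) -> (forall x, `|s x| <= m) ->
  `|extL r s y| <= m.
Proof.
move=> rm sm; rewrite /extL; case: ifP => // _.
by have := phi_lip (s (- (rho (r 0) (s 0) * y))) 0; rewrite phi0 !subr0 => /le_trans; apply.
Qed.

Lemma extR_bound t m r s y : (forall x, `|s x| <= m) -> (forall t, `|S t| <= m) ->
  `|extR t r s y| <= m.
Proof. by move=> sm Sm; rewrite /extR; case: ifP. Qed.

Lemma klip_shift L C (E v : R -> R) h : klip L E -> 0 <= h ->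
  klip C v -> klip (L * (1 + h * C)) (fun x => E (clamp l x + v (clamp l x) * h)).
Proof.
move=> EL h0 vC x y; have L0 := klip_ge0 EL; have C0 := klip_ge0 vC.
apply: le_trans (EL _ _) _; rewrite -mulrA; apply: ler_wpM2l => //.
set x' := clamp l x; set y' := clamp l y.
have -> : x' + v x' * h - (y' + v y' * h) = (x' - y') + h * (v x' - v y') by ring.
apply: le_trans (ler_normD _ _) _; rewrite mulrDl mul1r; apply: lerD.
  exact: clamp_lip.
rewrite normrM (ger0_norm h0) -mulrA; apply: ler_wpM2l => //.
apply: le_trans (vC _ _) _; apply: ler_wpM2l => //; exact: clamp_lip.
Qed.

Lemma klip_lam L r s : klip L r -> klip L s -> klip L (fun x => lam (r x) (s x)).
Proof. by move=> rl sl x y; apply: lam_lip; [exact: rl|exact: sl]. Qed.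

Lemma klip_mu L r s : klip L r -> klip L s -> klip L (fun x => mu (r x) (s x)).
Proof. by move=> rl sl x y; apply: mu_lip; [exact: rl|exact: sl]. Qed.

Lemma clamp0 : clamp l 0 = 0. Proof. by rewrite clamp_id// ltW. Qed.
Lemma clampl : clamp l l = l. Proof. by rewrite clamp_id// ltW. Qed.

(** The slope grows by h L^2, as for the Riccati equation, since the speeds are
    Lipschitz functions of the state; the ends add nothing, as the slope of [S]
    in time is at most [a * L]. *)
Lemma step_st t h L m r s : st t L m r s -> 0 <= h -> Lam * h <= l ->
  sg <= a * L -> (forall t, `|S t| <= m) ->
  st (t + h) (L * (1 + h * L)) m (stepr h r s) (steps h t r s).
Proof.
move=> w h0 hl sgL Sm; have lc := ltW l0.
have [rc sc rl sl left right rm sm] := w.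
split.
- by move=> x; rewrite /stepr clampK.
- by move=> x; rewrite /steps clampK.
- have lv : klip L (fun x => - lam (r x) (s x)).
    exact: klip_opp (klip_lam rl sl).
  have := klip_shift (extL_klip rl sl left) h0 lv.
  by under eq_fun do rewrite mulNr.
- exact: klip_shift (extR_klip r sl right sgL) h0 (klip_mu rl sl).
- have m0 := mu_gt0 (r 0) (s 0); have la0 := lam_gt0 (r 0) (s 0).
  rewrite /stepr /steps clamp0 sub0r add0r.
  rewrite extL_le0//; last by rewrite oppr_le0 mulr_ge0// ltW.
  rewrite extR_le; last by apply: le_trans hl; apply: ler_wpM2r => //; exact: mu_hi.
  by congr (phi (s _)); rewrite /rho; field; rewrite gt_eqF.
- have m0 := mu_gt0 (r l) (s l).
  rewrite /steps clampl extR_ge//; last by rewrite lerDl mulr_ge0// ltW.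
  by congr (S (t + _)); field; rewrite gt_eqF.
- by move=> x; exact: extL_bound.
- by move=> x; exact: extR_bound.
Qed.

Lemma step_near t h L m r s : st t L m r s -> 0 <= h -> sg <= a * L ->
  forall x, `|stepr h r s x - r x| <= L * Lam * h /\ `|steps h t r s x - s x| <= L * Lam * h.
Proof.
move=> [rc sc rl sl left right rm sm] h0 sgL x.
have L0 := klip_ge0 rl.
set x' := clamp l x; have x0 : 0 <= x' by exact: clamp_ge0.
have xl : x' <= l by apply: clamp_le; exact: ltW.
split.
- rewrite /stepr -(rc x) -/x' -(extL_ge0 r s x0).
  apply: le_trans (extL_klip rl sl left _ _) _; rewrite -mulrA; apply: ler_wpM2l => //.
  rewrite extL_ge0// addrAC subrr add0r normrN ger0_norm; last by rewrite mulr_ge0// ltW// lam_gt0.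
  by apply: ler_wpM2r.
- rewrite /steps -(sc x) -/x' -(extR_le t r s xl).
  apply: le_trans (extR_klip r sl right sgL _ _) _; rewrite -mulrA; apply: ler_wpM2l => //.
  rewrite extR_le// addrAC subrr add0r ger0_norm; last by rewrite mulr_ge0// ltW// mu_gt0.
  by apply: ler_wpM2r => //; exact: mu_hi.
Qed.

(** One step multiplies the uniform distance of two states by 1 + O(h). *)
Lemma step_stable t h L m D r s r' s' : st t L m r s -> st t L m r' s' ->
  0 <= h -> sg <= a * L -> 0 <= D ->
  (forall x, `|r x - r' x| <= D) -> (forall x, `|s x - s' x| <= D) ->
  forall x, `|stepr h r s x - stepr h r' s' x| <= D + D * (L + 2 * L * Lam / a) * h /\
    `|steps h t r s x - steps h t r' s' x| <= D + D * (L + 2 * L * Lam / a) * h.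
Proof.
move=> [rc sc rl sl left right rm sm] [rc' sc' rl' sl' left' right' rm' sm'].
move=> h0 sgL D0 Dr Ds x; have L0 := klip_ge0 rl.
have Lam0 := Lam_gt0.
rewrite /stepr /steps; set y := clamp l x.
have y0 : 0 <= y by exact: clamp_ge0.
have yl : y <= l by apply: clamp_le; exact: ltW.
have LLa : 0 <= L * Lam / a by rewrite divr_ge0// ?mulr_ge0// ltW.
split.
- set z := y - lam (r y) (s y) * h; set z' := y - lam (r' y) (s' y) * h.
  have zz : `|z - z'| <= D * h.
    have -> : z - z' = (lam (r' y) (s' y) - lam (r y) (s y)) * h by rewrite /z /z'; ring.
    rewrite normrM (ger0_norm h0); apply: ler_wpM2r => //.
    by apply: lam_lip; rewrite distrC.
  have h1 : `|extL r' s' z - extL r' s' z'| <= L * (D * h).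
    by apply: le_trans (extL_klip rl' sl' left' _ _) _; apply: ler_wpM2l.
  have h2 : `|extL r s z - extL r' s' z| <= D + L * (2 * D / a) * (Lam * h).
    have [z0|z0] := leP 0 z.
      rewrite !extL_ge0//; apply: le_trans (Dr _) _; rewrite lerDl !mulr_ge0 ?invr_ge0// ltW//.
    rewrite !extL_le0 ?(ltW z0)//; apply: le_trans (phi_lip _ _) _.
    apply: le_trans (ler_distD (s' (- (rho (r 0) (s 0) * z))) _ _) _; apply: lerD => //.
    apply: le_trans (sl' _ _) _; rewrite -[leRHS]mulrA; apply: ler_wpM2l => //.
    rewrite -opprD normrN -mulrBl normrM; apply: ler_pM => //.
      by apply: rho_lip.
    rewrite ler0_norm ?(ltW z0)// /z opprB.
    have : lam (r y) (s y) * h <= Lam * h by apply: ler_wpM2r.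
    lra.
  have := ler_distD (extL r' s' z) (extL r s z) (extL r' s' z').
  have -> : D * (L + 2 * L * Lam / a) * h = L * (D * h) + L * (2 * D / a) * (Lam * h) by ring.
  lra.
- set z := y + mu (r y) (s y) * h; set z' := y + mu (r' y) (s' y) * h.
  have zz : `|z - z'| <= D * h.
    have -> : z - z' = (mu (r y) (s y) - mu (r' y) (s' y)) * h by rewrite /z /z'; ring.
    rewrite normrM (ger0_norm h0); apply: ler_wpM2r => //.
    by apply: mu_lip.
  have h1 : `|extR t r' s' z - extR t r' s' z'| <= L * (D * h).
    by apply: le_trans (extR_klip r' sl' right' sgL _ _) _; apply: ler_wpM2l.
  have h2 : `|extR t r s z - extR t r' s' z| <= D + L * (D / a) * (Lam * h).
    have [z0|z0] := leP z l.
      rewrite !extR_le//; apply: le_trans (Ds _) _; rewrite lerDl !mulr_ge0 ?invr_ge0// ltW//.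
    rewrite !extR_ge ?(ltW z0)//; apply: le_trans (S_lip _ _) _.
    set m1 := mu _ _; set m2 := mu _ _.
    have m10 : 0 < m1 by exact: mu_gt0.
    have m20 : 0 < m2 by exact: mu_gt0.
    have -> : t + (z - l) / m1 - (t + (z - l) / m2) = (z - l) * (m2 - m1) / (m1 * m2).
      by field; rewrite !gt_eqF.
    have dm : `|m2 - m1| <= D by rewrite distrC; exact: mu_lip.
    have zl : `|z - l| <= Lam * h.
      rewrite ger0_norm ?subr_ge0 ?(ltW z0)// /z.
      have : mu (r y) (s y) * h <= Lam * h by apply: ler_wpM2r => //; exact: mu_hi.
      lra.
    have n1 : `|(z - l) * (m2 - m1) / (m1 * m2)| <= (Lam * h) * D / (a * a).
      rewrite !normrM normfV normrM (gtr0_norm m10) (gtr0_norm m20).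
      apply: ler_pM; [exact: mulr_ge0| |exact: ler_pM|].
        by rewrite invr_ge0 ltW// mulr_gt0.
      rewrite lef_pV2 ?posrE ?mulr_gt0//.
      by apply: ler_pM; rewrite ?mu_lo// ltW.
    have n0 : 0 <= (Lam * h) * D / (a * a).
      by apply: le_trans n1.
    have : sg * `|(z - l) * (m2 - m1) / (m1 * m2)| <= a * L * ((Lam * h) * D / (a * a)).
      by apply: ler_pM.
    have -> : a * L * ((Lam * h) * D / (a * a)) = L * (D / a) * (Lam * h).
      by field; rewrite gt_eqF.
    lra.
  have := ler_distD (extR t r' s' z) (extR t r s z) (extR t r' s' z').
  have -> : D * (L + 2 * L * Lam / a) * h = L * (D * h) + 2 * (L * (D / a) * (Lam * h)) by ring.
  have : 0 <= L * (D / a) * (Lam * h) by rewrite !mulr_ge0 ?invr_ge0// ltW.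
  lra.
Qed.


(** Consistency: a step of 2k and two steps of k differ by O(k^2). In each of
    them the foot of the characteristic is found in the interior, beyond the
    end after the first half step, or beyond it after the second one. *)
Lemma two_half_steps t k L m r s : st t L m r s -> 0 < k -> Lam * (2 * k) <= l ->
  sg <= a * L -> forall x,
  let r1 := stepr k r s in let s1 := steps k t r s in
  `|stepr k r1 s1 x - stepr (2 * k) r s x| <= L * (5 * (Lam / a) ^+ 2 * (L * Lam * k) * k) /\
  `|steps k (t + k) r1 s1 x - steps (2 * k) t r s x| <= L * (5 * (Lam / a) ^+ 2 * (L * Lam * k) * k).
Proof.
move=> w k0 kl sgL x r1 s1.
have [rc sc rl sl left right rm sm] := w.
have L0 := klip_ge0 rl.
have Lam0 := Lam_gt0.
have near y := step_near w (ltW k0) sgL y.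
set dl := L * Lam * k.
have dl0 : 0 <= dl by rewrite !mulr_ge0// ltW.
set q := Lam / a.
have q1 : 1 <= q by rewrite ler_pdivlMr// mul1r a_le_Lam.
have qq : q <= q ^+ 2 by rewrite expr2; apply: ler_peMl => //; lra.
have dq : dl * k <= q ^+ 2 * dl * k.
  by rewrite -mulrA; apply: ler_peMl; [rewrite mulr_ge0// ltW|lra].
have dk0 : 0 <= dl * k by rewrite mulr_ge0// ltW.
have dqq : q * dl * k <= q ^+ 2 * dl * k.
  by rewrite -2!mulrA; exact: (ler_wpM2r dk0 qq).
pose y := clamp l x.
have y0 : 0 <= y by exact: clamp_ge0.
have yl : y <= l by apply: clamp_le; exact: ltW.
have lamk u v : lam u v * k <= Lam * k by apply: ler_wpM2r => //; exact: ltW.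
have muk u v : mu u v * k <= Lam * k by apply: ler_wpM2r; [exact: ltW|exact: mu_hi].
have lamk0 u v : 0 < lam u v * k by rewrite mulr_gt0 ?lam_gt0.
have muk0 u v : 0 < mu u v * k by rewrite mulr_gt0 ?mu_gt0.
have near_arg z z' d : `|z - z'| <= d -> L * `|z - z'| <= L * d by exact: ler_wpM2l.
split.
- rewrite {1}/stepr -/y; set l1 := lam (r1 y) (s1 y).
  rewrite {1}/stepr -/y; set la := lam (r y) (s y).
  have dl1 : `|l1 - la| <= dl by apply: lam_lip; have [] := near y.
  have l1k := lamk (r1 y) (s1 y); rewrite -/l1 in l1k.
  have l1k0 := lamk0 (r1 y) (s1 y); rewrite -/l1 in l1k0.
  pose y1 := y - l1 * k; rewrite -/y1.
  have [y10|y10] := leP 0 y1.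
    rewrite (extL_ge0 r1 s1 y10).
    have y1c : clamp l y1 = y1 by apply: clamp_id => //; rewrite /y1; lra.
    rewrite /r1 /stepr y1c.
    apply: le_trans (extL_klip rl sl left _ _) _; apply: near_arg.
    set l2 := lam (r y1) (s y1).
    have dl2 : `|l2 - la| <= dl.
      have yy : L * `|y1 - y| <= dl.
        rewrite /dl -mulrA; apply: ler_wpM2l => //.
        rewrite /y1 addrAC subrr add0r normrN ger0_norm//; exact: ltW.
      by apply: lam_lip; [exact: le_trans (rl _ _) yy|exact: le_trans (sl _ _) yy].
    have -> : y1 - l2 * k - (y - la * (2 * k)) = - ((l1 - la) + (l2 - la)) * k.
      by rewrite /y1; ring.
    rewrite normrM normrN (ger0_norm (ltW k0)).
    have : `|l1 - la + (l2 - la)| <= 2 * dl by have := ler_normD (l1 - la) (l2 - la); lra.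
    move=> /(ler_wpM2r (ltW k0)); lra.
  have left1 : r1 0 = phi (s1 0).
    have kl' : Lam * k <= l by lra.
    have := muk (r 0) (s 0); have := muk0 (r 0) (s 0) => h1 h2.
    rewrite /r1 /s1 /stepr /steps clamp0 sub0r add0r.
    rewrite extL_le0//; last by rewrite oppr_le0 ltW// lamk0.
    rewrite extR_le; last lra.
    by congr (phi (s _)); rewrite /rho; field; rewrite gt_eqF// lam_gt0.
  rewrite (extL_le0 left1 (ltW y10)).
  set rho1 := rho (r1 0) (s1 0); set z := - (rho1 * y1).
  have z0 : 0 <= z by rewrite /z -mulrN mulr_ge0 ?oppr_ge0 ?ltW// rho_gt0.
  have zk : z <= Lam * k.
    have : rho1 * (- y1) <= - y1 by rewrite ler_piMl ?rho_le1// oppr_ge0 ltW.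
    rewrite /z mulrN; rewrite /y1 in y10 *; lra.
  set mz := mu (r z) (s z).
  have zc : clamp l z = z by apply: clamp_id => //; lra.
  have s1z : s1 z = s (z + mz * k).
    rewrite /s1 /steps zc extR_le//; have := muk (r z) (s z); rewrite -/mz; lra.
  rewrite s1z.
  set rh0 := rho (r 0) (s 0).
  have rh0_gt0 : 0 < rh0 by exact: rho_gt0.
  pose Y := - ((z + mz * k) / rh0).
  have Y0 : Y <= 0.
    rewrite /Y oppr_le0 divr_ge0 ?(ltW rh0_gt0)// addr_ge0// ltW//; exact: muk0.
  have -> : phi (s (z + mz * k)) = extL r s Y.
    rewrite extL_le0// -/rh0; congr (phi (s _)); rewrite /Y; field.
    by rewrite gt_eqF.
  apply: le_trans (extL_klip rl sl left _ _) _; apply: near_arg.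
  set la0 := lam (r 0) (s 0); set mu0 := mu (r 0) (s 0).
  have la00 : 0 < la0 by exact: lam_gt0.
  have mu00 : 0 < mu0 by exact: mu_gt0.
  have yk : y <= Lam * k by rewrite /y1 in y10; lra.
  have dla0 : `|la0 - la| <= dl.
    have yy : L * `|0 - y| <= dl.
      by rewrite /dl -mulrA; apply: ler_wpM2l => //; rewrite sub0r normrN ger0_norm.
    by apply: lam_lip; [exact: le_trans (rl _ _) yy|exact: le_trans (sl _ _) yy].
  have dmz : `|mz - mu0| <= dl.
    have yy : L * `|z - 0| <= dl.
      by rewrite /dl -mulrA; apply: ler_wpM2l => //; rewrite subr0 ger0_norm.
    by apply: mu_lip; [exact: le_trans (rl _ _) yy|exact: le_trans (sl _ _) yy].
  have dr1 : `|rho1 - rh0| <= 2 * dl / a by apply: rho_lip; have [] := near 0.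
  have ir0 : rh0^-1 <= q.
    by rewrite /q -[leRHS]invrK lef_pV2 ?posrE ?invr_gt0 ?divr_gt0// invf_div rho_lo.
  have -> : Y - (y - la * (2 * k)) =
     ((rho1 - rh0) * y1 - (mz - mu0) * k) / rh0 - ((l1 - la) + (la0 - la)) * k.
    rewrite /Y /z /y1 /rh0 /rho -/la0 -/mu0; field; by rewrite !gt_eqF.
  apply: le_trans (ler_normB _ _) _.
  have b1 : `|((rho1 - rh0) * y1 - (mz - mu0) * k) / rh0| <= (2 * dl / a * (Lam * k) + dl * k) * q.
    rewrite normrM normfV (gtr0_norm rh0_gt0); apply: ler_pM => //.
      by rewrite invr_ge0 ltW.
    apply: le_trans (ler_normB _ _) _; rewrite !normrM; apply: lerD.
      apply: ler_pM => //; rewrite ler0_norm ?(ltW y10)// /y1; lra.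
    by rewrite (ger0_norm (ltW k0)); apply: ler_wpM2r => //; exact: ltW.
  have b2 : `|((l1 - la) + (la0 - la)) * k| <= 2 * dl * k.
    rewrite normrM (ger0_norm (ltW k0)); apply: ler_wpM2r; first exact: ltW.
    by have := ler_normD (l1 - la) (la0 - la); lra.
  have e1 : (2 * dl / a * (Lam * k) + dl * k) * q = 2 * (q ^+ 2 * dl * k) + q * dl * k.
    by rewrite /q; field; rewrite gt_eqF.
  rewrite e1 in b1; lra.
- rewrite {1}/steps -/y; set m1 := mu (r1 y) (s1 y).
  rewrite {1}/steps -/y; set ma := mu (r y) (s y).
  have dm1 : `|m1 - ma| <= dl by apply: mu_lip; have [] := near y.
  have m1k := muk (r1 y) (s1 y); rewrite -/m1 in m1k.
  have m1k0 := muk0 (r1 y) (s1 y); rewrite -/m1 in m1k0.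
  pose y1 := y + m1 * k; rewrite -/y1.
  have [y10|y10] := leP y1 l.
    rewrite (extR_le (t + k) r1 s1 y10).
    have y1c : clamp l y1 = y1 by apply: clamp_id => //; rewrite /y1; lra.
    rewrite /s1 /steps y1c.
    apply: le_trans (extR_klip r sl right sgL _ _) _; apply: near_arg.
    set m2 := mu (r y1) (s y1).
    have dm2 : `|m2 - ma| <= dl.
      have yy : L * `|y1 - y| <= dl.
        rewrite /dl -mulrA; apply: ler_wpM2l => //.
        rewrite /y1 addrAC subrr add0r ger0_norm//; exact: ltW.
      by apply: mu_lip; [exact: le_trans (rl _ _) yy|exact: le_trans (sl _ _) yy].
    have -> : y1 + m2 * k - (y + ma * (2 * k)) = ((m1 - ma) + (m2 - ma)) * k.
      by rewrite /y1; ring.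
    rewrite normrM (ger0_norm (ltW k0)).
    have : `|m1 - ma + (m2 - ma)| <= 2 * dl by have := ler_normD (m1 - ma) (m2 - ma); lra.
    move=> /(ler_wpM2r (ltW k0)); lra.
  have right1 : s1 l = S (t + k).
    rewrite /s1 /steps clampl extR_ge//; last by rewrite lerDl ltW// muk0.
    by congr (S (t + _)); field; rewrite gt_eqF// mu_gt0.
  rewrite (extR_ge _ right1 (ltW y10)).
  set m1l := mu (r1 l) (s1 l); set ml := mu (r l) (s l).
  have m1l0 : 0 < m1l by exact: mu_gt0.
  have ml0 : 0 < ml by exact: mu_gt0.
  have yy1 : 0 <= y1 - l by rewrite subr_ge0 ltW.
  pose Y := l + ml * (k + (y1 - l) / m1l).
  have Yl : l <= Y.
    by rewrite /Y lerDl mulr_ge0 ?(ltW ml0)// addr_ge0 ?(ltW k0)// divr_ge0 ?(ltW m1l0).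
  have -> : S (t + k + (y1 - l) / m1l) = extR t r s Y.
    rewrite extR_ge// -/ml; congr S; rewrite /Y; field; by rewrite !gt_eqF.
  apply: le_trans (extR_klip r sl right sgL _ _) _; apply: near_arg.
  have ly : l - y <= Lam * k by rewrite /y1 in y10; lra.
  have dml : `|ml - ma| <= dl.
    have yy : L * `|l - y| <= dl.
      by rewrite /dl -mulrA; apply: ler_wpM2l => //; rewrite ger0_norm ?subr_ge0.
    by apply: mu_lip; [exact: le_trans (rl _ _) yy|exact: le_trans (sl _ _) yy].
  have dm1l : `|m1l - ml| <= dl by apply: mu_lip; have [] := near l.
  have -> : Y - (y + ma * (2 * k)) =
     - ((m1l - ml) * (y1 - l)) / m1l + ((m1 - ma) + (ml - ma)) * k.
    rewrite /Y /y1; field; by rewrite !gt_eqF.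
  apply: le_trans (ler_normD _ _) _.
  have b1 : `|- ((m1l - ml) * (y1 - l)) / m1l| <= dl * (Lam * k) / a.
    rewrite normrM normrN normfV (gtr0_norm m1l0) normrM; apply: ler_pM.
    - by rewrite mulr_ge0.
    - by rewrite invr_ge0 ltW.
    - apply: ler_pM => //; rewrite ger0_norm// /y1; lra.
    - by rewrite lef_pV2 ?posrE// mu_lo.
  have b2 : `|((m1 - ma) + (ml - ma)) * k| <= 2 * dl * k.
    rewrite normrM (ger0_norm (ltW k0)); apply: ler_wpM2r; first exact: ltW.
    by have := ler_normD (m1 - ma) (ml - ma); lra.
  have e1 : dl * (Lam * k) / a = q * dl * k by rewrite /q; ring.
  rewrite e1 in b1; lra.
Qed.

(** The notion of solution on [ta, tb]. The last two fields say that an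
    invariant varies to second order along a line of its own speed, and
    linearly in the error made on that speed; for Lipschitz functions it is a
    form of the two transport equations that needs no derivative, survives
    uniform limits, and is within reach of a comparison with the scheme. *)
Record csol (ta tb L Lt C m : R) (r s : R -> R -> R) : Prop := {
  cs_rc : forall t x, ta <= t -> t <= tb -> r t (clamp l x) = r t x;
  cs_sc : forall t x, ta <= t -> t <= tb -> s t (clamp l x) = s t x;
  cs_rx : forall t, ta <= t -> t <= tb -> klip L (r t);
  cs_sx : forall t, ta <= t -> t <= tb -> klip L (s t);
  cs_rt : forall t t' x, ta <= t -> t <= tb -> ta <= t' -> t' <= tb ->
    `|r t x - r t' x| <= Lt * `|t - t'|;
  cs_st : forall t t' x, ta <= t -> t <= tb -> ta <= t' -> t' <= tb ->
    `|s t x - s t' x| <= Lt * `|t - t'|;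
  cs_rm : forall t x, ta <= t -> t <= tb -> `|r t x| <= m;
  cs_sm : forall t x, ta <= t -> t <= tb -> `|s t x| <= m;
  cs_left : forall t, ta <= t -> t <= tb -> r t 0 = phi (s t 0);
  cs_right : forall t, ta <= t -> t <= tb -> s t l = S t;
  cs_charr : forall t h x k, ta <= t -> 0 <= h -> t + h <= tb -> `|k| <= Lam ->
    0 <= x -> x <= l -> 0 <= x + k * h -> x + k * h <= l ->
    `|r (t + h) (x + k * h) - r t x| <= C * (h + `|lam (r t x) (s t x) - k|) * h;
  cs_chars : forall t h x k, ta <= t -> 0 <= h -> t + h <= tb -> `|k| <= Lam ->
    0 <= x -> x <= l -> 0 <= x - k * h -> x - k * h <= l ->
    `|s (t + h) (x - k * h) - s t x| <= C * (h + `|mu (r t x) (s t x) - k|) * h }.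

Lemma csol_st ta tb L Lt C m r s t : csol ta tb L Lt C m r s -> ta <= t -> t <= tb ->
  st t L m (r t) (s t).
Proof.
move=> w h1 h2; split.
- by move=> x; exact: cs_rc w _ _ h1 h2.
- by move=> x; exact: cs_sc w _ _ h1 h2.
- exact: cs_rx w _ h1 h2.
- exact: cs_sx w _ h1 h2.
- exact: cs_left w _ h1 h2.
- exact: cs_right w _ h1 h2.
- by move=> x; exact: cs_rm w _ _ h1 h2.
- by move=> x; exact: cs_sm w _ _ h1 h2.
Qed.

(** A solution follows the scheme up to O(h^2) on each step. Beyond an end, the
    characteristic is broken at the time where it meets the end, and the
    boundary condition is used there. *)
Lemma csol_step ta tb L Lt C m r s t h : csol ta tb L Lt C m r s ->
  0 <= Lt -> 0 <= C -> ta <= t -> 0 < h -> t + h <= tb -> Lam * h <= l -> sg <= a * L ->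
  forall x,
  `|r (t + h) x - stepr h (r t) (s t) x|
     <= (2 * C * (1 + Lt + 2 * (L * Lam)) + L * (L * Lam) * Lam / a) * h * h /\
  `|s (t + h) x - steps h t (r t) (s t) x|
     <= (2 * C * (1 + Lt + 2 * (L * Lam)) + L * (L * Lam) * Lam / a) * h * h.
Proof.
move=> w Lt0 C0 tat h0 thb hl sgL x0.
have tb0 : t <= tb by lra.
have tbh : ta <= t + h by lra.
have w0 := csol_st w tat tb0; have [rc sc rl sl left right rm sm] := w0.
have L0 := klip_ge0 rl; have Lam0 := Lam_gt0; have h0' := ltW h0.
have LL0 : 0 <= L * Lam by rewrite mulr_ge0// ltW.
have LLLa : 0 <= L * (L * Lam) * Lam / a by rewrite divr_ge0 ?mulr_ge0// ltW.
set E := L * (L * Lam) * Lam / a in LLLa *.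
have Ehh : 0 <= E * h * h by apply: mulr_ge0 => //; exact: mulr_ge0.
have lamk u v : lam u v * h <= Lam * h by apply: ler_wpM2r.
have muk u v : mu u v * h <= Lam * h by apply: ler_wpM2r => //; exact: mu_hi.
have lamk0 u v : 0 < lam u v * h by rewrite mulr_gt0 ?lam_gt0.
have muk0 u v : 0 < mu u v * h by rewrite mulr_gt0 ?mu_gt0.
have lamn u v : `|lam u v| <= Lam by rewrite gtr0_norm ?lam_gt0.
have mun u v : `|mu u v| <= Lam by rewrite gtr0_norm ?mu_gt0// mu_hi.
have near_r z z' : `|z - z'| <= Lam * h -> `|r t z - r t z'| <= L * Lam * h.
  by move=> hz; apply: le_trans (rl _ _) _; rewrite -mulrA; exact: ler_wpM2l.
have near_s z z' : `|z - z'| <= Lam * h -> `|s t z - s t z'| <= L * Lam * h.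
  by move=> hz; apply: le_trans (sl _ _) _; rewrite -mulrA; exact: ler_wpM2l.
have near_lam z z' : `|z - z'| <= Lam * h ->
    `|lam (r t z) (s t z) - lam (r t z') (s t z')| <= L * Lam * h.
  by move=> hz; apply: lam_lip; [exact: near_r|exact: near_s].
have near_mu z z' : `|z - z'| <= Lam * h ->
    `|mu (r t z) (s t z) - mu (r t z') (s t z')| <= L * Lam * h.
  by move=> hz; apply: mu_lip; [exact: near_r|exact: near_s].
have err u v h' : 0 <= h' -> h' <= h -> u <= h -> v <= (Lt + 2 * (L * Lam)) * h -> 0 <= u -> 0 <= v ->
    C * (u + v) * h' <= C * (1 + Lt + 2 * (L * Lam)) * h * h.
  move=> h'0 h'h uh vh u0 v0; apply: ler_pM => //.
    by rewrite mulr_ge0// addr_ge0.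
  rewrite -mulrA; apply: ler_wpM2l => //; lra.
have fin v : v <= C * (1 + Lt + 2 * (L * Lam)) * h * h ->
    v <= (2 * C * (1 + Lt + 2 * (L * Lam)) + E) * h * h.
  have : 0 <= C * (1 + Lt + 2 * (L * Lam)) * h * h.
    by rewrite !mulr_ge0// !addr_ge0// mulr_ge0.
  lra.
have LLh : 0 <= L * Lam * h by rewrite mulr_ge0.
have Lth : 0 <= Lt * h by rewrite mulr_ge0.
pose x := clamp l x0.
have x00 : 0 <= x by exact: clamp_ge0.
have xl : x <= l by apply: clamp_le; exact: ltW.
split.
- rewrite -(cs_rc w x0 tbh thb) -/x /stepr -/x; set la := lam (r t x) (s t x).
  have la0 : 0 < la by exact: lam_gt0.
  have lah := lamk (r t x) (s t x); rewrite -/la in lah.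
  have lah0 := lamk0 (r t x) (s t x); rewrite -/la in lah0.
  pose y := x - la * h; rewrite -/y.
  have xy : `|x - y| <= Lam * h by rewrite /y opprB addrC subrK ger0_norm// ltW.
  have [y0|y0] := leP 0 y.
    have yl : y <= l by apply: le_trans xl; rewrite /y gerBl ltW.
    rewrite (extL_ge0 _ _ y0); apply: fin.
    have yx : x = y + la * h by rewrite /y; ring.
    rewrite {1}yx.
    apply: le_trans (cs_charr w tat h0' thb (lamn _ _) y0 yl _ _) _; rewrite -/la -?yx//.
    apply: err => //.
    have := near_lam y x; rewrite distrC => /(_ xy); lra.
  pose h1 := x / la; pose h2 := h - h1.
  have h10 : 0 <= h1 by rewrite divr_ge0// ltW.
  have h1h : h1 < h by rewrite /h1 ltr_pdivrMr// [h * _]mulrC -subr_lt0; exact: y0.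
  have h20 : 0 < h2 by rewrite subr_gt0.
  have h2h : h2 <= h by rewrite /h2 gerBl.
  have tau1 : ta <= t + h2 by apply: le_trans tat _; rewrite lerDl ltW.
  have tau2 : t + h2 <= tb by apply: le_trans thb; rewrite lerD2l.
  have x_la : 0 + la * h1 = x by rewrite /h1; field; rewrite gt_eqF.
  have th : t + h2 + h1 = t + h by rewrite /h2; ring.
  have x_small : `|0 - x| <= Lam * h.
    by rewrite sub0r normrN ger0_norm//; rewrite /y in y0; lra.
  rewrite (extL_le0 left (ltW y0)).
  set rh := rho (r t 0) (s t 0); set z := - (rh * y).
  have rh0 : 0 < rh by exact: rho_gt0.
  have zE : z = rh * la * h2 by rewrite /z /y /h2 /h1; field; rewrite gt_eqF.
  have z0 : 0 <= z by rewrite zE; apply: mulr_ge0; [apply: mulr_ge0|]; exact: ltW.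
  have zh : z <= Lam * h.
    have : rh * (- y) <= - y by rewrite ler_piMl ?rho_le1// oppr_ge0 ltW.
    rewrite /z mulrN; rewrite /y in y0 *; lra.
  have c1 : `|r (t + h) x - r (t + h2) 0| <= C * (1 + Lt + 2 * (L * Lam)) * h * h.
    rewrite -{1}th -{1}x_la.
    have b1 : 0 <= 0 + la * h1 by rewrite x_la.
    have b2 : 0 + la * h1 <= l by rewrite x_la.
    apply: le_trans (cs_charr w tau1 h10 _ (lamn _ _) (lexx 0) (ltW l0) b1 b2) _; first by rewrite th.
    apply: err => //; try exact: ltW.
    have dd : `|lam (r (t + h2) 0) (s (t + h2) 0) - lam (r t 0) (s t 0)| <= Lt * h.
      have tt : Lt * `|t + h2 - t| <= Lt * h.
        by apply: ler_wpM2l => //; rewrite addrAC subrr add0r gtr0_norm.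
      apply: lam_lip.
        exact: le_trans (cs_rt w _ tau1 tau2 tat tb0) tt.
      exact: le_trans (cs_st w _ tau1 tau2 tat tb0) tt.
    have := near_lam 0 x x_small; rewrite -/la.
    have := ler_distD (lam (r t 0) (s t 0)) (lam (r (t + h2) 0) (s (t + h2) 0)) la.
    lra.
  have c2 : `|s (t + h2) 0 - s t z| <= C * (1 + Lt + 2 * (L * Lam)) * h * h.
    have kn : `|rh * la| <= Lam.
      rewrite gtr0_norm; last exact: mulr_gt0.
      apply: le_trans (_ : la <= _); last exact: lam_hi.
      by rewrite ler_piMl ?rho_le1// ltW.
    have e0 : z - rh * la * h2 = 0 by rewrite zE subrr.
    have zl : z <= l by lra.
    have b1 : 0 <= z - rh * la * h2 by rewrite e0.
    have b2 : z - rh * la * h2 <= l by rewrite e0 ltW.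
    have := cs_chars w tat (ltW h20) tau2 kn z0 zl b1 b2; rewrite e0.
    move=> /le_trans; apply; apply: err => //; try exact: ltW.
    have n1 : `|mu (r t z) (s t z) - mu (r t 0) (s t 0)| <= L * Lam * h.
      by apply: near_mu; rewrite subr0 ger0_norm.
    have n2 : `|mu (r t 0) (s t 0) - rh * la| <= L * Lam * h.
      have -> : mu (r t 0) (s t 0) - rh * la = rh * (lam (r t 0) (s t 0) - la).
        by rewrite /rh /rho; field; rewrite gt_eqF// lam_gt0.
      rewrite normrM (gtr0_norm rh0) -[leRHS]mul1r; apply: ler_pM => //.
      + exact: ltW.
      + exact: rho_le1.
      + exact: near_lam.
    have := ler_distD (mu (r t 0) (s t 0)) (mu (r t z) (s t z)) (rh * la).
    lra.
  have := ler_distD (r (t + h2) 0) (r (t + h) x) (phi (s t z)).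
  have : `|r (t + h2) 0 - phi (s t z)| <= `|s (t + h2) 0 - s t z|.
    by rewrite (cs_left w tau1 tau2); exact: phi_lip.
  lra.
- rewrite -(cs_sc w x0 tbh thb) -/x /steps -/x; set ma := mu (r t x) (s t x).
  have ma0 : 0 < ma by exact: mu_gt0.
  have mah := muk (r t x) (s t x); rewrite -/ma in mah.
  have mah0 := muk0 (r t x) (s t x); rewrite -/ma in mah0.
  pose y := x + ma * h; rewrite -/y.
  have xy : `|y - x| <= Lam * h by rewrite /y addrAC subrr add0r ger0_norm// ltW.
  have [y0|y0] := leP y l.
    have yl : 0 <= y by rewrite /y addr_ge0// ltW.
    rewrite (extR_le _ _ _ y0); apply: fin.
    have yx : x = y - ma * h by rewrite /y; ring.
    rewrite {1}yx.
    apply: le_trans (cs_chars w tat h0' thb (mun _ _) yl y0 _ _) _; rewrite -/ma -?yx//.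
    apply: err => //.
    have := near_mu y x xy; lra.
  pose h1 := (l - x) / ma; pose h2 := h - h1.
  have h10 : 0 <= h1 by rewrite divr_ge0 ?subr_ge0// ltW.
  have h1h : h1 < h by rewrite /h1 ltr_pdivrMr// ltrBlDl [h * _]mulrC; exact: y0.
  have h20 : 0 < h2 by rewrite subr_gt0.
  have h2h : h2 <= h by rewrite /h2 gerBl.
  have tau1 : ta <= t + h2 by apply: le_trans tat _; rewrite lerDl ltW.
  have tau2 : t + h2 <= tb by apply: le_trans thb; rewrite lerD2l.
  have x_ma : l - ma * h1 = x by rewrite /h1; field; rewrite gt_eqF.
  have th : t + h2 + h1 = t + h by rewrite /h2; ring.
  have x_small : `|l - x| <= Lam * h.
    by rewrite ger0_norm ?subr_ge0//; rewrite /y in y0; lra.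
  rewrite (extR_ge _ right (ltW y0)); set ml := mu (r t l) (s t l).
  have ml0 : 0 < ml by exact: mu_gt0.
  have c1 : `|s (t + h) x - s (t + h2) l| <= C * (1 + Lt + 2 * (L * Lam)) * h * h.
    rewrite -{1}th -{1}x_ma.
    have b1 : 0 <= l - ma * h1 by rewrite x_ma.
    have b2 : l - ma * h1 <= l by rewrite x_ma.
    apply: le_trans (cs_chars w tau1 h10 _ (mun _ _) (ltW l0) (lexx l) b1 b2) _; first by rewrite th.
    apply: err => //; try exact: ltW.
    have dd : `|mu (r (t + h2) l) (s (t + h2) l) - ml| <= Lt * h.
      have tt : Lt * `|t + h2 - t| <= Lt * h.
        by apply: ler_wpM2l => //; rewrite addrAC subrr add0r gtr0_norm.
      apply: mu_lip.
        exact: le_trans (cs_rt w _ tau1 tau2 tat tb0) tt.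
      exact: le_trans (cs_st w _ tau1 tau2 tat tb0) tt.
    have := near_mu l x x_small; rewrite -/ma -/ml.
    have := ler_distD ml (mu (r (t + h2) l) (s (t + h2) l)) ma.
    lra.
  have c2 : `|s (t + h2) l - S (t + (y - l) / ml)| <= E * h * h.
    rewrite (cs_right w tau1 tau2); apply: le_trans (S_lip _ _) _.
    have yl0 : 0 <= y - l by rewrite subr_ge0 ltW.
    have -> : t + h2 - (t + (y - l) / ml) = (y - l) * (ml - ma) / (ma * ml).
      by rewrite /h2 /h1 /y; field; rewrite !gt_eqF.
    have n1 : `|(y - l) * (ml - ma) / (ma * ml)| <= (Lam * h) * (L * Lam * h) / (a * a).
      rewrite !normrM normfV normrM (gtr0_norm ma0) (gtr0_norm ml0).
      apply: ler_pM; [exact: mulr_ge0| |apply: ler_pM => //|].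
      + by rewrite invr_ge0 ltW// mulr_gt0.
      + by rewrite ger0_norm// /y; lra.
      + exact: near_mu.
      rewrite lef_pV2 ?posrE ?mulr_gt0//.
      by apply: ler_pM; rewrite ?mu_lo// ltW.
    have : sg * `|(y - l) * (ml - ma) / (ma * ml)| <= a * L * ((Lam * h) * (L * Lam * h) / (a * a)).
      by apply: ler_pM.
    move=> /le_trans; apply; rewrite le_eqVlt; apply/orP; left; apply/eqP.
    by rewrite /E; field; rewrite gt_eqF.
  have := ler_distD (s (t + h2) l) (s (t + h) x) (S (t + (y - l) / ml)).
  have : 0 <= C * (1 + Lt + 2 * (L * Lam)) * h * h.
    by rewrite !mulr_ge0// !addr_ge0// mulr_ge0.
  lra.
Qed.

End scheme.

(** * Uniqueness of characteristic solutions *)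

Section small.
Context {R : realType}.

Lemma exists_inv_le (K e : R) : 0 < e -> exists2 n : nat, (0 < n)%N & K / n%:R <= e.
Proof.
move=> e0; exists (Num.bound (K / e)).+1 => //.
rewrite ler_pdivrMr// mulrC -ler_pdivrMr//.
have [Ke|Ke] := leP (K / e) 0; first exact: le_trans Ke _.
apply: ltW; apply: lt_le_trans (archi_boundP (ltW Ke)) _.
by rewrite ler_nat.
Qed.

(** Bounds the error after [j] steps, when each step multiplies it by 1 + A h
    and adds B h^2: after a time T it is O(h). *)
Definition majorant (A B h : R) (j : nat) : R := j%:R * (B * h * h) * expR (A * h) ^+ j.

Lemma majorant_ge0 A B h j : 0 <= B -> 0 <= h -> 0 <= majorant A B h j.
Proof. by move=> B0 h0; rewrite !mulr_ge0// exprn_ge0// expR_ge0. Qed.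

Lemma majorantS A B h j : 0 <= A -> 0 <= B -> 0 <= h ->
  majorant A B h j + majorant A B h j * A * h + B * h * h <= majorant A B h j.+1.
Proof.
move=> A0 B0 h0; rewrite /majorant.
set E := expR (A * h); have E1 : 1 + A * h <= E by exact: expR_ge1Dx.
have Ah : 0 <= A * h by rewrite mulr_ge0.
have E1' : 1 <= E by lra.
have BB : 0 <= B * h * h by rewrite !mulr_ge0.
have h1 : j%:R * (B * h * h) * E ^+ j * (1 + A * h) <= j%:R * (B * h * h) * E ^+ j * E.
  by apply: ler_wpM2l => //; rewrite !mulr_ge0// exprn_ge0// (le_trans ler01).
have h2 : B * h * h * 1 <= B * h * h * E ^+ j.+1.
  by apply: ler_wpM2l => //; rewrite exprn_ege1.
rewrite -natr1 exprSr.
rewrite exprSr in h2.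
have -> : (j%:R + 1) * (B * h * h) * (E ^+ j * E)
  = j%:R * (B * h * h) * E ^+ j * E + B * h * h * (E ^+ j * E) by ring.
lra.
Qed.

Lemma majorant_le A B h j T : 0 <= A -> 0 <= B -> 0 <= h -> j%:R * h <= T ->
  majorant A B h j <= T * B * expR (A * T) * h.
Proof.
move=> A0 B0 h0 jT; rewrite /majorant -expRM_natl.
have -> : j%:R * (B * h * h) * expR (j%:R * (A * h))
  = (j%:R * h) * B * expR (A * (j%:R * h)) * h.
  by rewrite (_ : j%:R * (A * h) = A * (j%:R * h)); ring.
apply: ler_wpM2r => //; apply: ler_pM.
- by rewrite !mulr_ge0.
- exact: expR_ge0.
- exact: ler_wpM2r.
- by rewrite ler_expR; apply: ler_wpM2l.
Qed.
End small.

Section uniqueness.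
Context {R : realType}.
Variables (l a Lam sg : R) (lam mu : R -> R -> R) (phi S : R -> R).
Hypothesis W : wave_system l a Lam sg lam mu phi S.

(** Both solutions are within O(h) of the scheme started from their common
    state, for arbitrarily small [h]. *)
Lemma csol_unique ta tb L Lt C m r s r' s' :
  csol l Lam lam mu phi S ta tb L Lt C m r s ->
  csol l Lam lam mu phi S ta tb L Lt C m r' s' ->
  0 <= L -> 0 <= Lt -> 0 <= C -> sg <= a * L ->
  (forall x, r ta x = r' ta x) -> (forall x, s ta x = s' ta x) ->
  forall t x, ta <= t -> t <= tb -> r t x = r' t x /\ s t x = s' t x.
Proof.
move=> w w' L0 Lt0 C0 sgL r0 s0 t x tat ttb.
have Lam0 := Lam_gt0 W; have a0 := ws_a W; have l0 := ws_l W.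
pose A := L + 2 * L * Lam / a.
pose K := 2 * C * (1 + Lt + 2 * (L * Lam)) + L * (L * Lam) * Lam / a.
have LL0 : 0 <= L * Lam by rewrite mulr_ge0// ltW.
have A0 : 0 <= A.
  by rewrite /A addr_ge0// divr_ge0 ?(ltW a0)// -mulrA mulr_ge0.
have K0 : 0 <= K.
  rewrite /K addr_ge0//.
    by rewrite !mulr_ge0// !addr_ge0// mulr_ge0.
  by rewrite divr_ge0 ?(ltW a0)// mulr_ge0 ?(ltW Lam0)// mulr_ge0.
have KK : 0 <= 2 * K by rewrite mulr_ge0.
pose tau := t - ta; have tau0 : 0 <= tau by rewrite subr_ge0.
pose Z := tau * (2 * K) * expR (A * tau).
have grid n : (0 < n)%N -> Lam * (tau / n%:R) <= l ->
  forall x, `|r t x - r' t x| <= Z * (tau / n%:R) /\ `|s t x - s' t x| <= Z * (tau / n%:R).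
  move=> n0 hl; have n0' : 0 < n%:R :> R by rewrite ltr0n.
  set h := tau / n%:R in hl *.
  have h0 : 0 <= h by rewrite divr_ge0// ltW.
  have nh : n%:R * h = tau by rewrite /h mulrC divfK// gt_eqF.
  have claim j : (j <= n)%N -> forall x,
      `|r (ta + j%:R * h) x - r' (ta + j%:R * h) x| <= majorant A (2 * K) h j /\
      `|s (ta + j%:R * h) x - s' (ta + j%:R * h) x| <= majorant A (2 * K) h j.
    elim: j => [|j IH] jn y.
      by rewrite mul0r addr0 r0 s0 !subrr normr0 /majorant !mul0r.
    have {}IH := IH (ltnW jn).
    have jh0 : 0 <= j%:R * h by rewrite mulr_ge0.
    have jh : j.+1%:R * h <= tau.
      by rewrite -nh; apply: ler_wpM2r => //; rewrite ler_nat.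
    have jE : ta + j.+1%:R * h = ta + j%:R * h + h by rewrite -natr1; ring.
    have t1 : ta <= ta + j%:R * h by rewrite lerDl.
    have t2 : ta + j%:R * h + h <= tb by rewrite -jE; rewrite /tau in jh; lra.
    have t3 : ta + j%:R * h <= tb by lra.
    have [hz|hz] := eqVneq h 0.
      have e1 : ta + j.+1%:R * h = ta + j%:R * h by rewrite hz !mulr0.
      have := majorantS j A0 KK h0; have := majorant_ge0 A j KK h0.
      by rewrite e1 hz !mulr0 !addr0 => _ le1; have [h1 h2] := IH y; split;
        apply: le_trans le1; rewrite hz mulr0 addr0 in h1 h2.
    have hp : 0 < h by rewrite lt_neqAle eq_sym hz.
    have m0 := majorant_ge0 A j KK h0.
    have [a1 a2] := csol_step W w Lt0 C0 t1 hp t2 hl sgL y.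
    have [b1 b2] := csol_step W w' Lt0 C0 t1 hp t2 hl sgL y.
    have [c1 c2] := step_stable W (csol_st w t1 t3) (csol_st w' t1 t3) h0 sgL m0
      (fun z => (IH z).1) (fun z => (IH z).2) y.
    rewrite jE -/A -/K in a1 a2 b1 b2 c1 c2 *.
    have mS := majorantS j A0 KK h0.
    split; apply: le_trans mS.
      move: a1 b1 c1; set p := stepr _ _ _ _ _ _ _ y; set p' := stepr _ _ _ _ _ _ _ y.
      rewrite (distrC (r' _ _)).
      have := ler_distD p (r (ta + j%:R * h + h) y) (r' (ta + j%:R * h + h) y).
      have := ler_distD p' p (r' (ta + j%:R * h + h) y).
      rewrite (distrC p' (r' _ _)); clear; lra.
    move: a2 b2 c2; set p := steps _ _ _ _ _ _ _ y; set p' := steps _ _ _ _ _ _ _ y.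
    have := ler_distD p (s (ta + j%:R * h + h) y) (s' (ta + j%:R * h + h) y).
    have := ler_distD p' p (s' (ta + j%:R * h + h) y).
    rewrite (distrC p' (s' _ _)); clear; lra.
  move=> y; have [h1 h2] := claim n (leqnn n) y.
  have tE : ta + n%:R * h = t by rewrite nh /tau; ring.
  rewrite tE in h1 h2.
  have nhle : n%:R * h <= tau by rewrite nh.
  have := majorant_le A0 KK h0 nhle.
  by move=> ml; split; apply: le_trans ml.
have small (d : R) : (forall n, (0 < n)%N -> Lam * (tau / n%:R) <= l -> `|d| <= Z * (tau / n%:R)) -> d = 0.
  move=> H; apply/eqP; rewrite -normr_eq0 eq_le normr_ge0 andbT.
  apply/ler_addgt0Pr => e e0; rewrite add0r.
  have [n1 n10 H1] := exists_inv_le (Lam * tau) l0.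
  have [n2 n20 H2] := exists_inv_le (Z * tau) e0.
  have Z0 : 0 <= Z by rewrite /Z !mulr_ge0// expR_ge0.
  have mono u v : (0 < u)%N -> (0 < v)%N -> tau / (u * v)%N%:R <= tau / u%:R.
    move=> u0 v0; apply: ler_wpM2l => //.
    rewrite lef_pV2 ?posrE ?ltr0n ?muln_gt0 ?u0//.
    by rewrite ler_nat leq_pmulr.
  apply: le_trans (H (n1 * n2)%N _ _) _.
  - by rewrite muln_gt0 n10.
  - apply: le_trans H1; rewrite -mulrA; apply: ler_wpM2l; [exact: ltW|exact: mono].
  - apply: le_trans H2; rewrite -mulrA; apply: ler_wpM2l => //; rewrite mulnC; exact: mono.
by split; apply/eqP; rewrite -subr_eq0; apply/eqP; apply: small => n n0 hl;
  have [h1 h2] := grid n n0 hl x.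
Qed.
End uniqueness.

(** * Existence of characteristic solutions *)

Section dyadic.
Context {R : realType}.
Implicit Types (A H M : R) (k : nat).

Definition dyadic H k : R := H / 2 ^+ k.

Lemma dyadic_gt0 H k : 0 < H -> 0 < dyadic H k.
Proof. by move=> H0; rewrite divr_gt0// exprn_gt0. Qed.

Lemma dyadicS H k : dyadic H k = 2 * dyadic H k.+1.
Proof. by rewrite /dyadic exprS; field; rewrite expf_neq0. Qed.

Lemma dyadic_small A H e : 0 < e -> exists k, A * dyadic H k <= e.
Proof.
move=> e0; have [n n0 Hn] := exists_inv_le (`|A * H|) e0; exists n.
apply: le_trans Hn; rewrite /dyadic mulrA.
apply: le_trans (_ : `|A * H| / 2 ^+ n <= _).
  by apply: ler_wpM2r; [rewrite invr_ge0 exprn_ge0|exact: ler_norm].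
apply: ler_wpM2l => //.
by rewrite lef_pV2 ?posrE ?ltr0n ?exprn_gt0// -natrX ler_nat ltnW// ltn_expl.
Qed.

Lemma dyadic_le A H (x y : R) : 0 < H -> (forall k, x <= y + A * dyadic H k) -> x <= y.
Proof.
move=> H0 xy; apply/ler_addgt0Pr => e e0.
have [k hk] := dyadic_small A H e0.
by apply: le_trans (xy k) _; rewrite lerD2l.
Qed.

Lemma dyadic_eq A H (x y : R) : 0 < H -> (forall k, `|x - y| <= A * dyadic H k) -> x = y.
Proof.
move=> H0 xy; apply/eqP; rewrite -subr_eq0 -normr_eq0 eq_le normr_ge0 andbT.
by apply: (@dyadic_le A H) => // k; rewrite add0r.
Qed.

(** Increments halved at each step leave a tail of twice the first one. *)
Lemma dyadic_limit (u : nat -> R) M H : 0 < H -> 0 <= M ->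
  (forall k, `|u k - u k.+1| <= M * dyadic H k) ->
  exists x, forall k, `|u k - x| <= 2 * M * dyadic H k.
Proof.
move=> H0 M0 hu.
pose v k := u k - 2 * M * dyadic H k; pose w k := u k + 2 * M * dyadic H k.
have stepv k : v k <= v k.+1 /\ w k.+1 <= w k.
  have := hu k; rewrite ler_distlC => /andP[].
  have e : M * dyadic H k = 2 * M * dyadic H k.+1 by rewrite dyadicS; ring.
  have e2 : 2 * M * dyadic H k = M * dyadic H k + 2 * M * dyadic H k.+1 by rewrite -e; ring.
  by rewrite /v /w e2; move: e; generalize (M * dyadic H k) => X; split; lra.
have mv i j : v i <= v (i + j)%N.
  by elim: j => [|j IH]; [rewrite addn0|rewrite addnS (le_trans IH)// (stepv _).1].
have mw i j : w (i + j)%N <= w i.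
  by elim: j => [|j IH]; [rewrite addn0|rewrite addnS (le_trans (stepv _).2)].
have vw i j : v i <= w j.
  apply: le_trans (mv i j) _; apply: le_trans (mw j i); rewrite addnC.
  have : 0 <= 2 * M * dyadic H (j + i)%N by rewrite !mulr_ge0// ltW// dyadic_gt0.
  by rewrite /v /w; lra.
exists (sup (range v)) => k; rewrite ler_distlC; apply/andP; split.
  apply: sup_upper_bound; last by exists k.
  by split; [exists (v 0%N), 0%N|exists (w 0%N) => _ [i _ <-]].
by apply: ge_sup; [exists (v 0%N), 0%N|move=> _ [i _ <-]; exact: vw].
Qed.
End dyadic.

(** The scheme is run from data of slope [L0]. By the Riccati bound its slopes
    stay below 2 L0 for a time 1 / (4 L0), and the hypothesis [small] says that
    this is enough for the waves to leave the interval: [S] vanishes from [t1]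
    on, and each of the two crossings takes at most l / a. Afterwards the state
    is 0, and the solution is global. *)
Section existence.
Context {R : realType}.
Variables (l a Lam sg : R) (lam mu : R -> R -> R) (phi S : R -> R).
Hypothesis W : wave_system l a Lam sg lam mu phi S.
Variables (L0 m H0 t1 : R) (r0 s0 : R -> R).
Hypothesis st0 : st l phi S 0 L0 m r0 s0.
Hypothesis Sm : forall t, `|S t| <= m.
Hypothesis S0 : forall t, t1 <= t -> S t = 0.
Hypothesis t10 : 0 <= t1.
Hypothesis H00 : 0 < H0.
Hypothesis LamH : Lam * (2 * H0) <= l.
Hypothesis small : 4 * L0 * (t1 + 2 * l / a + 2 * H0) <= 1.
Hypothesis sgL0 : sg <= a * L0.

Local Notation stepr := (stepr l lam mu phi).
Local Notation steps := (steps l mu S).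
Local Notation st := (st l phi S).

Let l0 : 0 < l := ws_l W.
Let a0 : 0 < a := ws_a W.
Let Lam0 : 0 < Lam := Lam_gt0 W.
Let L00 : 0 <= L0 := klip_ge0 (st_rl st0).

Fixpoint sol (h : R) (n : nat) : (R -> R) * (R -> R) :=
  if n is j.+1 then
    (stepr h (sol h j).1 (sol h j).2, steps h (j%:R * h) (sol h j).1 (sol h j).2)
  else (r0, s0).

Definition solr h n := (sol h n).1.
Definition sols h n := (sol h n).2.

Lemma st_mono t L L' r s : st t L m r s -> L <= L' -> st t L' m r s.
Proof.
move=> [h1 h2 h3 h4 h5 h6 h7 h8] LL; split=> //.
- by move=> x y; apply: le_trans (h3 x y) _; apply: ler_wpM2r.
- by move=> x y; apply: le_trans (h4 x y) _; apply: ler_wpM2r.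
Qed.

Lemma sol_clamp h n x : solr h n (clamp l x) = solr h n x /\ sols h n (clamp l x) = sols h n x.
Proof.
case: n => [|n]; first by split; [exact: st_rc st0 _|exact: st_sc st0 _].
by rewrite /solr /sols /= /stepr /steps clampK// ltW.
Qed.

(** The zero state enters at [l] after [t1] and travels at speed at least
    [a]. *)
Lemma sols_extinct h n : 0 < h -> forall x, 0 <= x -> x <= l ->
  t1 + h + (l - x) / a <= n%:R * h -> sols h n x = 0.
Proof.
move=> h0; elim: n => [|n IH] x x0 xl.
  have : 0 <= (l - x) / a by rewrite divr_ge0 ?subr_ge0// ltW.
  by have := t10; rewrite mul0r => *; exfalso; lra.
move=> nh; rewrite /sols /= /steps clamp_id//.
set y := x + _; have mlo := ws_mu_lo W (solr h n x) (sols h n x).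
have nh' : t1 + (l - x) / a <= n%:R * h by have nE : n.+1%:R * h = n%:R * h + h; [rewrite -natr1; ring|rewrite nE in nh; lra].
have ly : 0 <= (l - x) / a by rewrite divr_ge0 ?subr_ge0// ltW.
have [yl|yl] := leP y l.
  rewrite extR_le//; apply: IH => //.
    rewrite /y addr_ge0// mulr_ge0 ?(ltW h0)//; exact: ltW (mu_gt0 W _ _).
  have : (l - y) / a <= (l - x) / a - h.
    rewrite ler_pdivrMr// mulrBl divfK ?gt_eqF// /y.
    have : a * h <= mu (solr h n x) (sols h n x) * h by apply: ler_wpM2r => //; exact: ltW.
    rewrite /solr /sols; lra.
  lra.
rewrite /extR leNgt yl/=; apply: S0.
have : 0 <= (y - l) / mu ((sol h n).1 l) ((sol h n).2 l).
  by rewrite divr_ge0 ?subr_ge0 ?(ltW yl)//; exact: ltW (mu_gt0 W _ _).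
lra.
Qed.

(** Once [s] is extinct, 0 = phi 0 enters at the other end. *)
Lemma solr_extinct h n : 0 < h -> forall x, 0 <= x -> x <= l ->
  t1 + 2 * h + l / a + x / a <= n%:R * h -> solr h n x = 0.
Proof.
move=> h0; have la : 0 <= l / a by rewrite divr_ge0 ?ltW.
elim: n => [|n IH] x x0 xl.
  have : 0 <= x / a by rewrite divr_ge0// ltW.
  by have := t10; rewrite mul0r => *; exfalso; lra.
move=> nh; rewrite /solr /= /stepr clamp_id//.
set y := x - _; have mlo := lam_lo W (solr h n x) (sols h n x).
have nh' : t1 + h + l / a + x / a <= n%:R * h by have nE : n.+1%:R * h = n%:R * h + h; [rewrite -natr1; ring|rewrite nE in nh; lra].
have xa : 0 <= x / a by rewrite divr_ge0// ltW.
have [y0|y0] := leP 0 y.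
  rewrite extL_ge0//; apply: IH => //.
    have := lam_gt0 W (solr h n x) (sols h n x) => lp.
    have : 0 <= lam (solr h n x) (sols h n x) * h by rewrite mulr_ge0 ?ltW.
    rewrite /y /solr /sols; lra.
  have : y / a <= x / a - h.
    rewrite ler_pdivrMr// mulrBl divfK ?gt_eqF// /y.
    have : a * h <= lam (solr h n x) (sols h n x) * h by apply: ler_wpM2r => //; exact: ltW.
    rewrite /solr /sols; lra.
  lra.
rewrite /extL leNgt y0/= -/(sols h n) -(sol_clamp h n _).2.
rewrite sols_extinct ?(ws_phi0 W)//; [exact: clamp_ge0|exact: clamp_le (ltW l0)|].
set z := clamp l _; have z0 : 0 <= z by exact: clamp_ge0.
have : (l - z) / a <= l / a by rewrite ler_pM2r ?invr_gt0//; lra.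
lra.
Qed.

Lemma st_zero t : t1 <= t -> st t (2 * L0) m (fun=> 0) (fun=> 0).
Proof.
move=> tt; have m0 : 0 <= m := le_trans (normr_ge0 _) (Sm 0).
split=> //; try (by move=> x; rewrite normr0).
- by move=> x y; rewrite subrr normr0 !mulr_ge0.
- by move=> x y; rewrite subrr normr0 !mulr_ge0.
- by rewrite (ws_phi0 W).
- by rewrite S0.
Qed.

(** Slopes are bounded by induction until extinction, and vanish after it. *)
Lemma sol_st h n : 0 < h -> h <= H0 -> st (n%:R * h) (2 * L0) m (solr h n) (sols h n).
Proof.
move=> h0 hH.
have la : 0 <= l / a by rewrite divr_ge0 ?ltW.
have la2 : 2 * l / a = l / a + l / a by ring.
have [big|nh] := leP (t1 + 2 * h + l / a + l / a) (n%:R * h).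
  have Z : solr h n = (fun=> 0) /\ sols h n = (fun=> 0).
    split; apply/funext => x.
      rewrite -(sol_clamp h n x).1; apply: solr_extinct => //; [exact: clamp_ge0|exact: clamp_le (ltW l0)|].
      have : clamp l x / a <= l / a by rewrite ler_pM2r ?invr_gt0// clamp_le// ltW.
      lra.
    rewrite -(sol_clamp h n x).2; apply: sols_extinct => //; [exact: clamp_ge0|exact: clamp_le (ltW l0)|].
    have : (l - clamp l x) / a <= l / a by rewrite ler_pM2r ?invr_gt0//; have := clamp_ge0 l x; lra.
    lra.
  by rewrite Z.1 Z.2; apply: st_zero; lra.
have nT : n%:R * h <= t1 + 2 * l / a + 2 * H0 by rewrite la2; lra.
have LT : 4 * L0 * (n%:R * h) <= 1.
  apply: le_trans small; apply: ler_wpM2l => //; exact: mulr_ge0.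
have grow j : (j <= n)%N -> st (j%:R * h) (L0 + 4 * L0 * (j%:R * h) * L0) m (solr h j) (sols h j).
  elim: j => [|j IH] jn; first by rewrite mul0r mulr0 mul0r addr0.
  have {}IH := IH (ltnW jn).
  have jh : 4 * L0 * (j.+1%:R * h) <= 1.
    apply: le_trans LT; apply: ler_wpM2l; first exact: mulr_ge0.
    by apply: ler_wpM2r; [exact: ltW|rewrite ler_nat].
  have jh0 : 0 <= 4 * L0 * (j%:R * h) by rewrite !mulr_ge0// ltW.
  have jE : j.+1%:R * h = j%:R * h + h by rewrite -natr1; ring.
  set Lj := L0 + _ in IH.
  have Lj0 : L0 <= Lj by rewrite /Lj lerDl mulr_ge0.
  have Lj2 : Lj <= 2 * L0.
    rewrite /Lj; have : 4 * L0 * (j%:R * h) * L0 <= 1 * L0.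
      apply: ler_wpM2r => //; apply: le_trans jh; rewrite jE mulrDr lerDl.
      by rewrite !mulr_ge0// ltW.
    lra.
  have hl : Lam * h <= l.
    apply: le_trans LamH; apply: ler_wpM2l; first exact: ltW.
    lra.
  have sgj : sg <= a * Lj by apply: le_trans sgL0 _; apply: ler_wpM2l => //; exact: ltW.
  have := step_st W IH (ltW h0) hl sgj Sm.
  rewrite jE; move=> /st_mono; apply.
  have LL : Lj * Lj <= (2 * L0) * (2 * L0) by apply: ler_pM => //; exact: le_trans Lj0.
  have LLh := ler_wpM2r (ltW h0) LL.
  have -> : Lj * (1 + h * Lj) = Lj + Lj * Lj * h by ring.
  have LjE : Lj = L0 + 4 * L0 * (j%:R * h) * L0 by [].
  move: LLh LjE; generalize Lj => X LLh LjE; lra.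
apply: st_mono (grow n (leqnn n)) _.
have : 4 * L0 * (n%:R * h) * L0 <= 1 * L0 by apply: ler_wpM2r.
lra.
Qed.


Let L := 2 * L0.
Let Lge0 : 0 <= L. Proof. exact: mulr_ge0. Qed.
Let sgL : sg <= a * L.
Proof. by apply: le_trans sgL0 _; apply: ler_wpM2l; [exact: ltW|rewrite /L ler_peMl// ler1n]. Qed.

Lemma sol_time h n j x : 0 < h -> h <= H0 ->
  `|solr h (n + j) x - solr h n x| <= L * Lam * (j%:R * h) /\
  `|sols h (n + j) x - sols h n x| <= L * Lam * (j%:R * h).
Proof.
move=> h0 hH; elim: j => [|j [IH1 IH2]].
  by rewrite addn0 !subrr normr0 mul0r mulr0.
have [h1 h2] := step_near W (sol_st (n + j) h0 hH) (ltW h0) sgL x.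
rewrite addnS -natr1 mulrDl mul1r mulrDr.
split.
  apply: le_trans (ler_distD (solr h (n + j) x) _ _) _; rewrite addrC; exact: lerD.
apply: le_trans (ler_distD (sols h (n + j) x) _ _) _; rewrite addrC; exact: lerD.
Qed.

(** The characteristic property for the scheme, at times that are multiples of
    [h], with constants independent of [h]. *)
Lemma sol_char h n j x k : 0 < h -> h <= H0 -> `|k| <= Lam ->
  0 <= x -> x <= l ->
  (0 <= x + k * (j%:R * h) -> x + k * (j%:R * h) <= l ->
   `|solr h (n + j) (x + k * (j%:R * h)) - solr h n x| <=
     L * (2 * (L * Lam) * (j%:R * h) + `|lam (solr h n x) (sols h n x) - k|) * (j%:R * h)) /\
  (0 <= x - k * (j%:R * h) -> x - k * (j%:R * h) <= l ->
   `|sols h (n + j) (x - k * (j%:R * h)) - sols h n x| <=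
     L * (2 * (L * Lam) * (j%:R * h) + `|mu (solr h n x) (sols h n x) - k|) * (j%:R * h)).
Proof.
move=> h0 hH kL x0 xl; have h0' := ltW h0.
have LL0 : 0 <= L * Lam by rewrite mulr_ge0// ltW.
elim: j => [|j [IH1 IH2]].
  by rewrite addn0 !mul0r !mulr0 addr0 subr0 !subrr normr0.
have jh0 : 0 <= j%:R * h by rewrite mulr_ge0.
have jE : j.+1%:R * h = j%:R * h + h by rewrite -natr1; ring.
have between c : 0 <= x + c * (j.+1%:R * h) -> x + c * (j.+1%:R * h) <= l ->
    0 <= x + c * (j%:R * h) /\ x + c * (j%:R * h) <= l.
  rewrite jE => b1 b2; have [c0|c0] := leP 0 c.
    have : 0 <= c * (j%:R * h) by rewrite mulr_ge0.
    have : 0 <= c * h by rewrite mulr_ge0.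
    by move=> *; split; lra.
  have : c * (j%:R * h) <= 0 by rewrite mulr_le0_ge0// ltW.
  have : c * h <= 0 by rewrite mulr_le0_ge0// ltW.
  by move=> *; split; lra.
have w := sol_st (n + j) h0 hH.
have [_ _ rl sl left right _ _] := w.
have kh : `|k * (j.+1%:R * h)| <= Lam * (j.+1%:R * h).
  rewrite normrM (ger0_norm (_ : 0 <= j.+1%:R * h)) ?mulr_ge0//.
  by apply: ler_wpM2r => //; rewrite mulr_ge0.
have space u y : klip L u -> `|y - x| <= Lam * (j.+1%:R * h) ->
    `|u y - u x| <= L * Lam * (j.+1%:R * h).
  by move=> ul hy; apply: le_trans (ul _ _) _; rewrite -mulrA; exact: ler_wpM2l.
have [T1 T2] := sol_time n j x h0 hH.
have Tj : L * Lam * (j%:R * h) <= L * Lam * (j.+1%:R * h).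
  by apply: ler_wpM2l => //; rewrite jE lerDl.
have far u y v : klip L u -> `|y - x| <= Lam * (j.+1%:R * h) ->
    `|u x - v| <= L * Lam * (j%:R * h) -> `|u y - v| <= 2 * (L * Lam) * (j.+1%:R * h).
  move=> ul hy uv; apply: le_trans (ler_distD (u x) _ _) _.
  have -> : 2 * (L * Lam) * (j.+1%:R * h) = L * Lam * (j.+1%:R * h) + L * Lam * (j.+1%:R * h) by ring.
  by apply: lerD; [exact: space|exact: le_trans uv Tj].
have final e d : `|e| <= L * (2 * (L * Lam) * (j%:R * h) + d) * (j%:R * h) ->
    0 <= d -> forall f, `|f| <= L * ((2 * (L * Lam) * (j.+1%:R * h) + d) * h) ->
    `|f + e| <= L * (2 * (L * Lam) * (j.+1%:R * h) + d) * (j.+1%:R * h).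
  move=> he d0 f hf; apply: le_trans (ler_normD _ _) _.
  have : L * (2 * (L * Lam) * (j%:R * h) + d) * (j%:R * h)
     <= L * (2 * (L * Lam) * (j.+1%:R * h) + d) * (j%:R * h).
    apply: ler_wpM2r => //; apply: ler_wpM2l => //.
    rewrite lerD2r; apply: ler_wpM2l; first by rewrite mulr_ge0.
    by rewrite jE lerDl.
  have -> : L * (2 * (L * Lam) * (j.+1%:R * h) + d) * (j.+1%:R * h) =
    L * (2 * (L * Lam) * (j.+1%:R * h) + d) * (j%:R * h)
    + L * ((2 * (L * Lam) * (j.+1%:R * h) + d) * h).
    by rewrite {2}jE; ring.
  by move=> mo; rewrite addrC; apply: lerD => //; exact: le_trans he mo.
split=> b1 b2.
- have [c1 c2] := between k b1 b2.
  have {}IH1 := IH1 c1 c2.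
  set y := x + k * (j.+1%:R * h) in b1 b2 *; set yj := x + k * (j%:R * h) in c1 c2 IH1 *.
  have yx : `|y - x| <= Lam * (j.+1%:R * h) by rewrite /y addrAC subrr add0r.
  have -> : solr h (n + j.+1) y - solr h n x =
     (solr h (n + j.+1) y - solr h (n + j) yj) + (solr h (n + j) yj - solr h n x).
    by rewrite addrA subrK.
  apply: final => //.
  rewrite addnS /solr /= /stepr clamp_id// -/(solr h (n + j)) -/(sols h (n + j)).
  rewrite -(extL_ge0 lam mu phi (solr h (n + j)) (sols h (n + j)) c1).
  apply: le_trans (extL_klip W rl sl left _ _) _; apply: ler_wpM2l => //.
  set la := lam _ _.
  have -> : y - la * h - yj = (k - la) * h by rewrite /y /yj jE; ring.
  rewrite normrM (ger0_norm h0'); apply: ler_wpM2r => //.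
  have : `|la - lam (solr h n x) (sols h n x)| <= 2 * (L * Lam) * (j.+1%:R * h).
    by apply: (ws_lam_lip W); [exact: far rl yx T1|exact: far sl yx T2].
  move=> h1; rewrite (distrC k la); apply: le_trans (ler_distD (lam (solr h n x) (sols h n x)) _ _) _.
  exact: lerD.
- have := between (- k); rewrite !mulNr => /(_ b1 b2) [c1 c2].
  have {}IH2 := IH2 c1 c2.
  set y := x - k * (j.+1%:R * h) in b1 b2 *; set yj := x - k * (j%:R * h) in c1 c2 IH2 *.
  have yx : `|y - x| <= Lam * (j.+1%:R * h) by rewrite /y addrAC subrr add0r normrN.
  have -> : sols h (n + j.+1) y - sols h n x =
     (sols h (n + j.+1) y - sols h (n + j) yj) + (sols h (n + j) yj - sols h n x).
    by rewrite addrA subrK.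
  apply: final => //.
  rewrite addnS /sols /= /steps clamp_id// -/(solr h (n + j)) -/(sols h (n + j)).
  rewrite -(extR_le mu S ((n + j)%:R * h) (solr h (n + j)) (sols h (n + j)) c2).
  apply: le_trans (extR_klip W _ sl right sgL _ _) _; apply: ler_wpM2l => //.
  set ma := mu _ _.
  have -> : y + ma * h - yj = (ma - k) * h by rewrite /y /yj jE; ring.
  rewrite normrM (ger0_norm h0'); apply: ler_wpM2r => //.
  have : `|ma - mu (solr h n x) (sols h n x)| <= 2 * (L * Lam) * (j.+1%:R * h).
    by apply: (ws_mu_lip W); [exact: far rl yx T1|exact: far sl yx T2].
  move=> h1; apply: le_trans (ler_distD (mu (solr h n x) (sols h n x)) _ _) _.
  exact: lerD.
Qed.

Let Bc := L * (5 * (Lam / a) ^+ 2 * (L * Lam)).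
Let Ac := L + 2 * L * Lam / a.

Let Bc0 : 0 <= Bc.
Proof.
apply: mulr_ge0; first exact: Lge0.
apply: mulr_ge0; first by rewrite mulr_ge0 ?sqr_ge0.
by apply: mulr_ge0; [exact: Lge0|exact: ltW].
Qed.
Let Ac0 : 0 <= Ac.
Proof.
apply: addr_ge0; first exact: Lge0.
apply: divr_ge0; last exact: ltW.
apply: mulr_ge0; last exact: ltW.
by apply: mulr_ge0; last exact: Lge0.
Qed.

(** Stability and consistency, summed over the steps: the scheme is a Cauchy
    sequence as the step is halved. *)
Lemma sol_half k n x : 0 < k -> 2 * k <= H0 ->
  `|solr (2 * k) n x - solr k (n.*2) x| <= majorant Ac Bc (2 * k) n /\
  `|sols (2 * k) n x - sols k (n.*2) x| <= majorant Ac Bc (2 * k) n.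
Proof.
move=> k0 kH; have hh0 : 0 < 2 * k by rewrite mulr_gt0.
elim: n x => [|n IH] x.
  by rewrite /= !subrr normr0 /majorant !mul0r.
have kH' : k <= H0 by lra.
have w := sol_st n hh0 kH; have w' := sol_st n.*2 k0 kH'.
have tE : (n.*2)%:R * k = n%:R * (2 * k) by rewrite -muln2 natrM; ring.
rewrite tE in w'.
have M0 := majorant_ge0 Ac n Bc0 (ltW hh0).
have [c1 c2] := step_stable W w w' (ltW hh0) sgL M0 (fun z => (IH z).1) (fun z => (IH z).2) x.
have kl : Lam * (2 * k) <= l.
  apply: le_trans LamH; apply: ler_wpM2l; [exact: ltW|lra].
have [d1 d2] := two_half_steps W w' k0 kl sgL x.
rewrite doubleS.
have E1 : solr k (n.*2).+2 = stepr k (stepr k (solr k n.*2) (sols k n.*2))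
    (steps k (n%:R * (2 * k)) (solr k n.*2) (sols k n.*2)).
  by rewrite /solr /= tE.
have E2 : sols k (n.*2).+2 = steps k (n%:R * (2 * k) + k) (stepr k (solr k n.*2) (sols k n.*2))
    (steps k (n%:R * (2 * k)) (solr k n.*2) (sols k n.*2)).
  rewrite /sols /= tE; congr (steps _ _ _ _); rewrite -natr1 mulrDl mul1r; congr (_ + _); exact: tE.
rewrite E1 E2 [solr _ n.+1]/(solr _ _) [sols _ n.+1]/(sols _ _) /=.
have BB : L * (5 * (Lam / a) ^+ 2 * (L * Lam * k) * k) <= Bc * (2 * k) * (2 * k).
  have -> : Bc * (2 * k) * (2 * k) = 4 * (L * (5 * (Lam / a) ^+ 2 * (L * Lam * k) * k)).
    by rewrite /Bc; ring.
  have : 0 <= Bc * k * k by apply: mulr_ge0; [apply: mulr_ge0|]; rewrite // ltW.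
  have -> : Bc * k * k = L * (5 * (Lam / a) ^+ 2 * (L * Lam * k) * k) by rewrite /Bc; ring.
  by move=> X0; rewrite ler_peMl// ler1n.
have mS := majorantS n Ac0 Bc0 (ltW hh0).
split; apply: le_trans mS.
  apply: le_trans (ler_distD (stepr (2 * k) (solr k n.*2) (sols k n.*2) x) _ _) _.
  rewrite [X in _ + X]distrC; apply: lerD => //; exact: le_trans d1 BB.
apply: le_trans (ler_distD (steps (2 * k) (n%:R * (2 * k)) (solr k n.*2) (sols k n.*2) x) _ _) _.
rewrite [X in _ + X]distrC; apply: lerD => //; exact: le_trans d2 BB.
Qed.

(* the scheme of step [H k] at time [t], and the distance [M T * H k] to the
   one of half that step, up to time [T] *)
Let H k := dyadic H0 k.
Let nk k t := Num.trunc (t / H k).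
Let Wr k t := solr (H k) (nk k t).
Let Ws k t := sols (H k) (nk k t).
Let M T := T * Bc * expR (Ac * T) + L * Lam.

Let Hp k : 0 < H k. Proof. exact: dyadic_gt0. Qed.
Let Hle k : H k <= H0.
Proof. by rewrite /H /dyadic ler_pdivrMr ?exprn_gt0// ler_peMr ?(ltW H00)// exprn_ege1// ler1n. Qed.
Let LL0 : 0 <= L * Lam. Proof. by apply: mulr_ge0; [exact: Lge0|exact: ltW]. Qed.

Let nk_itv k t : 0 <= t -> (nk k t)%:R * H k <= t /\ t <= (nk k t)%:R * H k + H k.
Proof.
move=> t0; have := truncn_itv (divr_ge0 t0 (ltW (Hp k))) => /andP[].
rewrite -/(nk k t) ler_pdivlMr// ltr_pdivrMr// -natr1 mulrDl mul1r => h1 h2.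
by split=> //; exact: ltW.
Qed.

Let nk_ge k t n : 0 <= t -> n%:R * H k <= t -> (n <= nk k t)%N.
Proof.
move=> t0 nt; have tH := divr_ge0 t0 (ltW (Hp k)).
by rewrite /nk (truncn_ge_nat n tH) ler_pdivlMr.
Qed.

Let M_ge0 T : 0 <= T -> 0 <= M T.
Proof.
move=> T0; rewrite /M; apply: addr_ge0 => //; apply: mulr_ge0; last exact: expR_ge0.
by apply: mulr_ge0.
Qed.

Let M_mono T T' : 0 <= T -> T <= T' -> M T <= M T'.
Proof.
move=> T0 TT; rewrite /M lerD2r; apply: ler_pM; [exact: mulr_ge0|exact: expR_ge0| |].
  by apply: ler_wpM2r.
by rewrite ler_expR; apply: ler_wpM2l.
Qed.

Let W_cauchy k t x : 0 <= t ->
  `|Wr k t x - Wr k.+1 t x| <= M t * H k /\ `|Ws k t x - Ws k.+1 t x| <= M t * H k.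
Proof.
move=> t0; have hE : H k = 2 * H k.+1 := dyadicS H0 k.
have [n1 n2] := nk_itv k t0; have [n3 n4] := nk_itv k.+1 t0.
have le2 : ((nk k t).*2 <= nk k.+1 t)%N.
  by apply: nk_ge => //; rewrite -muln2 natrM -mulrA -hE.
have [j jE] : exists j, nk k.+1 t = ((nk k t).*2 + j)%N.
  by exists (nk k.+1 t - (nk k t).*2)%N; rewrite subnKC.
have jH : j%:R * H k.+1 <= H k.
  have : (nk k.+1 t)%:R * H k.+1 = (nk k t)%:R * H k + j%:R * H k.+1.
    by rewrite jE natrD -muln2 natrM mulrDl -mulrA -hE.
  by move: n2 n3; generalize ((nk k t)%:R * H k) ((nk k.+1 t)%:R * H k.+1) (j%:R * H k.+1) (H k) => A B D G; lra.
have hH : 2 * H k.+1 <= H0 by rewrite -hE.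
have [c1 c2] := sol_half (nk k t) x (Hp k.+1) hH.
have [d1 d2] := sol_time (nk k t).*2 j x (Hp k.+1) (Hle k.+1).
rewrite -jE in d1 d2; rewrite -hE in c1 c2.
have mle := majorant_le Ac0 Bc0 (ltW (Hp k)) n1.
have jH' : L * Lam * (j%:R * H k.+1) <= L * Lam * H k by apply: ler_wpM2l.
rewrite /M mulrDl; split.
  apply: le_trans (ler_distD (solr (H k.+1) (nk k t).*2 x) _ _) _; apply: lerD.
    exact: le_trans c1 mle.
  by rewrite distrC; exact: le_trans d1 jH'.
apply: le_trans (ler_distD (sols (H k.+1) (nk k t).*2 x) _ _) _; apply: lerD.
  exact: le_trans c2 mle.
by rewrite distrC; exact: le_trans d2 jH'.
Qed.

Let W_time k t t' x : 0 <= t -> t <= t' ->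
  `|Wr k t' x - Wr k t x| <= L * Lam * (t' - t + H k) /\
  `|Ws k t' x - Ws k t x| <= L * Lam * (t' - t + H k).
Proof.
move=> t0 tt; have t'0 := le_trans t0 tt.
have [n1 n2] := nk_itv k t0; have [n3 n4] := nk_itv k t'0.
have le2 : (nk k t <= nk k t')%N by apply: nk_ge => //; exact: le_trans tt.
have [j jE] : exists j, nk k t' = (nk k t + j)%N.
  by exists (nk k t' - nk k t)%N; rewrite subnKC.
have jH : j%:R * H k <= t' - t + H k.
  have : (nk k t')%:R * H k = (nk k t)%:R * H k + j%:R * H k.
    by rewrite jE natrD mulrDl.
  by move: n2 n3; generalize ((nk k t)%:R * H k) ((nk k t')%:R * H k) (j%:R * H k) (H k) => A B D G; lra.
have [d1 d2] := sol_time (nk k t) j x (Hp k) (Hle k).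
rewrite -jE in d1 d2.
by split; [apply: le_trans d1 _|apply: le_trans d2 _]; apply: ler_wpM2l.
Qed.

Let W_st k t : st ((nk k t)%:R * H k) L m (Wr k t) (Ws k t).
Proof. exact: sol_st. Qed.

Let W_zero k t x : t1 + 2 * l / a + 3 * H k <= t -> 0 <= x -> x <= l ->
  Wr k t x = 0 /\ Ws k t x = 0.
Proof.
move=> tt x0 xl.
have la : 0 <= l / a by rewrite divr_ge0 ?ltW.
have la2 : 2 * l / a = l / a + l / a by ring.
have H_ := ltW (Hp k).
have t0 : 0 <= t.
  apply: le_trans tt; apply: addr_ge0; last by rewrite mulr_ge0.
  by apply: addr_ge0 => //; rewrite la2; exact: addr_ge0.
have [n1 n2] := nk_itv k t0.
have xa : x / a <= l / a by rewrite ler_pM2r ?invr_gt0.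
have lxa : (l - x) / a <= l / a by rewrite ler_pM2r ?invr_gt0// gerBl.
have nn : t1 + 2 * H k + 2 * l / a <= (nk k t)%:R * H k.
  by move: tt n2; generalize ((nk k t)%:R * H k) (2 * l / a) (H k) => A B D; lra.
split.
  apply: solr_extinct => //; apply: le_trans nn; rewrite la2 -!addrA lerD2l lerD2l.
  by rewrite lerD2l.
apply: sols_extinct => //; apply: le_trans nn; rewrite la2.
move: lxa la H_; generalize (H k) ((l - x) / a) (l / a) => A B D; lra.
Qed.

Let W_char k t d x c : 0 <= t -> 0 <= d -> `|c| <= Lam -> 0 <= x -> x <= l ->
  (0 <= x + c * d -> x + c * d <= l ->
   `|Wr k (t + d) (x + c * d) - Wr k t x| <=
     L * (2 * (L * Lam) * d + `|lam (Wr k t x) (Ws k t x) - c|) * d + 3 * (L * Lam) * H k) /\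
  (0 <= x - c * d -> x - c * d <= l ->
   `|Ws k (t + d) (x - c * d) - Ws k t x| <=
     L * (2 * (L * Lam) * d + `|mu (Wr k t x) (Ws k t x) - c|) * d + 3 * (L * Lam) * H k).
Proof.
move=> t0 d0 cL x0 xl.
have H_ := ltW (Hp k).
have td0 : 0 <= t + d by exact: addr_ge0.
have [n1 n2] := nk_itv k t0; have [n3 n4] := nk_itv k td0.
have [j1 j2] := nk_itv k d0.
pose j := nk k d; rewrite -/j in j1 j2.
have le2 : (nk k t + j <= nk k (t + d))%N by apply: nk_ge => //; rewrite natrD mulrDl; exact: lerD.
have [i iE] : exists i, nk k (t + d) = (nk k t + j + i)%N.
  by exists (nk k (t + d) - (nk k t + j))%N; rewrite subnKC.
have iH : i%:R * H k <= 2 * H k.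
  have : (nk k (t + d))%:R * H k = (nk k t)%:R * H k + j%:R * H k + i%:R * H k.
    by rewrite iE !natrD !mulrDl.
  move: n2 n3 j2; generalize ((nk k t)%:R * H k) ((nk k (t + d))%:R * H k) (j%:R * H k) (i%:R * H k) (H k).
  by move=> A B D G F; lra.
have jH0 : 0 <= j%:R * H k by apply: mulr_ge0.
have iH' : L * Lam * (i%:R * H k) <= 2 * (L * Lam) * H k.
  by rewrite [leRHS]mulrAC [leRHS]mulrC; apply: ler_wpM2l.
have between e : 0 <= x + e * d -> x + e * d <= l ->
    0 <= x + e * (j%:R * H k) /\ x + e * (j%:R * H k) <= l.
  move=> b1 b2; have [e0|e0] := leP 0 e.
    have : 0 <= e * (j%:R * H k) by apply: mulr_ge0.
    have : e * (j%:R * H k) <= e * d by apply: ler_wpM2l.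
    by generalize (e * (j%:R * H k)) (e * d) b2 => A B ? *; split; lra.
  have : e * (j%:R * H k) <= 0 by rewrite mulr_le0_ge0// ltW.
  have : e * d <= e * (j%:R * H k) by apply: ler_wnM2l => //; exact: ltW.
  by generalize (e * (j%:R * H k)) (e * d) b1 => A B ? *; split; lra.
have space u y z : klip L u -> `|y - z| <= Lam * H k -> `|u y - u z| <= L * Lam * H k.
  by move=> ul hy; apply: le_trans (ul _ _) _; rewrite -mulrA; exact: ler_wpM2l.
have shift : `|c * (d - j%:R * H k)| <= Lam * H k.
  rewrite normrM; apply: ler_pM => //; rewrite ger0_norm ?subr_ge0//.
  by rewrite lerBlDl.
have w := sol_st (nk k t + j) (Hp k) (Hle k).
have fin e : 0 <= e ->
    L * (2 * (L * Lam) * (j%:R * H k) + e) * (j%:R * H k) <= L * (2 * (L * Lam) * d + e) * d.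
  move=> e0; have q0 : 0 <= 2 * (L * Lam) by apply: mulr_ge0.
  have q1 : 0 <= 2 * (L * Lam) * (j%:R * H k) + e by apply: addr_ge0 => //; exact: mulr_ge0.
  apply: ler_pM => //; first exact: mulr_ge0.
  by apply: ler_wpM2l => //; rewrite lerD2r; apply: ler_wpM2l.
have [C1 C2] := sol_char (nk k t) j (Hp k) (Hle k) cL x0 xl.
split=> b1 b2.
- have [c1 c2] := between c b1 b2; have {}C1 := C1 c1 c2.
  have [T1 _] := sol_time (nk k t + j) i (x + c * d) (Hp k) (Hle k).
  rewrite -iE in T1.
  have sp : `|x + c * d - (x + c * (j%:R * H k))| <= Lam * H k.
    by rewrite opprD addrACA subrr add0r -mulrBr.
  have S1 := space _ _ _ (st_rl w) sp.
  apply: le_trans (ler_distD (solr (H k) (nk k t + j) (x + c * d)) _ _) _.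
  have -> : 3 * (L * Lam) * H k = 2 * (L * Lam) * H k + L * Lam * H k by ring.
  rewrite [leRHS]addrC -[leRHS]addrA; apply: lerD; first exact: le_trans T1 iH'.
  apply: le_trans (ler_distD (solr (H k) (nk k t + j) (x + c * (j%:R * H k))) _ _) _.
  by apply: lerD => //; apply: le_trans C1 _; exact: fin.
- have := between (- c); rewrite !mulNr => /(_ b1 b2) [c1 c2]; have {}C2 := C2 c1 c2.
  have [_ T1] := sol_time (nk k t + j) i (x - c * d) (Hp k) (Hle k).
  rewrite -iE in T1.
  have sp : `|x - c * d - (x - c * (j%:R * H k))| <= Lam * H k.
    by rewrite opprD addrACA subrr add0r -opprD -mulrBr normrN.
  have S1 := space _ _ _ (st_sl w) sp.
  apply: le_trans (ler_distD (sols (H k) (nk k t + j) (x - c * d)) _ _) _.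
  have -> : 3 * (L * Lam) * H k = 2 * (L * Lam) * H k + L * Lam * H k by ring.
  rewrite [leRHS]addrC -[leRHS]addrA; apply: lerD; first exact: le_trans T1 iH'.
  apply: le_trans (ler_distD (sols (H k) (nk k t + j) (x - c * (j%:R * H k))) _ _) _.
  by apply: lerD => //; apply: le_trans C2 _; exact: fin.
Qed.

(** Every property of the scheme passes to the limit with an error O(H k),
    which then vanishes. The constants do not depend on the final time. *)
Lemma csol_exists : exists r s : R -> R -> R,
  [/\ forall x, r 0 x = r0 x /\ s 0 x = s0 x,
      forall T, 0 <= T ->
        csol l Lam lam mu phi S 0 T (2 * L0) (2 * L0 * Lam)
          (2 * L0 * (1 + 2 * (2 * L0 * Lam))) m r s &
      forall t x, t1 + 2 * l / a <= t -> r t x = 0 /\ s t x = 0].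
Proof.
have lim (p : R * R) : exists q : R * R, 0 <= p.1 -> forall k,
    `|Wr k p.1 p.2 - q.1| <= 2 * M p.1 * H k /\ `|Ws k p.1 p.2 - q.2| <= 2 * M p.1 * H k.
  have [p0|p0] := leP 0 p.1; last by exists (0, 0) => //.
  have [x hx] := dyadic_limit H00 (M_ge0 p0) (fun k => (W_cauchy k p.2 p0).1).
  have [y hy] := dyadic_limit H00 (M_ge0 p0) (fun k => (W_cauchy k p.2 p0).2).
  by exists (x, y) => _ k; split; [exact: hx|exact: hy].
have [f hf] := choice lim.
pose r t x := (f (t, x)).1; pose s t x := (f (t, x)).2.
have rs T t x k : 0 <= t -> t <= T ->
    `|Wr k t x - r t x| <= 2 * M T * H k /\ `|Ws k t x - s t x| <= 2 * M T * H k.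
  move=> t0 tT; have [h1 h2] := hf (t, x) t0 k.
  have mm : 2 * M t * H k <= 2 * M T * H k.
    apply: ler_wpM2r; first exact: ltW.
    by apply: ler_wpM2l => //; apply: M_mono.
  by split; [apply: le_trans h1 mm|apply: le_trans h2 mm].
have L2 : 2 * L0 = L by [].
exists r, s; rewrite L2.
have tri (a1 b1 a2 b2 e e' : R) : `|a1 - b1| <= e -> `|a2 - b2| <= e ->
    `|a1 - a2| <= e' -> `|b1 - b2| <= e' + 2 * e.
  move=> h1 h2 h3; apply: le_trans (ler_distD a1 _ _) _.
  have := ler_distD a2 a1 b2; rewrite (distrC b1); lra.
have Tcs T : 0 <= T -> csol l Lam lam mu phi S 0 T L (L * Lam) (L * (1 + 2 * (L * Lam))) m r s; last first.
split => //.
- move=> x.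
  have n0 k : nk k 0 = 0%N by rewrite /nk mul0r truncn0.
  have c k := rs 0 0 x k (lexx 0) (lexx 0).
  split; apply: (@dyadic_eq _ (2 * M 0) H0) => // k; rewrite distrC; have [h1 h2] := c k.
    by move: h1; rewrite /Wr n0.
  by move: h2; rewrite /Ws n0.
- move=> t x tt; have la : 0 <= 2 * l / a by rewrite divr_ge0 ?mulr_ge0// ltW.
  have t0 : 0 <= t by apply: le_trans tt; exact: addr_ge0.
  wlog xl : x / 0 <= x /\ x <= l.
    move=> hw.
    have [] := hw (clamp l x) (conj (clamp_ge0 l x) (clamp_le x (ltW l0))).
    by rewrite (cs_rc (Tcs t t0) x t0 (lexx t)) (cs_sc (Tcs t t0) x t0 (lexx t)).
  suff: forall k, `|r t x| <= (2 * M (t + 3 * H0) + 4 * (L * Lam)) * H k /\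
      `|s t x| <= (2 * M (t + 3 * H0) + 4 * (L * Lam)) * H k.
    move=> hh; split.
      by apply: dyadic_eq H00 _ => k; rewrite subr0; exact: (hh k).1.
    by apply: dyadic_eq H00 _ => k; rewrite subr0; exact: (hh k).2.
  move=> k; have H3 : 0 <= 3 * H k by rewrite mulr_ge0// ltW.
  have tT : t <= t + 3 * H0 by rewrite lerDl mulr_ge0// ltW.
  have t3 : t1 + 2 * l / a + 3 * H k <= t + 3 * H k by rewrite lerD2r.
  have [z1 z2] := W_zero t3 xl.1 xl.2.
  have tt3 : t <= t + 3 * H k by rewrite lerDl.
  have [d1 d2] := W_time k x t0 tt3.
  have [h1 h2] := rs _ t x k t0 tT.
  have E : L * Lam * (t + 3 * H k - t + H k) = 4 * (L * Lam) * H k by ring.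
  rewrite E z1 z2 !sub0r !normrN in d1 d2.
  rewrite mulrDl; split.
    rewrite -[r t x](subKr (Wr k t x)); apply: le_trans (ler_normB _ _) _.
    by rewrite addrC; exact: lerD.
  rewrite -[s t x](subKr (Ws k t x)); apply: le_trans (ler_normB _ _) _.
  by rewrite addrC; exact: lerD.
move=> T0.
  have MT0 := M_ge0 T0.
  (* the frozen speed may be taken at the limit state *)
  have close u v c h k : `|u - v| <= 2 * M T * H k -> 0 <= h ->
      L * (2 * (L * Lam) * h + `|u - c|) * h + 3 * (L * Lam) * H k + 2 * (2 * M T * H k) <=
      L * (1 + 2 * (L * Lam)) * (h + `|v - c|) * h
        + (4 * M T + 3 * (L * Lam) + 2 * (L * M T * h)) * H k.
    move=> uv h0.
    have h1 : `|u - c| <= 2 * M T * H k + `|v - c|.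
      by apply: le_trans (ler_distD v _ _) _; exact: lerD.
    have h2 : L * h * (2 * (L * Lam) * h + `|u - c|)
        <= L * h * (2 * (L * Lam) * h + (2 * M T * H k + `|v - c|)).
      by apply: ler_wpM2l; [exact: mulr_ge0|rewrite lerD2l].
    have h3 : 0 <= L * h * (h + 2 * (L * Lam) * `|v - c|).
      by apply: mulr_ge0; [exact: mulr_ge0|apply: addr_ge0 => //; apply: mulr_ge0 => //; exact: mulr_ge0].
    rewrite -subr_ge0; rewrite -subr_ge0 in h2.
    set X := (X in 0 <= X).
    have -> : X = (L * h * (2 * (L * Lam) * h + (2 * M T * H k + `|v - c|))
      - L * h * (2 * (L * Lam) * h + `|u - c|)) + L * h * (h + 2 * (L * Lam) * `|v - c|).
      by rewrite /X; ring.
    exact: addr_ge0.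
  split.
  + move=> t x t0 tT; apply: (@dyadic_eq _ (4 * M T) H0) => // k.
    have [h1 _] := rs T t x k t0 tT; have [h2 _] := rs T t (clamp l x) k t0 tT.
    have := tri _ _ _ _ _ 0 h2 h1; rewrite /Wr (sol_clamp _ _ _).1 subrr normr0 lexx => /(_ isT).
    by rewrite add0r mulrA [2 * (2 * M T)]mulrA -natrM.
  + move=> t x t0 tT; apply: (@dyadic_eq _ (4 * M T) H0) => // k.
    have [_ h1] := rs T t x k t0 tT; have [_ h2] := rs T t (clamp l x) k t0 tT.
    have := tri _ _ _ _ _ 0 h2 h1; rewrite /Ws (sol_clamp _ _ _).2 subrr normr0 lexx => /(_ isT).
    by rewrite add0r mulrA [2 * (2 * M T)]mulrA -natrM.
  + move=> t t0 tT x y; apply: (@dyadic_le _ (4 * M T) H0) => // k.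
    have [h1 _] := rs T t x k t0 tT; have [h2 _] := rs T t y k t0 tT.
    have := tri _ _ _ _ _ _ h1 h2 (st_rl (W_st k t) x y).
    by rewrite mulrA [2 * (2 * M T)]mulrA -natrM.
  + move=> t t0 tT x y; apply: (@dyadic_le _ (4 * M T) H0) => // k.
    have [_ h1] := rs T t x k t0 tT; have [_ h2] := rs T t y k t0 tT.
    have := tri _ _ _ _ _ _ h1 h2 (st_sl (W_st k t) x y).
    by rewrite mulrA [2 * (2 * M T)]mulrA -natrM.
  + move=> t t' x; wlog tt : t t' / t' <= t => [hw|] t0 tT t'0 t'T.
      by have [/hw|/ltW/hw] := leP t' t; [|rewrite distrC (distrC t)]; apply.
    apply: (@dyadic_le _ (4 * M T + L * Lam) H0) => // k.
    have [h1 _] := rs T t x k t0 tT; have [h2 _] := rs T t' x k t'0 t'T.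
    have := tri _ _ _ _ _ _ h1 h2 (W_time k x t'0 tt).1.
    rewrite [`|t - t'|]ger0_norm ?subr_ge0//; move/le_trans; apply.
    by rewrite le_eqVlt; apply/orP; left; apply/eqP; rewrite -/(H k); ring.
  + move=> t t' x; wlog tt : t t' / t' <= t => [hw|] t0 tT t'0 t'T.
      by have [/hw|/ltW/hw] := leP t' t; [|rewrite distrC (distrC t)]; apply.
    apply: (@dyadic_le _ (4 * M T + L * Lam) H0) => // k.
    have [_ h1] := rs T t x k t0 tT; have [_ h2] := rs T t' x k t'0 t'T.
    have := tri _ _ _ _ _ _ h1 h2 (W_time k x t'0 tt).2.
    rewrite [`|t - t'|]ger0_norm ?subr_ge0//; move/le_trans; apply.
    by rewrite le_eqVlt; apply/orP; left; apply/eqP; rewrite -/(H k); ring.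
  + move=> t x t0 tT; apply: (@dyadic_le _ (2 * M T) H0) => // k.
    have [h1 _] := rs T t x k t0 tT; have h2 := st_rm (W_st k t) x.
    rewrite -[r t x](subKr (Wr k t x)); apply: le_trans (ler_normB _ _) _; exact: lerD.
  + move=> t x t0 tT; apply: (@dyadic_le _ (2 * M T) H0) => // k.
    have [_ h1] := rs T t x k t0 tT; have h2 := st_sm (W_st k t) x.
    rewrite -[s t x](subKr (Ws k t x)); apply: le_trans (ler_normB _ _) _; exact: lerD.
  + move=> t t0 tT; apply: (@dyadic_eq _ (4 * M T) H0) => // k.
    have [h1 h2] := rs T t 0 k t0 tT.
    have h3 := le_trans (ws_phi_lip W _ _) h2.
    have := tri _ _ _ _ _ 0 h1 h3; rewrite (st_left (W_st k t)) subrr normr0 lexx => /(_ isT).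
    by rewrite add0r mulrA [2 * (2 * M T)]mulrA -natrM.
  + move=> t t0 tT; apply: (@dyadic_eq _ (2 * M T + sg) H0) => // k.
    have [_ h2] := rs T t l k t0 tT; rewrite (st_right (W_st k t)) in h2.
    have [n1 n2] := nk_itv k t0.
    have h3 : `|S ((nk k t)%:R * H k) - S t| <= sg * H k.
      apply: le_trans (ws_S_lip W _ _) _; apply: ler_wpM2l; first exact: ws_sg W.
      by rewrite distrC ger0_norm ?subr_ge0// lerBlDl.
    apply: le_trans (ler_distD (S ((nk k t)%:R * H k)) _ _) _.
    by rewrite mulrDl distrC; exact: lerD.
  + move=> t h x c t0 h0 thT cL x0 xl b1 b2.
    have t0' := addr_ge0 t0 h0; have tT : t <= T by apply: le_trans thT; rewrite lerDl.
    apply: (@dyadic_le _ (4 * M T + 3 * (L * Lam) + 2 * (L * M T * h)) H0) => // k; rewrite -/(H k).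
    have [h1 h1'] := rs T t x k t0 tT; have [h2 _] := rs T (t + h) (x + c * h) k t0' thT.
    apply: le_trans (tri _ _ _ _ _ _ h2 h1 ((W_char k t0 h0 cL x0 xl).1 b1 b2)) _.
    exact: close (ws_lam_lip W h1 h1') h0.
  + move=> t h x c t0 h0 thT cL x0 xl b1 b2.
    have t0' := addr_ge0 t0 h0; have tT : t <= T by apply: le_trans thT; rewrite lerDl.
    apply: (@dyadic_le _ (4 * M T + 3 * (L * Lam) + 2 * (L * M T * h)) H0) => // k; rewrite -/(H k).
    have [h1 h1'] := rs T t x k t0 tT; have [_ h2] := rs T (t + h) (x - c * h) k t0' thT.
    apply: le_trans (tri _ _ _ _ _ _ h2 h1' ((W_char k t0 h0 cL x0 xl).2 b1 b2)) _.
    exact: close (ws_mu_lip W h1 h1') h0.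
Qed.

End existence.

(** * The control state *)

Section control.
Context {R : realType}.

(** Powers cut off at negative arguments, so that the formula for the control
    state goes through its extinction time; they are derivable when p > 1. *)
Definition ppow (p y : R) : R := Num.max 0 y `^ p.

Lemma ppow_ge0 p y : 0 <= ppow p y. Proof. exact: powR_ge0. Qed.

Lemma ppow_le0 p y : 0 < p -> y <= 0 -> ppow p y = 0.
Proof. by move=> p0 y0; rewrite /ppow (max_idPl y0) powR0// gt_eqF. Qed.

Lemma ppow_le p x y : 0 <= p -> x <= y -> ppow p x <= ppow p y.
Proof.
move=> p0 xy; apply: ge0_ler_powR => //.
- by rewrite nnegrE le_max lexx.
- by rewrite nnegrE le_max lexx.
- by rewrite ge_max le_max lexx/= le_max xy orbT.
Qed.

(** At 0, where the two formulas meet, the difference quotient is a positive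
    power. *)
Lemma ppow_derive p y : 1 < p -> is_derive y (1:R) (ppow p) (p * ppow (p - 1) y).
Proof.
move=> p1; have p0 : 0 < p by exact: lt_trans p1.
have q0 : 0 < p - 1 by rewrite subr_gt0.
case: (ltgtP y 0) => [y0|y0|->].
- rewrite ppow_le0 ?(ltW y0)// mulr0.
  have E : \forall z \near y, cst 0 z = ppow p z.
    near=> z; rewrite ppow_le0//; apply: ltW; near: z; exact: lt_nbhsl.
  exact: (near_eq_is_derive E).
- have E : \forall z \near y, z `^ p = ppow p z.
    near=> z; rewrite /ppow (max_idPr _)//; apply: ltW; near: z; exact: lt_nbhsr.
  apply: (near_eq_is_derive E).
  by rewrite /ppow (max_idPr (ltW y0)); exact: is_derive1_powR.
- rewrite [ppow (p - 1) 0]ppow_le0// mulr0.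
  have cv : h^-1 *: ((ppow p \o shift 0) (h *: (1:R)) - ppow p 0) @[h --> 0^'] --> (0:R).
    rewrite [ppow p 0]ppow_le0//.
    apply/cvgrPdist_le => e e0.
    near=> h.
    have h0 : h != 0 by near: h; exact: nbhs_dnbhs_neq.
    rewrite sub0r normrN subr0 /= addr0 /GRing.scale/= mulr1 normrM normfV.
    rewrite ler_pdivrMl ?normr_gt0// ger0_norm ?ppow_ge0//.
    have he : `|h| <= e `^ (p - 1)^-1.
      by near: h; apply: dnbhs0_le; exact: powR_gt0.
    apply: le_trans (ppow_le (ltW p0) (ler_norm h)) _.
    rewrite /ppow (max_idPr (normr_ge0 _)).
    have -> : p = 1 + (p - 1) by ring.
    rewrite powRD; last by rewrite normr_eq0 h0 implybT.
    rewrite powRr1//; apply: ler_wpM2l => //.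
    have := ge0_ler_powR (ltW q0) (normr_ge0 h) (powR_ge0 _ _) he.
    by rewrite -powRrM mulVf ?gt_eqF// powRr1// ltW.
  by apply: DeriveDef; [apply/cvg_ex; exists 0|exact/cvg_lim].
Unshelve. all: by end_near. Qed.

Variables (K gamma : R).
Hypotheses (K0 : 0 < K) (g0 : 0 < gamma) (g1 : gamma < 1).

(** Separation of variables: |v|^(1 - gamma) decreases at the constant rate (1
    - gamma) K, hence reaches 0 in finite time. *)
Definition drain (v0 t : R) : R := ppow (1 - gamma)^-1 (`|v0| `^ (1 - gamma) - (1 - gamma) * K * t).
Definition control (v0 t : R) : R := Num.sg v0 * drain v0 t.

Let q0 : 0 < 1 - gamma. Proof. by rewrite subr_gt0. Qed.
Let p1 : 1 < (1 - gamma)^-1.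
Proof. by rewrite invf_gt1// gtrBl. Qed.

Lemma drain0 v0 : drain v0 0 = `|v0|.
Proof.
rewrite /drain mulr0 subr0 /ppow (max_idPr (powR_ge0 _ _)) -powRrM.
by rewrite divff ?gt_eqF// powRr1.
Qed.

Lemma drain_ge0 v0 t : 0 <= drain v0 t. Proof. exact: ppow_ge0. Qed.

Lemma drain_le v0 t : 0 <= t -> drain v0 t <= `|v0|.
Proof.
move=> t0; rewrite -drain0; apply: ppow_le; first by rewrite invr_ge0 ltW.
rewrite lerD2l lerN2; apply: ler_wpM2l => //; apply: mulr_ge0; exact: ltW.
Qed.

Lemma control_extinct v0 t : `|v0| `^ (1 - gamma) / ((1 - gamma) * K) <= t -> control v0 t = 0.
Proof.
move=> ht; rewrite /control /drain ppow_le0 ?mulr0 ?invr_gt0// subr_le0.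
by rewrite mulrC -ler_pdivrMr ?mulr_gt0.
Qed.

Lemma drain_derive v0 t : is_derive t (1:R) (drain v0) (- K * drain v0 t `^ gamma).
Proof.
set a := - ((1 - gamma) * K); set b := `|v0| `^ (1 - gamma).
have E s : drain v0 s = ppow (1 - gamma)^-1 (a * s + b) by rewrite /drain /a /b mulNr (addrC _ (_ `^ _)).
have -> : drain v0 = (fun s => ppow (1 - gamma)^-1 (a * s + b)) by apply/funext.
apply: is_derive_rval; first by apply: is_derive_affine; exact: ppow_derive.
rewrite /ppow -powRrM /a (_ : (1 - gamma)^-1 - 1 = (1 - gamma)^-1 * gamma).
  by field; rewrite gt_eqF.
by field; rewrite gt_eqF.
Qed.

Lemma control_derive v0 t :
  is_derive t (1:R) (control v0) (- K * Num.sg (control v0 t) * `|control v0 t| `^ gamma).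
Proof.
have := is_deriveZ (Num.sg v0) (drain_derive v0 t).
move=> /is_derive_rval; apply; rewrite /GRing.scale/= /control sgrM normrM normr_sg sgr_id.
have [->|v00] := eqVneq v0 0; first by rewrite sgr0 !mul0r mulr0 mul0r.
rewrite mul1r (ger0_norm (drain_ge0 _ _)) mulrCA -!mulrA; congr (_ * (_ * _)).
have := drain_ge0 v0 t; rewrite le_eqVlt => /orP[/eqP<-|h].
  by rewrite powR0 ?gt_eqF// mulr0.
by rewrite gtr0_sg// mul1r.
Qed.

Lemma control0 v0 : control v0 0 = v0.
Proof. by rewrite /control drain0 mulr_sg_norm. Qed.

Lemma control_le v0 t : 0 <= t -> `|control v0 t| <= `|v0|.
Proof.
move=> t0; rewrite /control normrM normr_sg (ger0_norm (drain_ge0 _ _)).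
have [->|v00] := eqVneq v0 0; first by rewrite mul0r.
by rewrite mul1r drain_le.
Qed.

Lemma control_continuous v0 : continuous (control v0).
Proof. by apply: derivable_continuous => x; have := control_derive v0 x => -[]. Qed.

Lemma control_lip v0 t t' : 0 <= t -> 0 <= t' ->
  `|control v0 t - control v0 t'| <= K * `|v0| `^ gamma * `|t - t'|.
Proof.
wlog tt : t t' / t' <= t => [hw|] t0 t'0.
  by have [/hw|/ltW/hw] := leP t' t; [|rewrite distrC (distrC t)]; apply.
have [c /[!in_itv]/= /andP[c1 c2] ->] := @MVT_segment R (control v0) _ t' t tt
  (fun x _ => control_derive v0 x) (continuous_subspaceT (@control_continuous v0)).
rewrite normrM; apply: ler_wpM2r => //.
set u := control v0 c.
rewrite normrM [`|- K * _|]normrM normrN (gtr0_norm K0) (ger0_norm (powR_ge0 _ _)) -mulrA.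
apply: ler_wpM2l; first exact: ltW.
rewrite -[leRHS]mul1r; apply: ler_pM; rewrite ?powR_ge0//.
  by rewrite normr_sg; case: (_ == 0); rewrite ?lexx ?ler01.
apply: ge0_ler_powR; rewrite ?nnegrE ?(ltW g0)//.
by apply: control_le; exact: le_trans c1.
Qed.

Lemma sg_powR_mono (x y : R) : x <= y ->
  Num.sg x * `|x| `^ gamma <= Num.sg y * `|y| `^ gamma.
Proof.
have pos z : 0 <= z -> Num.sg z * `|z| `^ gamma = z `^ gamma.
  rewrite le_eqVlt => /orP[/eqP<-|z0]; first by rewrite sgr0 mul0r powR0// gt_eqF.
  by rewrite gtr0_sg// mul1r gtr0_norm.
have neg z : z <= 0 -> Num.sg z * `|z| `^ gamma = - (- z) `^ gamma.
  move=> z0; rewrite -[in LHS](opprK z) sgrN normrN mulNr pos// oppr_ge0//.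
move=> xy; have [x0|/ltW x0] := leP 0 x.
  have y0 := le_trans x0 xy; rewrite !pos//.
  by apply: ge0_ler_powR; rewrite ?nnegrE ?(ltW g0).
have [y0|/ltW y0] := leP 0 y.
  rewrite neg// pos//; apply: le_trans (powR_ge0 _ _).
  by rewrite oppr_le0 powR_ge0.
rewrite !neg// lerN2; apply: ge0_ler_powR; rewrite ?nnegrE ?(ltW g0) ?oppr_ge0//.
by rewrite lerN2.
Qed.

(** The right-hand side is decreasing in the state, hence the squared distance
    of two states does not increase; it is not Lipschitz at 0, and this
    monotonicity replaces the Cauchy-Lipschitz theorem. *)
Lemma control_state_unique T v0 v : 0 <= T -> control_state K gamma T v0 v ->
  forall t, 0 <= t -> t <= T -> v t = control v0 t.
Proof.
move=> T0 [cv dv v_0] t t0 tT.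
pose w s := v s - control v0 s.
pose F x : R := Num.sg x * `|x| `^ gamma.
have cw : {within `[0, t], continuous w}.
  have cv' : {within `[0, t], continuous v}.
    apply: continuous_subspaceW cv => x /=; rewrite !in_itv/= => /andP[-> h].
    exact: le_trans tT.
  move=> x; apply: cvgB; first exact: cv'.
  exact: continuous_subspaceT (@control_continuous v0) x.
have dw x : x \in `]0, t[ -> is_derive x (1:R) w (- K * (F (v x) - F (control v0 x))).
  rewrite in_itv/= => /andP[x0 xt].
  have xT : x \in `]0, T[ by rewrite in_itv/= x0 (lt_le_trans xt).
  apply: is_derive_rval; first exact: is_deriveB (dv x xT) (control_derive v0 x).
  by rewrite /F; ring.
have dz x : x \in `]0, t[ -> is_derive x (1:R) (fun y => w y * w y)
    (2 * (w x * (- K * (F (v x) - F (control v0 x))))).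
  move=> xt; apply: is_derive_rval; first exact: is_deriveM (dw x xt) (dw x xt).
  by rewrite /GRing.scale/=; ring.
have cz : {within `[0, t], continuous (fun y => w y * w y)}.
  by move=> x; apply: cvgM; exact: cw.
have [c _ cE] := MVT_segment t0 dz cz.
have w0 : w 0 = 0 by rewrite /w v_0 control0 subrr.
rewrite w0 mul0r !subr0 in cE.
have : w t * w t <= 0.
  rewrite cE; apply: mulr_le0_ge0 => //; apply: mulr_ge0_le0 => //.
  rewrite mulNr mulrN oppr_le0 mulrCA; apply: mulr_ge0; first exact: ltW.
  rewrite /w; have [h|/ltW h] := leP (control v0 c) (v c).
    by apply: mulr_ge0; rewrite subr_ge0//; exact: sg_powR_mono.
  by apply: mulr_le0; rewrite subr_le0//; exact: sg_powR_mono.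
rewrite -expr2 => h; apply/eqP; rewrite -subr_eq0 -/(w t) -sqrf_eq0 eq_le h.
exact: sqr_ge0.
Qed.

Lemma control_is_state T v0 : control_state K gamma T v0 (control v0).
Proof.
split; first exact: continuous_subspaceT (@control_continuous v0).
  by move=> t _; exact: control_derive.
exact: control0.
Qed.

(** Constant before time 0, to be Lipschitz on the whole line. *)
Definition boundary_control (v0 t : R) : R := control v0 (Num.max 0 t).

Lemma boundary_control_lip v0 t t' :
  `|boundary_control v0 t - boundary_control v0 t'| <= K * `|v0| `^ gamma * `|t - t'|.
Proof.
have m0 s : 0 <= Num.max 0 s :> R by rewrite le_max lexx.
apply: le_trans (control_lip v0 (m0 t) (m0 t')) _.
apply: ler_wpM2l; first by rewrite mulr_ge0 ?powR_ge0// ltW.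
case: (lerP 0 t) => h; case: (lerP 0 t') => h' //.
- by rewrite subr0 !ger0_norm//; lra.
- by rewrite sub0r normrN distrC !ger0_norm//; lra.
- by rewrite subr0 normr0.
Qed.
End control.

Lemma powR_small {R : realType} (p e : R) : 0 < p -> 0 < e -> exists2 m0, 0 < m0 &
  forall m, 0 <= m -> m <= m0 -> m `^ p <= e.
Proof.
move=> p0 e0; exists (e `^ p^-1); first exact: powR_gt0.
move=> m m0 h; have := ge0_ler_powR (ltW p0) m0 (powR_ge0 _ _) h.
by rewrite -powRrM mulVf ?gt_eqF// powRr1// ltW.
Qed.

(** * Shallow water in Riemann invariants *)

Section saint_venant.
Context {R : realType}.
Variables (g Hs Vs a eta : R).
Hypotheses (g0 : 0 < g) (Hs0 : 0 < Hs) (Vs0 : 0 < Vs) (a0 : 0 < a) (eta0 : 0 < eta).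
Local Notation cs := (Num.sqrt (g * Hs)).
Hypotheses (etaV : eta < Vs) (etaa : a + eta <= cs - Vs).

(** Invariants are V +- 2 sqrt(g H) minus their equilibrium values, so that the
    equilibrium is (0, 0); [celerity] is sqrt(g H) as a function of them. *)
Definition celerity (r s : R) : R := cs + (r - s) / 4.
Definition velocity (r s : R) : R := Vs + (r + s) / 2.
Definition depth (r s : R) : R := celerity r s ^+ 2 / g.

(** Truncation to [-eta, eta], the range where the flow is subcritical, with
    both speeds at least [a], and where V > 0. *)
Definition clip (z : R) : R := Num.max (- eta) (Num.min eta z).

(** The speeds V + sqrt(g H) and sqrt(g H) - V, truncated. *)
Definition lam (r s : R) : R := Vs + cs + (3 * clip r + clip s) / 4.
Definition mu (r s : R) : R := cs - Vs - (clip r + 3 * clip s) / 4.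

Lemma clip_id z : `|z| <= eta -> clip z = z.
Proof.
by rewrite ler_norml => /andP[h1 h2]; rewrite /clip (min_idPr h2) (max_idPr h1).
Qed.

Lemma clip_le z : `|clip z| <= eta.
Proof.
rewrite /clip ler_norml ge_max le_max lexx /= ge_min lexx andbT.
by rewrite ge0_cp// ltW.
Qed.

Lemma clip_lip z z' : `|clip z - clip z'| <= `|z - z'|.
Proof.
wlog zz : z z' / z' <= z => [H|].
  by have [/H//|/ltW/H] := leP z' z; rewrite distrC (distrC z).
rewrite [leRHS]ger0_norm ?subr_ge0// /clip.
case: (lerP eta z) => lx; case: (lerP eta z') => ly;
  case: (lerP (- eta) eta) => l0; case: (lerP (- eta) z) => x0; case: (lerP (- eta) z') => y0;
  rewrite ler_norml; apply/andP; split; lra.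
Qed.

Lemma lam_lip e r s r' s' : `|r - r'| <= e -> `|s - s'| <= e -> `|lam r s - lam r' s'| <= e.
Proof.
move=> h1 h2; have := le_trans (clip_lip r r') h1; have := le_trans (clip_lip s s') h2.
rewrite !ler_norml /lam => /andP[? ?] /andP[? ?]; apply/andP; split; lra.
Qed.

Lemma mu_lip e r s r' s' : `|r - r'| <= e -> `|s - s'| <= e -> `|mu r s - mu r' s'| <= e.
Proof.
move=> h1 h2; have := le_trans (clip_lip r r') h1; have := le_trans (clip_lip s s') h2.
rewrite !ler_norml /mu => /andP[? ?] /andP[? ?]; apply/andP; split; lra.
Qed.

Lemma speedsE r s : `|r| <= eta -> `|s| <= eta ->
  lam r s = velocity r s + celerity r s /\ - mu r s = velocity r s - celerity r s.
Proof.
by move=> h1 h2; rewrite /lam /mu !clip_id// /velocity /celerity; split; field.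
Qed.

Lemma mu_lo r s : a <= mu r s.
Proof.
have := clip_le r; have := clip_le s; move: etaa.
rewrite !ler_norml /mu => ? /andP[? ?] /andP[? ?]. lra.
Qed.

Lemma mu_lam r s : mu r s <= lam r s.
Proof.
have := clip_le r; have := clip_le s; move: etaV.
rewrite !ler_norml /mu /lam => ? /andP[? ?] /andP[? ?]; lra.
Qed.

Lemma lam_hi r s : lam r s <= Vs + cs + eta.
Proof.
have := clip_le r; have := clip_le s.
rewrite !ler_norml /lam => /andP[? ?] /andP[? ?]; lra.
Qed.

Lemma cs_eta : eta < cs. Proof. by move: Vs0 a0 etaa; lra. Qed.

Lemma celerity_ge r s : `|r| <= eta -> `|s| <= eta -> cs / 2 <= celerity r s.
Proof.
have := cs_eta.
by rewrite !ler_norml /celerity => ? /andP[? ?] /andP[? ?]; lra.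
Qed.

Lemma celerity_gt0 r s : `|r| <= eta -> `|s| <= eta -> 0 < celerity r s.
Proof.
have := cs_eta; have := eta0.
by rewrite !ler_norml /celerity => ? ? /andP[? ?] /andP[? ?]; lra.
Qed.

Lemma velocity_gt0 r s : `|r| <= eta -> `|s| <= eta -> 0 < velocity r s.
Proof. by move: etaV; rewrite !ler_norml /velocity => ? /andP[? ?] /andP[? ?]; lra. Qed.

(** The condition H V = Hs Vs at the uncontrolled end, multiplied by g. *)
Definition inflow (r s : R) := celerity r s ^+ 2 * velocity r s = cs ^+ 2 * Vs.

(** On a level set of celerity^2 * velocity the celerity decreases when the
    velocity increases: r - s and r + s vary in opposite directions, which
    means that |r - r'| <= |s - s'|. *)
Lemma inflow_lip r s r' s' : `|r| <= eta -> `|s| <= eta -> `|r'| <= eta -> `|s'| <= eta ->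
  inflow r s -> inflow r' s' -> `|r - r'| <= `|s - s'|.
Proof.
wlog VV : r s r' s' / velocity r s <= velocity r' s' => [hw h1 h2 h3 h4 i1 i2|].
  have [/hw|/ltW/hw] := leP (velocity r s) (velocity r' s'); first exact.
  by rewrite distrC (distrC s); exact.
move=> h1 h2 h3 h4 i1 i2.
have q0 := celerity_gt0 h1 h2; have q0' := celerity_gt0 h3 h4.
have v0 := velocity_gt0 h1 h2; have v0' := velocity_gt0 h3 h4.
have qq : celerity r' s' <= celerity r s.
  rewrite leNgt; apply/negP => qq.
  have : celerity r s ^+ 2 * velocity r s < celerity r' s' ^+ 2 * velocity r' s'.
    apply: (@lt_le_trans _ _ (celerity r' s' ^+ 2 * velocity r s)).
      by rewrite ltr_pM2r// !expr2; apply: ltr_pM => //; exact: ltW.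
    by apply: ler_wpM2l => //; exact: sqr_ge0.
  by rewrite i1 i2 ltxx.
rewrite [leRHS]ler0_norm; last by rewrite /celerity /velocity in qq VV; lra.
rewrite ler_norml; apply/andP; rewrite /celerity /velocity in qq VV; split; lra.
Qed.

Lemma inflow0 : inflow 0 0.
Proof. by rewrite /inflow /celerity /velocity subrr addr0 !mul0r !addr0. Qed.

(** Intermediate values between r = -|s| and r = |s|: in both cases either the
    celerity or the velocity has its equilibrium value, and the other one is on
    the right side of it. *)
Lemma inflow_ex s : `|s| <= eta -> exists2 r, `|r| <= eta & inflow r s.
Proof.
move=> hs; pose f r := celerity r s ^+ 2 * velocity r s.
have cf : {within `[(- `|s|), `|s|], continuous f}.
  apply: continuous_subspaceT => x; rewrite /f /celerity /velocity.
  have cq : {for x, continuous (fun r : R => cs + (r - s) / 4)}.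
    apply: cvgD; first exact: cvg_cst.
    by apply: cvgMl; apply: cvgB; [exact: cvg_id|exact: cvg_cst].
  apply: cvgM; first by apply: cvgM.
  apply: cvgD; first exact: cvg_cst.
  by apply: cvgMl; apply: cvgD; [exact: cvg_id|exact: cvg_cst].
have vE : velocity (- s) s = Vs by rewrite /velocity addNr mul0r addr0.
have cE : celerity s s = cs by rewrite /celerity subrr mul0r addr0.
have c0 : 0 <= cs by exact: sqrtr_ge0.
have [lo hi] : f (- `|s|) <= cs ^+ 2 * Vs /\ cs ^+ 2 * Vs <= f `|s|.
  rewrite /f; case: (ger0P s) => s0; rewrite ?opprK vE cE.
    have q0 : 0 <= celerity (- s) s.
      by apply: ltW; apply: celerity_gt0; rewrite ?normrN.
    split.
      apply: ler_wpM2r; first exact: ltW.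
      by rewrite !expr2; apply: ler_pM => //; rewrite /celerity; lra.
    by apply: ler_wpM2l; [exact: sqr_ge0|rewrite /velocity; lra].
  split.
    by apply: ler_wpM2l; [exact: sqr_ge0|rewrite /velocity; lra].
  apply: ler_wpM2r; first exact: ltW.
  by rewrite !expr2; apply: ler_pM => //; rewrite /celerity; lra.
have [r /[!in_itv]/= rs fr] : exists2 c, c \in `[(- `|s|), `|s|] & f c = cs ^+ 2 * Vs.
  apply: IVT => //; first by rewrite ge0_cp.
  by rewrite ge_min lo le_max hi orbT.
by exists r => //; apply: le_trans hs; rewrite ler_norml.
Qed.

Definition phi (s : R) : R := xget 0 [set r | `|r| <= eta /\ inflow r (clip s)].

Lemma phiP s : `|phi s| <= eta /\ inflow (phi s) (clip s).
Proof.
have [r h1 h2] := inflow_ex (clip_le s).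
by rewrite /phi; case: xgetP => [x -> []//|/(_ r)/=]; case.
Qed.

Lemma phi_lip s s' : `|phi s - phi s'| <= `|s - s'|.
Proof.
have [h1 h2] := phiP s; have [h3 h4] := phiP s'.
by apply: le_trans (clip_lip s s'); apply: inflow_lip => //; exact: clip_le.
Qed.

Lemma inflow_phi r s : `|r| <= eta -> `|s| <= eta -> inflow r s <-> r = phi s.
Proof.
move=> hr hs; have [h1] := phiP s; rewrite clip_id// => h2; split=> [rs|->//].
apply/eqP; rewrite -subr_eq0 -normr_le0 -(normr0 R) -(subrr s).
exact: inflow_lip.
Qed.

Lemma phi0 : phi 0 = 0.
Proof. by apply/esym/inflow_phi; rewrite ?normr0 ?(ltW eta0)//; exact: inflow0. Qed.

Lemma saint_venant_system (l sg : R) (S : R -> R) : 0 < l -> 0 <= sg ->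
  (forall t t', `|S t - S t'| <= sg * `|t - t'|) ->
  wave_system l a (Vs + cs + eta) sg lam mu phi S.
Proof.
move=> l0 sg0 Sl; split=> //.
- exact: mu_lo.
- exact: mu_lam.
- exact: lam_hi.
- exact: lam_lip.
- exact: mu_lip.
- exact: phi_lip.
- exact: phi0.
Qed.

Lemma sqrt_depth r s : `|r| <= eta -> `|s| <= eta -> Num.sqrt (g * depth r s) = celerity r s.
Proof.
move=> h1 h2; rewrite /depth mulrC divfK ?gt_eqF// sqrtr_sqr ger0_norm//.
exact: ltW (celerity_gt0 h1 h2).
Qed.

Definition rinv (H V : R) : R := V - Vs + 2 * (Num.sqrt (g * H) - cs).
Definition sinv (H V : R) : R := V - Vs - 2 * (Num.sqrt (g * H) - cs).

Lemma celerity_inv H V : celerity (rinv H V) (sinv H V) = Num.sqrt (g * H).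
Proof. by rewrite /celerity /rinv /sinv; field. Qed.

Lemma velocity_inv H V : velocity (rinv H V) (sinv H V) = V.
Proof. by rewrite /velocity /rinv /sinv; field. Qed.

Lemma depth_inv H V : 0 <= H -> depth (rinv H V) (sinv H V) = H.
Proof.
move=> H0; rewrite /depth celerity_inv sqr_sqrtr ?mulr_ge0 ?(ltW g0)//.
by rewrite mulrC mulKf// gt_eqF.
Qed.

Lemma inflow_inv H V : 0 <= H -> inflow (rinv H V) (sinv H V) <-> H * V = Hs * Vs.
Proof.
move=> H0; rewrite /inflow celerity_inv velocity_inv.
rewrite !sqr_sqrtr ?mulr_ge0 ?(ltW g0) ?(ltW Hs0)// -!mulrA.
by split=> [/(mulfI (lt0r_neq0 g0))|->].
Qed.

(** The lower bound is on one argument only, so that the other one may be the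
    depth of a solution about which nothing is known yet. *)
Lemma sqrt_near (k u v : R) : 0 < k -> k ^+ 2 <= u ->
  `|Num.sqrt u - Num.sqrt v| <= `|u - v| / k.
Proof.
move=> k0 ku; have u0 : 0 <= u by apply: le_trans ku; exact: sqr_ge0.
have su : k <= Num.sqrt u by rewrite -(ger0_norm (ltW k0)) -sqrtr_sqr ler_wsqrtr.
have key w : 0 <= w -> `|Num.sqrt u - Num.sqrt w| <= `|u - w| / k.
  move=> w0; have sw := sqrtr_ge0 w.
  have -> : u - w = (Num.sqrt u - Num.sqrt w) * (Num.sqrt u + Num.sqrt w).
    by rewrite -subr_sqr !sqr_sqrtr.
  rewrite normrM ler_pdivlMr//; apply: ler_wpM2l => //.
  by apply: le_trans (ler_norm _); rewrite (le_trans su)// lerDl.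
have [v0|v0] := leP 0 v; first exact: key.
rewrite (ler0_sqrtr (ltW v0)) -[in leLHS](sqrtr0 R).
apply: le_trans (key 0 (lexx _)) _; apply: ler_wpM2r; first by rewrite invr_ge0 ltW.
by rewrite subr0 !ger0_norm; lra.
Qed.

End saint_venant.

(** * Characteristic solutions solve the closed loop *)

Section tools.
Context {R : realType}.
Implicit Types (u v f : R * R -> R).

(** Bounded Lipschitz functions form an algebra, which contains depth, velocity
    and the two fluxes once it contains the invariants. *)
Definition blip u := exists L M, [/\ 0 <= L, 0 <= M, glip L u & forall p, `|u p| <= M].

Lemma blip_cst (c : R) : blip (fun=> c).
Proof. by exists 0, `|c|; split=> // p q; rewrite subrr normr0 mul0r. Qed.

Lemma blipD u v : blip u -> blip v -> blip (fun p => u p + v p).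
Proof.
move=> [L [M [L0 M0 uL uM]]] [L' [M' [L0' M0' vL vM]]].
exists (L + L'), (M + M'); split; rewrite ?addr_ge0//.
  move=> p q; rewrite opprD addrACA; apply: le_trans (ler_normD _ _) _.
  by rewrite mulrDl; apply: lerD.
by move=> p; apply: le_trans (ler_normD _ _) _; apply: lerD.
Qed.

Lemma blipM u v : blip u -> blip v -> blip (fun p => u p * v p).
Proof.
move=> [L [M [L0 M0 uL uM]]] [L' [M' [L0' M0' vL vM]]].
exists (L * M' + M * L'), (M * M'); split; rewrite ?addr_ge0 ?mulr_ge0//.
  move=> p q.
  have -> : u p * v p - u q * v q = (u p - u q) * v p + u q * (v p - v q) by ring.
  apply: le_trans (ler_normD _ _) _; rewrite !normrM mulrDl; apply: lerD.
    by rewrite mulrAC; apply: ler_pM.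
  by rewrite -mulrA; apply: ler_pM.
by move=> p; rewrite normrM; apply: ler_pM.
Qed.

Lemma glipW L L' u : L <= L' -> glip L u -> glip L' u.
Proof.
move=> LL uL p q; apply: le_trans (uL p q) _.
by apply: ler_wpM2r => //; exact: addr_ge0.
Qed.

Lemma glip_lipschitz L u (A : set (R * R)) : 0 <= L -> glip L u ->
  [lipschitz u p | p in A].
Proof.
move=> L0 uL; exists (2 * L); split; first exact: num_real.
move=> k kL [p q] [_ _] /=; apply: le_trans (uL p q) _.
have h1 : `|p.1 - q.1| <= `|p - q|.
  by rewrite [leRHS]/Num.norm/= le_max lexx.
have h2 : `|p.2 - q.2| <= `|p - q|.
  by rewrite [leRHS]/Num.norm/= le_max lexx orbT.
apply: (@le_trans _ _ (2 * L * `|p - q|)).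
  rewrite [2 * L]mulrC -mulrA; apply: ler_wpM2l => //.
  by rewrite mulr2n mulrDl mul1r; exact: lerD.
by apply: ler_wpM2r => //; exact: ltW.
Qed.

Lemma weak_law_ext (D : set (R * R)) u u' f f' : (forall p, D p -> u p = u' p) ->
  (forall p, D p -> f p = f' p) ->
  weak_conservation_law D u f -> weak_conservation_law D u' f'.
Proof.
move=> uu ff H phi tphi; rewrite -[RHS](H phi tphi).
by apply: eq_integral => p /set_mem Dp; rewrite uu// ff.
Qed.

Lemma cvg_close (x y : nat -> R) (B c : R) :
  (\forall n \near \oo, `|x n - y n| <= B * hseq n) ->
  y n @[n --> \oo] --> c -> x n @[n --> \oo] --> c.
Proof.
move=> xy yc.
have z0 : B * hseq n @[n --> \oo] --> (0 : R).
  by rewrite -(mulr0 B); apply: cvgMr; exact: hseq_cvg0.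
have d0 : x n - y n @[n --> \oo] --> (0 : R).
  apply: (@squeeze_cvgr _ _ _ _ (fun n => - (B * hseq n)) (fun n => B * hseq n)) => //.
    by near=> n; rewrite -ler_norml; near: n.
  by rewrite -oppr0; exact: cvgN.
rewrite -[c]addr0 (_ : x = fun n => y n + (x n - y n)); first exact: cvgD.
by apply/funext => n; rewrite addrC subrK.
Unshelve. all: by end_near. Qed.

(** If [z] varies to second order along the line of speed [k] through (t, x),
    its time derivative there is -k times its space derivative. *)
Lemma transport_dt (z : R -> R -> R) (T l C k d t x : R) : t < T -> 0 < x -> x < l ->
  (forall h, 0 <= h -> t + h <= T -> 0 <= x - k * h -> x - k * h <= l ->
     `|z (t + h) x - z t (x - k * h)| <= C * h * h) ->
  is_derive x (1:R) (z t) d ->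
  n.+1%:R * (z (t + hseq n) x - z t x) @[n --> \oo] --> - (k * d).
Proof.
move=> tT x0 xl hz dz.
have dw : is_derive (0:R) (1:R) (fun y => z t (- k * y + x)) (- k * d).
  by apply: is_derive_affine; rewrite mulr0 add0r.
have := seq_derive dw; rewrite mulr0 add0r mulNr => H.
apply: (@cvg_close _ _ C _ _ H).
have small (e : R) : 0 < e -> \forall n \near \oo, (hseq n : R) < e.
  move=> e0; have := @hseq_cvg0 R; move/cvgrPdist_lt => /(_ e e0).
  by apply: filterS => n; rewrite sub0r normrN gtr0_norm// hseq_gt0.
have k1 : 0 < `|k| + 1 by rewrite ltr_pwDr.
have xk : 0 < x / (`|k| + 1) by rewrite divr_gt0.
have lk : 0 < (l - x) / (`|k| + 1) by rewrite divr_gt0 ?subr_gt0.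
near=> n.
have hp := @hseq_gt0 R n.
have h1 : hseq n < T - t by near: n; apply: small; rewrite subr_gt0.
have h2 : hseq n < x / (`|k| + 1) by near: n; exact: small.
have h3 : hseq n < (l - x) / (`|k| + 1) by near: n; exact: small.
rewrite ltr_pdivlMr// in h2; rewrite ltr_pdivlMr// in h3.
have kh : `|k * hseq n| <= hseq n * (`|k| + 1).
  by rewrite normrM (gtr0_norm hp) mulrC; apply: ler_wpM2l; [exact: ltW|rewrite lerDl].
move: kh; rewrite ler_norml => /andP[k2 k3].
rewrite add0r mulNr -mulrBr opprB addrA subrK normrM ger0_norm//.
have -> : z (t + hseq n) x - z t (- (k * hseq n) + x) = z (t + hseq n) x - z t (x - k * hseq n).
  by rewrite [- _ + x]addrC.
have b1 : t + hseq n <= T by lra.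
have b2 : 0 <= x - k * hseq n by rewrite subr_ge0 ltW// (le_lt_trans k3).
have b3 : x - k * hseq n <= l.
  by rewrite -lerBrDl; apply/ltW/(le_lt_trans _ h3); rewrite lerNl.
have h := hz (hseq n) (ltW hp) b1 b2 b3; apply: le_trans (ler_wpM2l (ler0n _ _) h) _.
suff -> : n.+1%:R * (C * hseq n * hseq n) = C * hseq n by [].
by rewrite mulrC -[_ * _ * _ * _]mulrA /hseq mulVf ?pnatr_eq0// mulr1.
Unshelve. all: by end_near. Qed.

Lemma csol_ext (l Lam : R) lam mu phi S ta tb L Lt C m (r s r' s' : R -> R -> R) :
  (forall t, ta <= t -> t <= tb -> r t = r' t) ->
  (forall t, ta <= t -> t <= tb -> s t = s' t) ->
  csol l Lam lam mu phi S ta tb L Lt C m r s -> csol l Lam lam mu phi S ta tb L Lt C m r' s'.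
Proof.
move=> er es [h1 h2 h3 h4 h5 h6 h7 h8 h9 h10 h11 h12].
have lo t h : ta <= t -> 0 <= h -> ta <= t + h by lra.
have hi t h : 0 <= h -> t + h <= tb -> t <= tb by lra.
split.
- by move=> t x ? ?; rewrite -er//; exact: h1.
- by move=> t x ? ?; rewrite -es//; exact: h2.
- by move=> t ? ?; rewrite -er//; exact: h3.
- by move=> t ? ?; rewrite -es//; exact: h4.
- by move=> t t' x ? ? ? ?; rewrite -!er//; exact: h5.
- by move=> t t' x ? ? ? ?; rewrite -!es//; exact: h6.
- by move=> t x ? ?; rewrite -er//; exact: h7.
- by move=> t x ? ?; rewrite -es//; exact: h8.
- by move=> t ? ?; rewrite -er// -es//; exact: h9.
- by move=> t ? ?; rewrite -es//; exact: h10.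
- move=> t h x k t1 h0 t2 *; rewrite -!er -?es ?(hi _ _ h0 t2) ?(lo _ _ t1 h0)//; exact: h11.
- move=> t h x k t1 h0 t2 *; rewrite -!es -?er ?(hi _ _ h0 t2) ?(lo _ _ t1 h0)//; exact: h12.
Qed.
End tools.

(** The solution is assumed to be constant in time outside [0, T], to be
    Lipschitz on the plane. *)
Section closed_loop_of_csol.
Context {R : realType}.
Variables (g Hs Vs a eta : R).
Hypotheses (g0 : 0 < g) (Hs0 : 0 < Hs) (Vs0 : 0 < Vs) (a0 : 0 < a) (eta0 : 0 < eta).
Local Notation cs := (Num.sqrt (g * Hs)).
Hypotheses (etaV : eta < Vs) (etaa : a + eta <= cs - Vs).
Local Notation Lam := (Vs + cs + eta).
Local Notation lam := (lam g Hs Vs eta).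
Local Notation mu := (mu g Hs Vs eta).
Local Notation phi := (phi g Hs Vs eta).
Local Notation celerity := (celerity g Hs).
Local Notation velocity := (velocity Vs).
Local Notation depth := (depth g Hs).
Variables (l T sg L Lt C m : R) (S : R -> R) (r s : R -> R -> R).
Hypotheses (l0 : 0 < l) (T0 : 0 < T) (L0 : 0 <= L) (Lt0 : 0 <= Lt) (C0 : 0 <= C).
Hypothesis W : wave_system l a Lam sg lam mu phi S.
Hypothesis w : csol l Lam lam mu phi S 0 T L Lt C m r s.
Hypothesis m_eta : m <= eta.
Hypothesis rT : forall t, r (clamp T t) = r t.
Hypothesis sT : forall t, s (clamp T t) = s t.

Let cT0 t : 0 <= clamp T t. Proof. exact: clamp_ge0. Qed.
Let cTT t : clamp T t <= T. Proof. by apply: clamp_le; exact: ltW. Qed.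

Let r_le t x : `|r t x| <= eta.
Proof. by rewrite -rT; apply: le_trans m_eta; exact: cs_rm w _ _ (cT0 t) (cTT t). Qed.
Let s_le t x : `|s t x| <= eta.
Proof. by rewrite -sT; apply: le_trans m_eta; exact: cs_sm w _ _ (cT0 t) (cTT t). Qed.
Let r_klip t : klip L (r t).
Proof. by rewrite -rT; exact: cs_rx w _ (cT0 t) (cTT t). Qed.
Let s_klip t : klip L (s t).
Proof. by rewrite -sT; exact: cs_sx w _ (cT0 t) (cTT t). Qed.

Let r_glip : glip (Lt + L) (fun p => r p.1 p.2).
Proof.
move=> [t x] [t' x'] /=; apply: le_trans (ler_distD (r t' x) _ _) _.
rewrite mulrDl; apply: le_trans (_ : Lt * `|t - t'| + L * `|x - x'| <= _).
  apply: lerD; last exact: r_klip.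
  rewrite -(rT t) -(rT t'); apply: le_trans (cs_rt w x (cT0 t) (cTT t) (cT0 t') (cTT t')) _.
  by apply: ler_wpM2l => //; exact: clamp_lip.
by apply: lerD; apply: ler_wpM2l => //; rewrite ?lerDl ?lerDr.
Qed.

Let s_glip : glip (Lt + L) (fun p => s p.1 p.2).
Proof.
move=> [t x] [t' x'] /=; apply: le_trans (ler_distD (s t' x) _ _) _.
rewrite mulrDl; apply: le_trans (_ : Lt * `|t - t'| + L * `|x - x'| <= _).
  apply: lerD; last exact: s_klip.
  rewrite -(sT t) -(sT t'); apply: le_trans (cs_st w x (cT0 t) (cTT t) (cT0 t') (cTT t')) _.
  by apply: ler_wpM2l => //; exact: clamp_lip.
by apply: lerD; apply: ler_wpM2l => //; rewrite ?lerDl ?lerDr.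
Qed.

Let r_blip : blip (fun p => r p.1 p.2).
Proof.
by exists (Lt + L), eta; split => //; [exact: addr_ge0|exact: ltW].
Qed.
Let s_blip : blip (fun p => s p.1 p.2).
Proof.
by exists (Lt + L), eta; split => //; [exact: addr_ge0|exact: ltW].
Qed.

Let q p := celerity (r p.1 p.2) (s p.1 p.2).
Let V p := velocity (r p.1 p.2) (s p.1 p.2).
Let H p := depth (r p.1 p.2) (s p.1 p.2).

Let q_blip : blip q.
Proof.
have -> : q = (fun p => cs + (r p.1 p.2 + (-1) * s p.1 p.2) * 4^-1).
  by apply/funext => p; rewrite /q /celerity mulN1r.
apply: blipD; first exact: blip_cst.
apply: blipM; last exact: blip_cst.
by apply: blipD => //; apply: blipM => //; exact: blip_cst.
Qed.

Let V_blip : blip V.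
Proof.
have -> : V = (fun p => Vs + (r p.1 p.2 + s p.1 p.2) * 2^-1) by [].
apply: blipD; first exact: blip_cst.
by apply: blipM; [exact: blipD|exact: blip_cst].
Qed.

Let H_blip : blip H.
Proof.
have -> : H = (fun p => (q p * q p) * g^-1) by apply/funext => p; rewrite /H /depth expr2.
by apply: blipM; [exact: blipM|exact: blip_cst].
Qed.

Let Lam0 : 0 < Lam := Lam_gt0 W.

Let r_dt t x d : 0 < t -> t < T -> 0 < x -> x < l -> is_derive x (1:R) (r t) d ->
  n.+1%:R * (r (t + hseq n) x - r t x) @[n --> \oo] --> - (lam (r t x) (s t x) * d).
Proof.
move=> t0 tT x0 xl dr; set k := lam _ _.
have kL : `|k| <= Lam by rewrite gtr0_norm ?(lam_gt0 W)//; exact: (ws_lam_hi W).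
apply: (@transport_dt _ r T l (C * (1 + L * Lam)) k d t x tT x0 xl _ dr) => h h0 hT y0 yl.
have e : x - k * h + k * h = x by rewrite subrK.
have b1 : 0 <= x - k * h + k * h by rewrite e ltW.
have b2 : x - k * h + k * h <= l by rewrite e ltW.
have := cs_charr w (ltW t0) h0 hT kL y0 yl b1 b2; rewrite e => /le_trans; apply.
apply: ler_wpM2r => //; rewrite -mulrA; apply: ler_wpM2l => //.
rewrite [leRHS]mulrDl mul1r lerD2l.
have kh : L * `|x - k * h - x| <= L * Lam * h.
  rewrite -mulrA; apply: ler_wpM2l => //.
  by rewrite addrAC subrr add0r normrN normrM (ger0_norm h0); apply: ler_wpM2r.
by apply: (ws_lam_lip W); apply: le_trans kh; [exact: r_klip|exact: s_klip].
Qed.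

Let s_dt t x d : 0 < t -> t < T -> 0 < x -> x < l -> is_derive x (1:R) (s t) d ->
  n.+1%:R * (s (t + hseq n) x - s t x) @[n --> \oo] --> mu (r t x) (s t x) * d.
Proof.
move=> t0 tT x0 xl dr; set k := mu _ _.
have kL : `|k| <= Lam by rewrite gtr0_norm ?(mu_gt0 W)//; exact: (mu_hi W).
rewrite -[k * d]opprK -mulNr.
apply: (@transport_dt _ s T l (C * (1 + L * Lam)) (- k) d t x tT x0 xl _ dr) => h h0 hT.
rewrite mulNr opprK => y0 yl.
have e : x + k * h - k * h = x by rewrite addrK.
have b1 : 0 <= x + k * h - k * h by rewrite e ltW.
have b2 : x + k * h - k * h <= l by rewrite e ltW.
have := cs_chars w (ltW t0) h0 hT kL y0 yl b1 b2; rewrite e => /le_trans; apply.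
apply: ler_wpM2r => //; rewrite -mulrA; apply: ler_wpM2l => //.
rewrite [leRHS]mulrDl mul1r lerD2l.
have kh : L * `|x + k * h - x| <= L * Lam * h.
  rewrite -mulrA; apply: ler_wpM2l => //.
  by rewrite addrAC subrr add0r normrM (ger0_norm h0); apply: ler_wpM2r.
by apply: (ws_mu_lip W); apply: le_trans kh; [exact: r_klip|exact: s_klip].
Qed.

Let t_cvg (z : R -> R -> R) t x : glip (Lt + L) (fun p => z p.1 p.2) ->
  z (t + hseq n) x @[n --> \oo] --> z t x.
Proof.
move=> zL; apply: (@cvg_close _ _ (fun=> z t x) (Lt + L)); last exact: cvg_cst.
near=> n; have := zL (t + hseq n, x) (t, x).
by rewrite /= subrr normr0 addr0 addrAC subrr add0r (gtr0_norm (hseq_gt0 n)).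
Unshelve. all: by end_near. Qed.

(* chain rule, at a point where both invariants have an x-derivative *)
Let pointwise t x dr ds : 0 < t -> t < T -> 0 < x -> x < l ->
  is_derive x (1:R) (r t) dr -> is_derive x (1:R) (s t) ds ->
  (exists2 d, is_derive x (1:R) (fun y => H (t, y) * V (t, y)) d &
     n.+1%:R * (H (t + hseq n, x) - H (t, x)) @[n --> \oo] --> - d) /\
  (exists2 d, is_derive x (1:R) (fun y => V (t, y) ^+ 2 / 2 + g * H (t, y)) d &
     n.+1%:R * (V (t + hseq n, x) - V (t, x)) @[n --> \oo] --> - d).
Proof.
move=> t0 tT x0 xl Dr Ds.
have R1 := r_dt t0 tT x0 xl Dr; have S1 := s_dt t0 tT x0 xl Ds.
have [lamE muE] := speedsE g Hs Vs (r_le t x) (s_le t x).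
have {}muE : mu (r t x) (s t x) = celerity (r t x) (s t x) - velocity (r t x) (s t x).
  by rewrite -[LHS]opprK muE opprB.
have Rc := @t_cvg r t x r_glip; have Sc := @t_cvg s t x s_glip.
rewrite lamE in R1; rewrite muE in S1.
set Q := celerity (r t x) (s t x) in R1 S1 *; set U := velocity (r t x) (s t x) in R1 S1 *.
have dq : is_derive x (1:R) (fun y => q (t, y)) ((dr - ds) / 4).
  have := is_deriveD (is_derive_cst cs x (1:R)) (is_deriveZ (4^-1 : R) (is_deriveB Dr Ds)).
  have -> : (cst cs + 4^-1 \*: (r t - s t)) = (fun y => q (t, y)).
    by apply/funext => y; congr (_ + _); exact: mulrC.
  by move/is_derive_rval; apply; rewrite add0r /GRing.scale/= mulrC.
have dV : is_derive x (1:R) (fun y => V (t, y)) ((dr + ds) / 2).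
  have := is_deriveD (is_derive_cst Vs x (1:R)) (is_deriveZ (2^-1 : R) (is_deriveD Dr Ds)).
  have -> : (cst Vs + 2^-1 \*: (r t + s t)) = (fun y => V (t, y)).
    by apply/funext => y; congr (_ + _); exact: mulrC.
  by move/is_derive_rval; apply; rewrite add0r /GRing.scale/= mulrC.
have dH : is_derive x (1:R) (fun y => H (t, y)) (2 * Q * ((dr - ds) / 4) / g).
  have := is_deriveZ (g^-1 : R) (is_deriveM dq dq).
  have -> : (g^-1 \*: ((fun y => q (t, y)) * (fun y => q (t, y)))) = (fun y => H (t, y)).
    by apply/funext => y; rewrite /H /depth expr2 [RHS]mulrC.
  by move/is_derive_rval; apply; rewrite /GRing.scale/= /Q /q/=; field; rewrite gt_eqF.
split.
- exists (H (t, x) * ((dr + ds) / 2) + V (t, x) * (2 * Q * ((dr - ds) / 4) / g)).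
    exact: is_deriveM dH dV.
  have E n : n.+1%:R * (H (t + hseq n, x) - H (t, x)) =
      (n.+1%:R * (r (t + hseq n) x - r t x) - n.+1%:R * (s (t + hseq n) x - s t x))
      * ((2 * cs + (r (t + hseq n) x - s (t + hseq n) x + (r t x - s t x)) / 4) / (4 * g)).
    by rewrite /H /depth /celerity/=; field; rewrite gt_eqF.
  under eq_fun do rewrite E.
  have -> : - (H (t, x) * ((dr + ds) / 2) + V (t, x) * (2 * Q * ((dr - ds) / 4) / g)) =
     (- ((U + Q) * dr) - (Q - U) * ds) *
     ((2 * cs + (r t x - s t x + (r t x - s t x)) / 4) / (4 * g)).
    rewrite /H /V /depth/= -/Q -/U.
    have -> : 2 * cs + (r t x - s t x + (r t x - s t x)) / 4 = 2 * Q.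
      by rewrite /Q /celerity; field.
    by field; rewrite gt_eqF.
  apply: cvgM; first exact: cvgB.
  apply: cvgMl; apply: cvgD; first exact: cvg_cst.
  by apply: cvgMl; apply: cvgD; [exact: cvgB|exact: cvg_cst].
- exists (V (t, x) * ((dr + ds) / 2) + g * (2 * Q * ((dr - ds) / 4) / g)).
    have := is_deriveD (is_deriveZ (2^-1 : R) (is_deriveM dV dV)) (is_deriveZ g dH).
    have -> : (2^-1 \*: ((fun y => V (t, y)) * (fun y => V (t, y))) + g \*: (fun y => H (t, y)))
       = (fun y => V (t, y) ^+ 2 / 2 + g * H (t, y)).
      by apply/funext => y; congr (_ + _); rewrite expr2; exact: mulrC.
    by move/is_derive_rval; apply; rewrite /GRing.scale/=; field; rewrite gt_eqF.
  have E n : n.+1%:R * (V (t + hseq n, x) - V (t, x)) =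
      (n.+1%:R * (r (t + hseq n) x - r t x) + n.+1%:R * (s (t + hseq n) x - s t x)) * 2^-1.
    by rewrite /V /velocity/=; field.
  under eq_fun do rewrite E.
  have -> : - (V (t, x) * ((dr + ds) / 2) + g * (2 * Q * ((dr - ds) / 4) / g)) =
     (- ((U + Q) * dr) + (Q - U) * ds) * 2^-1.
    by rewrite /V/= -/U; field; rewrite gt_eqF.
  by apply: cvgMl; exact: cvgD.
Qed.

Let ae_derive t : {ae @lebesgue_measure R, forall x : R, x \in `]0, l[ ->
  (exists d, is_derive x (1:R) (r t) d) /\ (exists d, is_derive x (1:R) (s t) d)}.
Proof.
have L1 : 0 < L + 1 by rewrite ltr_pwDr.
have up z : klip L z -> klip (L + 1) z.
  by move=> zL x y; apply: le_trans (zL x y) _; apply: ler_wpM2r => //; rewrite lerDl.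
have [d1 [_ h1 _]] := klip_ftc L1 (up _ (r_klip t)) l0.
have [d2 [_ h2 _]] := klip_ftc L1 (up _ (s_klip t)) l0.
apply: ae_imply (ae_conj h1 h2) => x [p1 p2] xl.
by split; [exists (d1 x); exact: p1|exists (d2 x); exact: p2].
Qed.

Lemma csol_weak : weak_conservation_law (Om T l) H (fun p => H p * V p) /\
  weak_conservation_law (Om T l) V (fun p => V p ^+ 2 / 2 + g * H p).
Proof.
have law u f : blip u -> blip f ->
    (forall t x dr ds, 0 < t -> t < T -> 0 < x -> x < l ->
       is_derive x (1:R) (r t) dr -> is_derive x (1:R) (s t) ds ->
       exists2 d, is_derive x (1:R) (fun y => f (t, y)) d &
         n.+1%:R * (u (t + hseq n, x) - u (t, x)) @[n --> \oo] --> - d) ->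
    weak_conservation_law (Om T l) u f.
  move=> [L1 [M1 [L10 M10 uL uM]]] [L2 [M2 [L20 M20 fL fM]]] pt.
  have L12 : L1 <= L1 + L2 by rewrite lerDl.
  have L21 : L2 <= L1 + L2 by rewrite lerDr.
  apply: (@weak_of_ae _ T l (L1 + L2) (M1 + M2) u f) => //; rewrite ?addr_ge0//.
  - exact: glipW uL.
  - exact: glipW fL.
  - by move=> p; apply: le_trans (uM p) _; rewrite lerDl.
  - by move=> p; apply: le_trans (fM p) _; rewrite lerDr.
  move=> t /[!in_itv]/= /andP[t0 tT].
  apply: ae_imply (ae_derive t) => x dd /[dup] xl /[!in_itv]/= /andP[x0 xl'].
  by have [[dr Dr] [ds Ds]] := dd xl; exact: pt Dr Ds.
split; apply: law => //.
- exact: blipM.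
- by move=> t x dr ds *; apply: (proj1 (pointwise _ _ _ _ _ _)); eassumption.
- apply: blipD; last by apply: blipM => //; exact: blip_cst.
  have -> : (fun p => V p ^+ 2 / 2) = (fun p => V p * V p * 2^-1).
    by apply/funext => p; rewrite expr2.
  by apply: blipM; [exact: blipM|exact: blip_cst].
- by move=> t x dr ds *; apply: (proj2 (pointwise _ _ _ _ _ _)); eassumption.
Qed.

Lemma csol_lipschitz (A : set (R * R)) :
  [lipschitz H p | p in A] /\ [lipschitz V p | p in A].
Proof.
have [L1 [M1 [L10 _ HL _]]] := H_blip; have [L2 [M2 [L20 _ VL _]]] := V_blip.
by split; [exact: glip_lipschitz HL|exact: glip_lipschitz VL].
Qed.

End closed_loop_of_csol.

Section closed_loop.
Context {R : realType}.
Variables (g Hs Vs a eta l K gamma : R).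
Hypotheses (g0 : 0 < g) (Hs0 : 0 < Hs) (Vs0 : 0 < Vs) (a0 : 0 < a) (eta0 : 0 < eta).
Hypotheses (l0 : 0 < l) (K0 : 0 < K) (gamma0 : 0 < gamma) (gamma1 : gamma < 1).
Local Notation cs := (Num.sqrt (g * Hs)).
Hypotheses (etaV : eta < Vs) (etaa : a + eta <= cs - Vs).
Local Notation Lam := (Vs + cs + eta).
Local Notation lam := (lam g Hs Vs eta).
Local Notation mu := (mu g Hs Vs eta).
Local Notation phi := (phi g Hs Vs eta).
Local Notation celerity := (celerity g Hs).
Local Notation velocity := (velocity Vs).
Local Notation depth := (depth g Hs).
Local Notation rinv := (rinv g Hs Vs).
Local Notation sinv := (sinv g Hs Vs).
Local Notation ctrl := (boundary_control K gamma).

Lemma lipschitz_ext (u v : R * R -> R) (A : set (R * R)) :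
  (forall p, A p -> u p = v p) -> [lipschitz u p | p in A] -> [lipschitz v p | p in A].
Proof.
move=> uv [M [Mr H]]; exists M; split => // k Mk [p q] [Ap Aq] /=.
by rewrite -!uv//; exact: (H k Mk (p, q)).
Qed.

Lemma control_system v0 :
  wave_system l a Lam (K * `|v0| `^ gamma) lam mu phi (ctrl v0).
Proof.
apply: (saint_venant_system Vs0 a0 eta0 etaV etaa l0).
  by rewrite mulr_ge0 ?powR_ge0// ltW.
by move=> t t'; exact: boundary_control_lip.
Qed.

(** At [l], s = v is the feedback law: H (v + 2 sqrt(g H) + Vs - 2 sqrt(g Hs))
    is the flux H V exactly when V - 2 sqrt(g H), shifted, is [v]. *)
Lemma csol_closed_loop (T L Lt C m v0 : R) (H0 V0 : R -> R) (r s : R -> R -> R) :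
  0 < T -> 0 <= L -> 0 <= Lt -> 0 <= C -> m <= eta ->
  csol l Lam lam mu phi (ctrl v0) 0 T L Lt C m r s ->
  (forall x : R, x \in `[0, l] ->
     [/\ 0 <= H0 x, r 0 x = rinv (H0 x) (V0 x) & s 0 x = sinv (H0 x) (V0 x)]) ->
  v0 = sinv (H0 l) (V0 l) ->
  closed_loop_solution g l K gamma Hs Vs H0 V0 T
    (fun p => depth (r p.1 p.2) (s p.1 p.2)) (fun p => velocity (r p.1 p.2) (s p.1 p.2)).
Proof.
move=> T0 L0 Lt0 C0 meta w init v0E.
pose r' t := r (clamp T t); pose s' t := s (clamp T t).
have cT t : clamp T (clamp T t) = clamp T t by rewrite clampK// ltW.
have er t : 0 <= t -> t <= T -> r t = r' t by move=> t0 tT; rewrite /r' clamp_id.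
have es t : 0 <= t -> t <= T -> s t = s' t by move=> t0 tT; rewrite /s' clamp_id.
have w' := csol_ext er es w.
have rT t : r' (clamp T t) = r' t by rewrite /r' cT.
have sT t : s' (clamp T t) = s' t by rewrite /s' cT.
have rm t x : 0 <= t -> t <= T -> `|r t x| <= eta.
  by move=> t0 tT; apply: le_trans meta; exact: cs_rm w _ _ t0 tT.
have sm t x : 0 <= t -> t <= T -> `|s t x| <= eta.
  by move=> t0 tT; apply: le_trans meta; exact: cs_sm w _ _ t0 tT.
have [wH wV] := csol_weak g0 eta0 l0 T0 L0 Lt0 C0 (control_system v0) w' meta rT sT.
have [lH lV] := csol_lipschitz eta0 T0 L0 Lt0 w' meta rT sT (`[0, T] `*` `[0, l]).
split.
- apply: lipschitz_ext lH => p [/=]; rewrite !in_itv/= => /andP[t0 tT] _.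
  by rewrite er// es.
- apply: lipschitz_ext lV => p [/=]; rewrite !in_itv/= => /andP[t0 tT] _.
  by rewrite er// es.
- apply: weak_law_ext wH => p [/=]; rewrite !in_itv/= => /andP[/ltW t0 /ltW tT] _;
    by rewrite er// es.
- apply: weak_law_ext wV => p [/=]; rewrite !in_itv/= => /andP[/ltW t0 /ltW tT] _;
    by rewrite er// es.
- move=> x xl /=; have [h0 -> ->] := init x xl; exact: depth_inv.
- move=> x xl /=; have [h0 -> ->] := init x xl; exact: velocity_inv.
- move=> t /[!in_itv]/= /andP[t0 tT].
  have := cs_left w t0 tT.
  move/(inflow_phi Vs0 a0 eta0 etaV etaa (rm _ _ t0 tT) (sm _ _ t0 tT)).
  rewrite /inflow => E; rewrite /depth [_ / g * _]mulrAC E.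
  by rewrite sqr_sqrtr ?mulr_ge0 ?(ltW g0) ?(ltW Hs0)//; field; rewrite gt_eqF.
- by move=> t _ /=; rewrite /depth divr_ge0 ?sqr_ge0 ?ltW.
- exists (control K gamma v0).
    have -> : V0 l - 2 * Num.sqrt (g * H0 l) - Vs + 2 * cs = v0.
      by rewrite v0E /sinv; ring.
    exact: control_is_state.
  move=> t /[!in_itv]/= /andP[t0 tT].
  rewrite (sqrt_depth g0 Vs0 a0 eta0 etaa (rm _ _ t0 tT) (sm _ _ t0 tT)); congr (_ * _).
  have <- : s t l = control K gamma v0 t.
    by rewrite (cs_right w t0 tT) /boundary_control (max_idPr t0).
  by rewrite /velocity /celerity; field.
Qed.

End closed_loop.

(** * Solutions near the equilibrium are characteristic *)

Section transport_closed.
Context {R : realType}.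

Lemma le_of_small (X Y Z : R) : 0 <= Z ->
  (forall e, 0 < e -> e < 1 -> X <= Y + e * Z) -> X <= Y.
Proof.
move=> Z0 H; apply/ler_addgt0Pr => d d0.
have Z1 : 0 < Z + 1 by rewrite ltr_pwDr.
pose e := Num.min 2^-1 (d / (Z + 1)).
have e0 : 0 < e by rewrite lt_min invr_gt0 ltr0n divr_gt0.
have e1 : e < 1 by rewrite gt_min invf_lt1 ?ltr0n// ltr1n.
apply: le_trans (H e e0 e1) _; rewrite lerD2l.
apply: le_trans (_ : d / (Z + 1) * Z <= _).
  by apply: ler_wpM2r => //; rewrite ge_min lexx orbT.
by rewrite mulrAC ler_pdivrMr//; apply: ler_wpM2l; [exact: ltW|rewrite lerDl].
Qed.

(** Extension to segments that touch the boundary of the rectangle, which a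
    homothety of ratio 1 - e at its centre sends inside without changing their
    slope. *)
Lemma weak_transport_closed (T l L g M : R) H V : 0 < T -> 0 < l -> 0 <= L -> 0 <= M ->
  glip L H -> glip L V ->
  weak_conservation_law (Om T l) H (fun p => H p * V p) ->
  weak_conservation_law (Om T l) V (fun p => V p ^+ 2 / 2 + g * H p) ->
  exists2 C : R, 0 <= C & forall a H0 V0 k t0 t1 x0 : R,
  a ^+ 2 * H0 = g -> `|a| <= M -> `|k| <= M ->
  0 <= t0 -> t0 <= t1 -> t1 <= T -> 0 <= x0 -> x0 <= l ->
  0 <= x0 + k * (t1 - t0) -> x0 + k * (t1 - t0) <= l ->
  `|a * (H (t1, x0 + k * (t1 - t0)) - H (t0, x0))
    + (V (t1, x0 + k * (t1 - t0)) - V (t0, x0))|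
  <= C * (`|H (t0, x0) - H0| + `|V (t0, x0) - V0| + (t1 - t0) + `|V0 + a * H0 - k|) * (t1 - t0).
Proof.
move=> T0 l0 L0 M0 HL VL wH wV.
have [C C0 HC] := weak_transport T0 l0 L0 M0 HL VL wH wV.
exists C => // a H0 V0 k t0 t1 x0 aH aM kM t00 t01 t1T x00 x0l x10 x1l.
move: t01; rewrite le_eqVlt => /orP[/eqP<-|t01].
  by rewrite !subrr !mulr0 addr0 !subrr mulr0 addr0 normr0.
set x1 := x0 + k * (t1 - t0) in x10 x1l *; pose D := T + l.
pose sh (e c z : R) := (1 - e) * z + e * c.
have sh_in e c z b : 0 < e -> e < 1 -> 0 <= z -> z <= b -> 0 < c -> c < b -> 0 < sh e c z /\ sh e c z < b.
  move=> e0 e1 z0 zb c0 cb; have h1 : 0 <= (1 - e) * z by rewrite mulr_ge0// subr_ge0 ltW.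
  have h2 : 0 < e * c by rewrite mulr_gt0.
  have h3 : (1 - e) * z <= (1 - e) * b by rewrite ler_wpM2l// subr_ge0 ltW.
  have h4 : e * c < e * b by rewrite ltr_pM2l.
  by rewrite /sh; split; lra.
have sh_near e c z b : 0 < e -> 0 <= z -> z <= b -> 0 < c -> c < b -> `|sh e c z - z| <= e * b.
  move=> e0 z0 zb c0 cb; have -> : sh e c z - z = e * (c - z) by rewrite /sh; ring.
  rewrite normrM (gtr0_norm e0); apply: ler_wpM2l; first exact: ltW.
  by rewrite ler_norml; apply/andP; split; lra.
have T2 : 0 < T / 2 /\ T / 2 < T by split; lra.
have l2 : 0 < l / 2 /\ l / 2 < l by split; lra.
have t0T : t0 <= T by lra.
have t10 : 0 <= t1 by lra.
have D0 : 0 <= D by rewrite /D addr_ge0// ltW.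
have Z0 : 0 <= 2 * (M + 1) * L * D + 2 * C * L * D * T.
  by rewrite addr_ge0 ?mulr_ge0 ?addr_ge0// ltW.
apply: (le_of_small Z0) => e e0 e1.
have [ta tb] := sh_in e _ _ _ e0 e1 t00 t0T T2.1 T2.2.
have [tc td] := sh_in e _ _ _ e0 e1 t10 t1T T2.1 T2.2.
have [xa xb] := sh_in e _ _ _ e0 e1 x00 x0l l2.1 l2.2.
have [xc xd] := sh_in e _ _ _ e0 e1 x10 x1l l2.1 l2.2.
have na := sh_near e _ _ _ e0 t00 t0T T2.1 T2.2.
have nb := sh_near e _ _ _ e0 t10 t1T T2.1 T2.2.
have nc := sh_near e _ _ _ e0 x00 x0l l2.1 l2.2.
have nd := sh_near e _ _ _ e0 x10 x1l l2.1 l2.2.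
move: ta tb tc td xa xb xc xd na nb nc nd.
set u0 := sh e (T / 2) t0; set u1 := sh e (T / 2) t1.
set y0 := sh e (l / 2) x0; set y1 := sh e (l / 2) x1 => ta tb tc td xa xb xc xd na nb nc nd.
have uE : u1 - u0 = (1 - e) * (t1 - t0) by rewrite /u1 /u0 /sh; ring.
have yE : y0 + k * (u1 - u0) = y1 by rewrite uE /y0 /y1 /x1 /sh; ring.
have h01 : 0 < t1 - t0 by rewrite subr_gt0.
have u01 : u0 < u1 by rewrite -subr_gt0 uE mulr_gt0// subr_gt0.
have u_le : u1 - u0 <= t1 - t0.
  by rewrite uE ler_piMl ?ltW// gtrBl.
have := HC a H0 V0 k u0 u1 y0 aH aM kM ta u01 td xa xb; rewrite yE => /(_ xc xd) main.
have near f : glip L f -> `|f (u0, y0) - f (t0, x0)| <= L * (e * D) /\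
    `|f (u1, y1) - f (t1, x1)| <= L * (e * D).
  move=> fL; rewrite /D mulrDr; split; apply: le_trans (fL _ _) _; apply: ler_wpM2l => //=; exact: lerD.
have [H1 H2] := near _ HL; have [V1 V2] := near _ VL.
set P := a * (H (t1, x1) - H (t0, x0)) + (V (t1, x1) - V (t0, x0)).
set Q := a * (H (u1, y1) - H (u0, y0)) + (V (u1, y1) - V (u0, y0)) in main.
have LeD : 0 <= L * (e * D) by rewrite !mulr_ge0// ltW.
have PQ : `|P - Q| <= 2 * (M + 1) * (L * (e * D)).
  have -> : P - Q = a * ((H (u0, y0) - H (t0, x0)) - (H (u1, y1) - H (t1, x1)))
     + ((V (u0, y0) - V (t0, x0)) - (V (u1, y1) - V (t1, x1))) by rewrite /P /Q; ring.
  apply: le_trans (ler_normD _ _) _.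
  have h1 : `|H (u0, y0) - H (t0, x0) - (H (u1, y1) - H (t1, x1))| <= 2 * (L * (e * D)).
    apply: le_trans (ler_normB _ _) _; rewrite mulr_natl mulr2n; exact: lerD.
  have h2 : `|V (u0, y0) - V (t0, x0) - (V (u1, y1) - V (t1, x1))| <= 2 * (L * (e * D)).
    apply: le_trans (ler_normB _ _) _; rewrite mulr_natl mulr2n; exact: lerD.
  have h3 : `|a * (H (u0, y0) - H (t0, x0) - (H (u1, y1) - H (t1, x1)))| <= M * (2 * (L * (e * D))).
    by rewrite normrM; apply: ler_pM.
  by apply: le_trans (lerD h3 h2) _; rewrite le_eqVlt; apply/orP; left; apply/eqP; ring.
have PE : `|P| <= `|Q| + 2 * (M + 1) * (L * (e * D)).
  have := ler_normD (P - Q) Q; rewrite subrK => /le_trans; apply.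
  by rewrite addrC; exact: lerD.
have QE : `|Q| <= C * (`|H (t0, x0) - H0| + `|V (t0, x0) - V0| + (t1 - t0) + `|V0 + a * H0 - k|) * (t1 - t0)
    + 2 * C * (L * (e * D)) * T.
  apply: le_trans main _.
  apply: le_trans (_ : C * (`|H (t0, x0) - H0| + `|V (t0, x0) - V0| + (t1 - t0) + `|V0 + a * H0 - k| + 2 * (L * (e * D))) * (t1 - t0) <= _).
    have u10 : 0 <= u1 - u0 by rewrite subr_ge0 ltW.
    apply: ler_pM => //.
      by apply: mulr_ge0 => //; repeat apply: addr_ge0 => //.
    apply: ler_wpM2l => //.
    have -> : `|H (t0, x0) - H0| + `|V (t0, x0) - V0| + (t1 - t0) + `|V0 + a * H0 - k| + 2 * (L * (e * D))
      = (L * (e * D) + `|H (t0, x0) - H0|) + (L * (e * D) + `|V (t0, x0) - V0|) + (t1 - t0)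
        + `|V0 + a * H0 - k| by ring.
    apply: lerD => //; apply: lerD => //; apply: lerD.
      by apply: le_trans (ler_distD (H (t0, x0)) _ _) _; exact: lerD.
    by apply: le_trans (ler_distD (V (t0, x0)) _ _) _; exact: lerD.
  rewrite [C * (_ + 2 * _)]mulrDr mulrDl lerD2l.
  have -> : 2 * C * (L * (e * D)) * T = C * (2 * (L * (e * D))) * T by ring.
  apply: ler_wpM2l; last by rewrite lerBlDr; apply: le_trans t1T _; rewrite lerDl.
  by apply: mulr_ge0 => //; exact: mulr_ge0.
apply: le_trans PE _; apply: le_trans (lerD QE (lexx _)) _.
rewrite -addrA lerD2l le_eqVlt; apply/orP; left; apply/eqP; ring.
Qed.
End transport_closed.

(** [H] and [V] are an arbitrary solution, of Lipschitz constant [LU], which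
    nothing prevents from leaving the neighbourhood of the equilibrium; what
    follows holds as long as it remains there. *)
Section window.
Context {R : realType}.
Variables (g Hs Vs a eta : R).
Hypotheses (g0 : 0 < g) (Hs0 : 0 < Hs) (Vs0 : 0 < Vs) (a0 : 0 < a) (eta0 : 0 < eta).
Local Notation cs := (Num.sqrt (g * Hs)).
Hypotheses (etaV : eta < Vs) (etaa : a + eta <= cs - Vs).
Local Notation Lam := (Vs + cs + eta).
Local Notation lam := (lam g Hs Vs eta).
Local Notation mu := (mu g Hs Vs eta).
Local Notation phi := (phi g Hs Vs eta).
Local Notation celerity := (celerity g Hs).
Local Notation velocity := (velocity Vs).
Local Notation depth := (depth g Hs).
Local Notation rinv := (rinv g Hs Vs).
Local Notation sinv := (sinv g Hs Vs).
Variables (l T LU : R) (S : R -> R) (H V : R * R -> R).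
Hypotheses (l0 : 0 < l) (T0 : 0 < T) (LU0 : 0 <= LU).
Hypotheses (HL : glip LU H) (VL : glip LU V).
Hypothesis Hc : forall t x, H (t, clamp l x) = H (t, x).
Hypothesis Vc : forall t x, V (t, clamp l x) = V (t, x).
Hypothesis wH : weak_conservation_law (Om T l) H (fun p => H p * V p).
Hypothesis wV : weak_conservation_law (Om T l) V (fun p => V p ^+ 2 / 2 + g * H p).
Hypothesis left : forall t, 0 <= t -> t <= T -> H (t, 0) * V (t, 0) = Hs * Vs.
Hypothesis right : forall t, 0 <= t -> t <= T -> 0 < H (t, l) ->
  V (t, l) = S t + 2 * Num.sqrt (g * H (t, l)) + Vs - 2 * cs.

Definition rof t x := rinv (H (t, x)) (V (t, x)).
Definition sof t x := sinv (H (t, x)) (V (t, x)).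

Let kap := cs / 2.
Let csp : 0 < cs. Proof. by rewrite sqrtr_gt0 mulr_gt0. Qed.
Let kap0 : 0 < kap. Proof. by rewrite divr_gt0. Qed.

(** A Lipschitz constant for the invariants, as sqrt(g H) >= kap near
    equilibrium. *)
Definition Linv := LU * (1 + 2 * g / kap).

Lemma Linv_ge0 : 0 <= Linv.
Proof.
apply: mulr_ge0 => //; apply: addr_ge0 => //; apply: divr_ge0; last exact: ltW.
by rewrite mulr_ge0// ltW.
Qed.

Let sqrtE t x : Num.sqrt (g * H (t, x)) = celerity (rof t x) (sof t x).
Proof. by rewrite celerity_inv. Qed.

Definition near_eq t x := `|rof t x| <= eta /\ `|sof t x| <= eta.

Let sqrt_ge t x : near_eq t x -> kap <= Num.sqrt (g * H (t, x)).
Proof. by move=> [h1 h2]; rewrite sqrtE (celerity_ge Vs0 a0 etaa). Qed.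

Let gH_gt0 t x : near_eq t x -> 0 < g * H (t, x).
Proof. by move=> /sqrt_ge h; rewrite -sqrtr_gt0; exact: lt_le_trans h. Qed.

Let H_gt0 t x : near_eq t x -> 0 < H (t, x).
Proof. by move=> /gH_gt0; rewrite pmulr_rgt0. Qed.

Let gH_ge t x : near_eq t x -> kap ^+ 2 <= g * H (t, x).
Proof.
move=> h; rewrite -(sqr_sqrtr (ltW (gH_gt0 h))) !expr2.
by apply: ler_pM; rewrite ?(ltW kap0)//; exact: sqrt_ge.
Qed.

Lemma inv_near t x t' x' : near_eq t x ->
  `|rof t x - rof t' x'| <= Linv * (`|t - t'| + `|x - x'|) /\
  `|sof t x - sof t' x'| <= Linv * (`|t - t'| + `|x - x'|).
Proof.
move=> h; set d := `|t - t'| + `|x - x'|.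
have d0 : 0 <= d by exact: addr_ge0.
have hH : `|H (t, x) - H (t', x')| <= LU * d := HL (t, x) (t', x').
have hV : `|V (t, x) - V (t', x')| <= LU * d := VL (t, x) (t', x').
have hq : `|Num.sqrt (g * H (t, x)) - Num.sqrt (g * H (t', x'))| <= g * (LU * d) / kap.
  apply: le_trans (sqrt_near _ kap0 (gH_ge h)) _.
  apply: ler_wpM2r; first by rewrite invr_ge0 ltW.
  by rewrite -mulrBr normrM (gtr0_norm g0); apply: ler_wpM2l => //; exact: ltW.
have E : Linv * d = LU * d + 2 * (g * (LU * d) / kap) by rewrite /Linv; ring.
rewrite E /rof /sof /rinv /sinv.
set q := Num.sqrt (g * H (t, x)) in hq *; set q' := Num.sqrt (g * H (t', x')) in hq *.
have hq2 : `|2 * (q - q')| <= 2 * (g * (LU * d) / kap).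
  by rewrite normrM ger0_norm//; exact: ler_wpM2l.
split.
  have -> : V (t, x) - Vs + 2 * (q - cs) - (V (t', x') - Vs + 2 * (q' - cs))
    = (V (t, x) - V (t', x')) + 2 * (q - q') by ring.
  by apply: le_trans (ler_normD _ _) _; exact: lerD.
have -> : V (t, x) - Vs - 2 * (q - cs) - (V (t', x') - Vs - 2 * (q' - cs))
  = (V (t, x) - V (t', x')) - 2 * (q - q') by ring.
by apply: le_trans (ler_normB _ _) _; exact: lerD.
Qed.

Let Lam0 : 0 < Lam. Proof. by rewrite !addr_gt0. Qed.

(** The two linearised invariants at the state of the starting point, with a =
    sqrt(g / H) and a = - sqrt(g / H), differ from the invariants by quadratic
    terms. *)
Lemma char_near : exists2 C, 0 <= C & forall t h x k, 0 <= t -> 0 <= h -> t + h <= T ->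
  `|k| <= Lam -> 0 <= x -> x <= l -> near_eq t x ->
  (0 <= x + k * h -> x + k * h <= l -> near_eq (t + h) (x + k * h) ->
    `|rof (t + h) (x + k * h) - rof t x| <= C * (h + `|lam (rof t x) (sof t x) - k|) * h) /\
  (0 <= x - k * h -> x - k * h <= l -> near_eq (t + h) (x - k * h) ->
    `|sof (t + h) (x - k * h) - sof t x| <= C * (h + `|mu (rof t x) (sof t x) - k|) * h).
Proof.
have M0 : 0 <= g / kap + Lam by rewrite addr_ge0// ?divr_ge0// ltW.
have [C C0 HC] := weak_transport_closed T0 l0 LU0 M0 HL VL wH wV.
pose B := (Linv * (1 + Lam)) ^+ 2 / kap.
have B0 : 0 <= B by rewrite divr_ge0 ?sqr_ge0// ltW.
exists (C + B); first exact: addr_ge0.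
have L'0 := Linv_ge0.
(* both invariants at once, for the sign [e]; the remainder is (sqrt(g H1) -
   sqrt(g H))^2 / sqrt(g H) *)
have key t h x (e c : R) : e ^+ 2 = 1 -> 0 <= t -> 0 <= h -> t + h <= T ->
    `|c| <= Lam -> 0 <= x -> x <= l -> near_eq t x ->
    0 <= x + c * h -> x + c * h <= l -> near_eq (t + h) (x + c * h) ->
    `|V (t + h, x + c * h) - V (t, x)
      + 2 * e * (Num.sqrt (g * H (t + h, x + c * h)) - Num.sqrt (g * H (t, x)))|
    <= (C + B) * (h + `|V (t, x) + e * Num.sqrt (g * H (t, x)) - c|) * h.
  move=> e2 t0 h0 hT cL x0 xl n0 y0 yl n1.
  set y := x + c * h in y0 yl n1 *.
  set q := Num.sqrt (g * H (t, x)); set q1 := Num.sqrt (g * H (t + h, y)).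
  have q0 : 0 < q by rewrite sqrtr_gt0 gH_gt0.
  have qk : kap <= q by exact: sqrt_ge.
  have q2 : q ^+ 2 = g * H (t, x) by rewrite sqr_sqrtr// ltW// gH_gt0.
  have q12 : q1 ^+ 2 = g * H (t + h, y) by rewrite sqr_sqrtr// ltW// gH_gt0.
  have e1 : `|e| = 1.
    by apply/eqP; rewrite -(@eqrXn2 _ 2)// -normrX e2 normr1 expr1n.
  pose A := e * (g / q).
  have AH : A ^+ 2 * H (t, x) = g.
    have -> : H (t, x) = q ^+ 2 / g by rewrite q2 mulrC mulKf// gt_eqF.
    by rewrite /A exprMn e2; field; rewrite !gt_eqF.
  have AM : `|A| <= g / kap + Lam.
    rewrite /A normrM e1 mul1r gtr0_norm ?divr_gt0//.
    apply: le_trans (_ : g / kap <= _); last by rewrite lerDl ltW.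
    by apply: ler_wpM2l; [exact: ltW|rewrite lef_pV2 ?posrE].
  have cM : `|c| <= g / kap + Lam.
    by apply: le_trans cL _; rewrite lerDr divr_ge0// ltW.
  have th : t <= t + h by rewrite lerDl.
  have hE : t + h - t = h by rewrite addrAC subrr add0r.
  have := HC A (H (t, x)) (V (t, x)) c t (t + h) x AH AM cM t0 th hT x0 xl.
  rewrite hE -/y => /(_ y0 yl); rewrite !subrr normr0 !add0r.
  have -> : V (t, x) + A * H (t, x) - c = V (t, x) + e * q - c.
    congr (_ + _ - _); rewrite /A -mulrA; congr (_ * _).
    by apply: (mulIf (lt0r_neq0 q0)); rewrite -expr2 q2; field; rewrite gt_eqF.
  have -> : A * (H (t + h, y) - H (t, x)) + (V (t + h, y) - V (t, x)) =
      (V (t + h, y) - V (t, x) + 2 * e * (q1 - q)) + e * ((q1 - q) ^+ 2 / q).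
    have -> : H (t + h, y) = q1 ^+ 2 / g by rewrite q12 mulrC mulKf// gt_eqF.
    have -> : H (t, x) = q ^+ 2 / g by rewrite q2 mulrC mulKf// gt_eqF.
    by rewrite /A; field; rewrite !gt_eqF.
  set X := V (t + h, y) - V (t, x) + _; set Z := `|V (t, x) + _ - _|.
  have qq : `|q1 - q| <= Linv * (1 + Lam) * h.
    have [nr ns] := inv_near (t + h) y n0.
    have -> : q1 - q = ((rof (t + h) y - rof t x) - (sof (t + h) y - sof t x)) / 4.
      by rewrite /q1 /q !sqrtE /celerity; field.
    have dd : `|t - (t + h)| + `|x - y| <= (1 + Lam) * h.
      rewrite mulrDl mul1r; apply: lerD.
        by rewrite distrC hE ger0_norm.
      rewrite distrC /y addrAC subrr add0r normrM (ger0_norm h0).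
      exact: ler_wpM2r.
    have dL : Linv * (`|t - (t + h)| + `|x - y|) <= Linv * (1 + Lam) * h.
      by rewrite -mulrA; exact: ler_wpM2l.
    have nr' := le_trans nr dL; have ns' := le_trans ns dL.
    rewrite distrC in nr'; rewrite distrC in ns'.
    have := ler_normB (rof (t + h) y - rof t x) (sof (t + h) y - sof t x) => nB.
    have h4 := le_trans nB (lerD nr' ns').
    rewrite normrM [`|4^-1|]ger0_norm ?invr_ge0// ler_pdivrMr//.
    apply: le_trans h4 _.
    have : 0 <= Linv * (1 + Lam) * h by apply: le_trans ns'.
    by generalize (Linv * (1 + Lam) * h) => u; lra.
  have rem : `|e * ((q1 - q) ^+ 2 / q)| <= B * h * h.
    rewrite normrM e1 mul1r normrM normfV (gtr0_norm q0) normrX.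
    have -> : B * h * h = (Linv * (1 + Lam) * h) ^+ 2 / kap by rewrite /B; ring.
    apply: ler_pM => //.
    - by rewrite invr_ge0 ltW.
    - rewrite !expr2; exact: ler_pM.
    - by rewrite lef_pV2 ?posrE.
  move=> main.
  rewrite -[X](addrK (e * ((q1 - q) ^+ 2 / q))); apply: le_trans (ler_normB _ _) _.
  apply: le_trans (lerD main rem) _.
  have -> : (C + B) * (h + Z) * h = C * (h + Z) * h + B * h * h + B * Z * h by ring.
  by rewrite lerDl; apply: mulr_ge0 => //; apply: mulr_ge0 => //; exact: normr_ge0.
move=> t h x k t0 h0 hT kL x0 xl n0; have [nr ns] := n0.
have [lamE muE] := speedsE g Hs Vs nr ns.
have vE : velocity (rof t x) (sof t x) = V (t, x) by rewrite velocity_inv.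
rewrite vE -sqrtE in lamE muE.
split=> y0 yl n1.
  have := key t h x 1 k (expr1n _ _) t0 h0 hT kL x0 xl n0 y0 yl n1.
  rewrite mul1r -lamE mulr1.
  have -> : rof (t + h) (x + k * h) - rof t x =
    V (t + h, x + k * h) - V (t, x) + 2 * (Num.sqrt (g * H (t + h, x + k * h)) - Num.sqrt (g * H (t, x))).
    by rewrite /rof /rinv; ring.
  exact.
have kL' : `|- k| <= Lam by rewrite normrN.
have sq1 : (-1) ^+ 2 = 1 :> R by rewrite sqrrN expr1n.
rewrite -mulNr in y0 yl n1 *.
have := key t h x (-1) (- k) sq1 t0 h0 hT kL' x0 xl n0 y0 yl n1.
have -> : V (t, x) + -1 * Num.sqrt (g * H (t, x)) - - k = - (mu (rof t x) (sof t x) - k).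
  by rewrite opprD muE; ring.
rewrite normrN.
have -> : sof (t + h) (x + - k * h) - sof t x =
  V (t + h, x + - k * h) - V (t, x) + 2 * -1 * (Num.sqrt (g * H (t + h, x + - k * h)) - Num.sqrt (g * H (t, x))).
  by rewrite /sof /sinv; ring.
exact.
Qed.

(** A solution that is within [m] < [eta] of the equilibrium at time [ta]
    remains within [eta] for a time that depends on its Lipschitz constant
    only, and is a characteristic solution meanwhile. *)
Lemma window_csol : exists2 C, 0 <= C & forall m ta tb, 0 <= ta -> ta <= tb -> tb <= T ->
  m <= eta -> (forall x, `|rof ta x| <= m /\ `|sof ta x| <= m) ->
  Linv * (tb - ta) <= eta - m ->
  csol l Lam lam mu phi S ta tb Linv Linv C eta rof sof.
Proof.
have [C C0 HC] := char_near; exists C => // m ta tb ta0 tab tbT meta start small.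
have near t x : ta <= t -> t <= tb -> near_eq t x.
  move=> t1 t2; have [r1 s1] := start x.
  have n0 : near_eq ta x by split; [exact: le_trans r1 meta|exact: le_trans s1 meta].
  have [dr ds] := inv_near t x n0.
  have st : Linv * (`|ta - t| + `|x - x|) <= eta - m.
    apply: le_trans small; apply: ler_wpM2l; first exact: Linv_ge0.
    by rewrite subrr normr0 addr0 distrC ger0_norm ?subr_ge0// lerD2r.
  split.
    rewrite -(subKr (rof ta x) (rof t x)); apply: le_trans (ler_normB _ _) _.
    by apply: le_trans (lerD r1 (le_trans dr st)) _; rewrite addrC subrK.
  rewrite -(subKr (sof ta x) (sof t x)); apply: le_trans (ler_normB _ _) _.
  by apply: le_trans (lerD s1 (le_trans ds st)) _; rewrite addrC subrK.
have t_in t : ta <= t -> t <= tb -> 0 <= t /\ t <= T.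
  by move=> t1 t2; split; [exact: le_trans t1|exact: le_trans tbT].
split.
- by move=> t x _ _; rewrite /rof Hc Vc.
- by move=> t x _ _; rewrite /sof Hc Vc.
- move=> t t1 t2 x y; have [+ _] := inv_near t y (near t x t1 t2).
  by rewrite subrr normr0 add0r.
- move=> t t1 t2 x y; have [_ +] := inv_near t y (near t x t1 t2).
  by rewrite subrr normr0 add0r.
- move=> t t' x t1 t2 _ _; have [+ _] := inv_near t' x (near t x t1 t2).
  by rewrite subrr normr0 addr0.
- move=> t t' x t1 t2 _ _; have [_ +] := inv_near t' x (near t x t1 t2).
  by rewrite subrr normr0 addr0.
- by move=> t x t1 t2; have [] := near t x t1 t2.
- by move=> t x t1 t2; have [] := near t x t1 t2.
- move=> t t1 t2; have [t0 tT] := t_in t t1 t2.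
  have n0 := near t 0 t1 t2; have [nr ns] := n0.
  apply/(inflow_phi Vs0 a0 eta0 etaV etaa nr ns).
  by have [_] := inflow_inv Vs g0 Hs0 (V (t, 0)) (ltW (H_gt0 n0)); apply; exact: left.
- move=> t t1 t2; have [t0 tT] := t_in t t1 t2.
  have n0 := near t l t1 t2.
  by rewrite /sof /sinv (right t0 tT (H_gt0 n0)); ring.
- move=> t h x k t1 h0 t2 kL x0 xl y0 yl.
  have t3 : t <= tb by apply: le_trans t2; rewrite lerDl.
  have t4 : ta <= t + h by apply: le_trans t1 _; rewrite lerDl.
  have [t0 _] := t_in t t1 t3.
  have [+ _] := HC t h x k t0 h0 (le_trans t2 tbT) kL x0 xl (near t x t1 t3).
  by apply=> //; exact: near.
- move=> t h x k t1 h0 t2 kL x0 xl y0 yl.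
  have t3 : t <= tb by apply: le_trans t2; rewrite lerDl.
  have t4 : ta <= t + h by apply: le_trans t1 _; rewrite lerDl.
  have [t0 _] := t_in t t1 t3.
  have [_ +] := HC t h x k t0 h0 (le_trans t2 tbT) kL x0 xl (near t x t1 t3).
  by apply=> //; exact: near.
Qed.
End window.

(** * Uniqueness for the closed loop *)

Section uniqueness_sv.
Context {R : realType}.
Variables (g Hs Vs a eta l K gamma : R).
Hypotheses (g0 : 0 < g) (Hs0 : 0 < Hs) (Vs0 : 0 < Vs) (a0 : 0 < a) (eta0 : 0 < eta).
Hypotheses (l0 : 0 < l) (K0 : 0 < K) (gamma0 : 0 < gamma) (gamma1 : gamma < 1).
Local Notation cs := (Num.sqrt (g * Hs)).
Hypotheses (etaV : eta < Vs) (etaa : a + eta <= cs - Vs).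
Local Notation Lam := (Vs + cs + eta).
Local Notation lam := (lam g Hs Vs eta).
Local Notation mu := (mu g Hs Vs eta).
Local Notation phi := (phi g Hs Vs eta).
Local Notation celerity := (celerity g Hs).
Local Notation velocity := (velocity Vs).
Local Notation depth := (depth g Hs).
Local Notation rinv := (rinv g Hs Vs).
Local Notation sinv := (sinv g Hs Vs).
Local Notation ctrl := (boundary_control K gamma).

Lemma glip_clamp T (u : R * R -> R) : 0 <= T -> [lipschitz u p | p in `[0, T] `*` `[0, l]] ->
  exists2 L, 0 <= L & glip L (fun p => u (clamp T p.1, clamp l p.2)).
Proof.
move=> T0 [M [Mr H]]; exists (`|M| + 1); first by rewrite addr_ge0.
have /H k : M < `|M| + 1 by rewrite (le_lt_trans (ler_norm M))// ltrDl.
move=> [t x] [t' x'] /=.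
have i s y : (`[0, T] `*` `[0, l])%classic (clamp T s, clamp l y).
  by split; rewrite /= clamp_in// ltW.
apply: le_trans (k ((clamp T t, clamp l x), (clamp T t', clamp l x')) _) _; first by split; exact: i.
apply: ler_wpM2l; first by rewrite addr_ge0.
rewrite [leLHS]/Num.norm/= ge_max; apply/andP; split.
  by apply: le_trans (clamp_lip _ _ _) _; rewrite lerDl.
by apply: le_trans (clamp_lip _ _ _) _; rewrite lerDr.
Qed.

Lemma csol_weaken S ta tb ta' tb' L L' Lt Lt' C C' m m' r s :
  csol l Lam lam mu phi S ta tb L Lt C m r s ->
  ta <= ta' -> tb' <= tb -> L <= L' -> Lt <= Lt' -> C <= C' -> m <= m' ->
  csol l Lam lam mu phi S ta' tb' L' Lt' C' m' r s.
Proof.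
move=> [h1 h2 h3 h4 h5 h6 h7 h8 h9 h10 h11 h12] ha hb hL hLt hC hm.
have lo t : ta' <= t -> ta <= t by exact: le_trans.
have hi t : t <= tb' -> t <= tb by move=> /le_trans; apply.
split.
- by move=> t x /lo ? /hi ?; exact: h1.
- by move=> t x /lo ? /hi ?; exact: h2.
- by move=> t /lo ? /hi ? x y; apply: le_trans (h3 _ _ _ x y) _ => //; exact: ler_wpM2r.
- by move=> t /lo ? /hi ? x y; apply: le_trans (h4 _ _ _ x y) _ => //; exact: ler_wpM2r.
- move=> t t' x /lo ? /hi ? /lo ? /hi ?; apply: le_trans (h5 t t' x _ _ _ _) _ => //.
  exact: ler_wpM2r.
- move=> t t' x /lo ? /hi ? /lo ? /hi ?; apply: le_trans (h6 t t' x _ _ _ _) _ => //.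
  exact: ler_wpM2r.
- by move=> t x /lo ? /hi ?; apply: le_trans hm; exact: h7.
- by move=> t x /lo ? /hi ?; apply: le_trans hm; exact: h8.
- by move=> t /lo ? /hi ?; exact: h9.
- by move=> t /lo ? /hi ?; exact: h10.
- move=> t h x k /lo ? h0 /hi ? ? ? ? ? ?; apply: le_trans (h11 t h x k _ _ _ _ _ _ _ _) _ => //.
  by apply: ler_wpM2r => //; apply: ler_wpM2r => //; exact: addr_ge0.
- move=> t h x k /lo ? h0 /hi ? ? ? ? ? ?; apply: le_trans (h12 t h x k _ _ _ _ _ _ _ _) _ => //.
  by apply: ler_wpM2r => //; apply: ler_wpM2r => //; exact: addr_ge0.
Qed.

(** Step by step: as long as it agrees with the characteristic solution (r, s),
    an arbitrary solution is within [m] of the equilibrium, so that it is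
    characteristic for a further time [th], the same at each step, during which
    it agrees with (r, s) by uniqueness. *)
Lemma closed_loop_unique (T L Lt C m v0 : R) (H0 V0 : R -> R) (r s : R -> R -> R) H V :
  0 < T -> 0 <= L -> 0 <= Lt -> 0 <= C -> m < eta ->
  csol l Lam lam mu phi (ctrl v0) 0 T L Lt C m r s ->
  (forall x : R, x \in `[0, l] ->
     [/\ 0 <= H0 x, r 0 x = rinv (H0 x) (V0 x) & s 0 x = sinv (H0 x) (V0 x)]) ->
  v0 = sinv (H0 l) (V0 l) ->
  closed_loop_solution g l K gamma Hs Vs H0 V0 T H V ->
  forall t x, 0 <= t -> t <= T -> 0 <= x -> x <= l ->
    H (t, x) = depth (r t x) (s t x) /\ V (t, x) = velocity (r t x) (s t x).
Proof.
move=> T0 L0 Lt0 C0 meta w init v0E sol.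
have [L1 L10 HL1] := glip_clamp (ltW T0) (cls_lip_H sol).
have [L2 L20 VL2] := glip_clamp (ltW T0) (cls_lip_V sol).
pose Hc p := H (clamp T p.1, clamp l p.2); pose Vc p := V (clamp T p.1, clamp l p.2).
pose LU := L1 + L2; have LU0 : 0 <= LU by exact: addr_ge0.
have HL : glip LU Hc by apply: glipW HL1; rewrite lerDl.
have VL : glip LU Vc by apply: glipW VL2; rewrite lerDr.
have Hcc t x : Hc (t, clamp l x) = Hc (t, x) by rewrite /Hc /= clampK// ltW.
have Vcc t x : Vc (t, clamp l x) = Vc (t, x) by rewrite /Vc /= clampK// ltW.
have in_id p : Om T l p -> (clamp T p.1, clamp l p.2) = p.
  case: p => t x [/=]; rewrite !in_itv/= => /andP[t0 tT] /andP[x0 xl].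
  by rewrite !clamp_id// ltW.
have wH : weak_conservation_law (Om T l) Hc (fun p => Hc p * Vc p).
  apply: weak_law_ext (cls_mass sol) => p pO; by rewrite /Hc /Vc in_id.
have wV : weak_conservation_law (Om T l) Vc (fun p => Vc p ^+ 2 / 2 + g * Hc p).
  apply: weak_law_ext (cls_momentum sol) => p pO; by rewrite /Hc /Vc in_id.
have c0 : clamp l 0 = 0 by rewrite clamp_id// ltW.
have cl : clamp l l = l by rewrite clamp_id// ltW.
have tin t : 0 <= t -> t <= T -> t \in `[0, T] by move=> t0 tT; rewrite in_itv/= t0.
have left t : 0 <= t -> t <= T -> Hc (t, 0) * Vc (t, 0) = Hs * Vs.
  by move=> t0 tT; rewrite /Hc /Vc /= c0 (clamp_id t0 tT); exact: (cls_left sol (tin t t0 tT)).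
have right t : 0 <= t -> t <= T -> 0 < Hc (t, l) ->
    Vc (t, l) = ctrl v0 t + 2 * Num.sqrt (g * Hc (t, l)) + Vs - 2 * cs.
  move=> t0 tT; rewrite /Hc /Vc /= cl (clamp_id t0 tT) => Hp.
  have [v vs /(_ t (tin t t0 tT)) fb] := cls_feedback sol.
  have E : V0 l - 2 * Num.sqrt (g * H0 l) - Vs + 2 * cs = v0 by rewrite v0E /sinv; ring.
  rewrite E in vs; have vE := control_state_unique K0 gamma0 gamma1 (ltW T0) vs t0 tT.
  move/(mulfI (lt0r_neq0 Hp)): fb => ->; rewrite vE.
  by rewrite /boundary_control (max_idPr t0).
pose r' := rof g Hs Vs Hc Vc; pose s' := sof g Hs Vs Hc Vc.
have [C' C'0 win] := window_csol g0 Hs0 Vs0 a0 eta0 etaV etaa l0 T0 LU0 HL VL Hcc Vcc wH wV left right.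
set L' := Linv g Hs LU in win; have L'0 : 0 <= L' by exact: Linv_ge0.
pose sg := K * `|v0| `^ gamma.
have W : wave_system l a Lam sg lam mu phi (ctrl v0).
  exact: control_system.
have sg0 : 0 <= sg := ws_sg W.
pose Lb := L + L' + sg / a.
have Lb1 : L <= Lb by rewrite /Lb -addrA lerDl addr_ge0// divr_ge0// ltW.
have Lb2 : L' <= Lb by rewrite /Lb [L + L']addrC -addrA lerDl addr_ge0// divr_ge0// ltW.
have Lb3 : sg <= a * Lb.
  rewrite mulrC -ler_pdivrMr// /Lb lerDr; exact: addr_ge0.
have Lb0 : 0 <= Lb by exact: le_trans Lb1.
pose th := (eta - m) / (L' + 1).
have L'1 : 0 < L' + 1 by rewrite ltr_pwDr.
have th0 : 0 < th by rewrite divr_gt0// subr_gt0.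
have claim n t : 0 <= t -> t <= T -> t <= n%:R * th ->
    forall x, r' t x = r t x /\ s' t x = s t x.
  elim: n t => [|n IH] t t0 tT tn.
    have -> : t = 0 by apply/eqP; rewrite eq_le t0 andbT; rewrite mul0r in tn.
    move=> x; have xl : clamp l x \in `[0, l] by apply: clamp_in; exact: ltW.
    have [_ rE sE] := init _ xl.
    rewrite -(cs_rc w x (lexx 0) (ltW T0)) -(cs_sc w x (lexx 0) (ltW T0)) rE sE.
    rewrite /r' /s' /rof /sof /Hc /Vc /=.
    rewrite clamp_id ?(ltW T0)//.
    by rewrite (cls_init_H sol xl) (cls_init_V sol xl).
  have [|nt] := leP t (n%:R * th); first exact: IH.
  set ta := n%:R * th in nt.
  have ta0 : 0 <= ta by rewrite mulr_ge0// ltW.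
  have taT : ta <= T by apply: ltW; exact: lt_le_trans tT.
  have eqa := IH ta ta0 taT (lexx _).
  have start x : `|r' ta x| <= m /\ `|s' ta x| <= m.
    have [-> ->] := eqa x.
    by split; [exact: cs_rm w _ _ ta0 taT|exact: cs_sm w _ _ ta0 taT].
  have small : L' * (t - ta) <= eta - m.
    have tth : t - ta <= th.
      by rewrite lerBlDr addrC /ta; move: tn; rewrite -natr1 mulrDl mul1r.
    apply: le_trans (_ : L' * th <= _); first exact: ler_wpM2l.
    rewrite /th mulrCA ler_piMr ?subr_ge0 ?(ltW meta)//.
    by rewrite ler_pdivrMr// mul1r lerDl.
  have w' := win m ta t ta0 (ltW nt) tT (ltW meta) start small.
  have w1 : csol l Lam lam mu phi (ctrl v0) ta t Lb (Lt + L') (C + C') eta r' s'.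
    apply: csol_weaken w' _ _ _ _ _ _ => //; rewrite ?lerDr//.
  have w2 : csol l Lam lam mu phi (ctrl v0) ta t Lb (Lt + L') (C + C') eta r s.
    by apply: csol_weaken w _ _ _ _ _ _ => //; rewrite ?lerDl// ltW.
  move=> x; apply: (csol_unique W w1 w2) => //; rewrite ?addr_ge0//.
  - by move=> y; have [] := eqa y.
  - by move=> y; have [] := eqa y.
  - exact: ltW.
move=> t x t0 tT x0 xl.
have [n n0 nT] := exists_inv_le T th0.
rewrite ler_pdivrMr ?ltr0n// mulrC in nT.
have [rE sE] := claim n t t0 tT (le_trans tT nT) x.
have HE : H (t, x) = Hc (t, x) by rewrite /Hc /= !clamp_id.
have VE : V (t, x) = Vc (t, x) by rewrite /Vc /= !clamp_id.
rewrite HE VE -rE -sE; split; last by rewrite /r' /s' /rof /sof velocity_inv.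
rewrite /r' /s' /rof /sof depth_inv//.
have rn : `|r' t x| <= eta by rewrite rE; apply: le_trans (ltW meta); exact: cs_rm w _ _ t0 tT.
have sn : `|s' t x| <= eta by rewrite sE; apply: le_trans (ltW meta); exact: cs_sm w _ _ t0 tT.
have := celerity_gt0 Vs0 a0 eta0 etaa rn sn.
by rewrite /r' /s' /rof /sof celerity_inv sqrtr_gt0 pmulr_rgt0// => /ltW.
Qed.
End uniqueness_sv.

(** * Small data, finite-time rest and stability *)

Section main.
Context {R : realType}.
Variables (g l K gamma Hs Vs c : R).
Hypotheses (g0 : 0 < g) (l0 : 0 < l) (K0 : 0 < K) (gamma0 : 0 < gamma) (gamma1 : gamma < 1).
Hypotheses (Hs0 : 0 < Hs) (Vs0 : 0 < Vs) (c0 : 0 < c).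
Local Notation cs := (Num.sqrt (g * Hs)).
Hypothesis subcritical : 2 * c < cs - Vs.

Let a := 2 * c.
(** Both speeds are at least 2 c, rather than c, within this distance of the
    equilibrium: the crossing times are then half of what the theorem allows,
    and what is left is available for the extinction time of the control. *)
Definition radius := Num.min Vs (cs - Vs - 2 * c) / 2.
Local Notation eta := radius.

Let a0 : 0 < a. Proof. by rewrite mulr_gt0. Qed.
Let gap : 0 < cs - Vs - 2 * c. Proof. by rewrite subr_gt0. Qed.
Let eta0 : 0 < eta. Proof. by rewrite divr_gt0// lt_min Vs0 gap. Qed.
Let etaV : eta < Vs.
Proof.
have : Num.min Vs (cs - Vs - 2 * c) <= Vs by rewrite ge_min lexx.
by move: Vs0; rewrite /radius; lra.
Qed.
Let etaa : a + eta <= cs - Vs.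
Proof.
have : Num.min Vs (cs - Vs - 2 * c) <= cs - Vs - 2 * c by rewrite ge_min lexx orbT.
by move: gap; rewrite /radius /a; lra.
Qed.
Let csp : 0 < cs. Proof. by rewrite sqrtr_gt0 mulr_gt0. Qed.

Local Notation Lam := (Vs + cs + eta).
Local Notation lam := (lam g Hs Vs eta).
Local Notation mu := (mu g Hs Vs eta).
Local Notation phi := (phi g Hs Vs eta).
Local Notation celerity := (celerity g Hs).
Local Notation velocity := (velocity Vs).
Local Notation depth := (depth g Hs).
Local Notation rinv := (rinv g Hs Vs).
Local Notation sinv := (sinv g Hs Vs).
Local Notation ctrl := (boundary_control K gamma).

Let Lam0 : 0 < Lam. Proof. by rewrite !addr_gt0. Qed.

(** Initial slope for the scheme, when the invariants and their slopes are
    bounded by [m]: the second term dominates the slope K m^gamma of the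
    control in time. *)
Definition slope m := m + K * m `^ gamma / a.
(** Invariants of data within [d] of the equilibrium are within [ratio * d] of
    0. *)
Definition ratio := 1 + 4 * g / cs.

Let ratio1 : 1 <= ratio.
Proof. by rewrite /ratio lerDl divr_ge0 ?mulr_ge0// ltW. Qed.
Let ratio0 : 0 < ratio. Proof. exact: lt_le_trans ratio1. Qed.

Lemma slope_ge m : m <= slope m.
Proof. by rewrite /slope lerDl divr_ge0 ?mulr_ge0 ?powR_ge0// ltW. Qed.

Lemma slope_small e : 0 < e -> exists2 m1, 0 < m1 & forall m, 0 <= m -> m <= m1 ->
  [/\ m <= e, m `^ (1 - gamma) <= e & slope m <= e].
Proof.
move=> e0; have e2 : 0 < e / 2 by rewrite divr_gt0.
have [m1 m10 h1] := powR_small (p := 1 - gamma) (e := e) ltac:(by rewrite subr_gt0) e0.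
have Ka : 0 < e / 2 * (a / K) by rewrite mulr_gt0// divr_gt0.
have [m2 m20 h2] := powR_small gamma0 Ka.
exists (Num.min (e / 2) (Num.min m1 m2)); first by rewrite !lt_min e2 m10.
move=> m m0; rewrite !le_min => /andP[me /andP[mm1 mm2]].
have me' : m <= e by lra.
split=> //; first exact: h1.
rewrite /slope; have : K * m `^ gamma / a <= e / 2.
  rewrite ler_pdivrMr// mulrC -ler_pdivlMr// -mulrA; exact: h2.
lra.
Qed.

Definition tstep := l / (2 * Lam).

(** The extinction time of the control is at most l / c, and the lifetime of
    the slope bound covers the time of two crossings after it. *)
Record small_data m : Prop := {
  sd_gt0 : 0 < m;
  sd_eta : m < eta;
  sd_depth : m <= Hs / 2;
  sd_time : m `^ (1 - gamma) / ((1 - gamma) * K) <= l / c;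
  sd_slope : 4 * slope m * (l / c + 2 * l / a + 2 * tstep) <= 1 }.

Lemma small_dataP e : 0 < e -> exists2 m1, 0 < m1 & forall m, 0 < m -> m <= m1 ->
  small_data m /\ slope m <= e.
Proof.
move=> e0.
have q0 : 0 < (1 - gamma) * K by rewrite mulr_gt0// subr_gt0.
pose D := l / c + 2 * l / a + 2 * tstep.
have D0 : 0 < D.
  have ts : 0 < tstep by rewrite divr_gt0// mulr_gt0.
  apply: addr_gt0; last by rewrite mulr_gt0.
  by apply: addr_gt0; rewrite divr_gt0// mulr_gt0.
pose e' := Num.min (Num.min e (eta / 2)) (Num.min (Hs / 2) (Num.min (l / c * ((1 - gamma) * K)) (4 * D)^-1)).
have e'0 : 0 < e'.
  have D4 : 0 < (4 * D)^-1 by rewrite invr_gt0 mulr_gt0.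
  have lcq : 0 < l / c * ((1 - gamma) * K) by rewrite mulr_gt0// divr_gt0.
  have e2 : 0 < eta / 2 by apply: divr_gt0.
  have H2 : 0 < Hs / 2 by apply: divr_gt0.
  by rewrite /e' !lt_min e0 D4 lcq e2 H2.
have [m1 m10 h] := slope_small e'0.
exists m1 => // m m0 mm1; have [me mp ms] := h m (ltW m0) mm1.
move: me mp ms; rewrite !le_min => /andP[/andP[_ me] /andP[mH _]].
move=> /andP[_ /andP[_ /andP[mt _]]] /andP[/andP[se _] /andP[_ /andP[_ sD]]].
split=> //; split=> //.
- by have := eta0; lra.
- by rewrite ler_pdivrMr.
- rewrite -/D (_ : 4 * slope m * D = (4 * D) * slope m); last by ring.
  by rewrite -ler_pdivlMl ?mulr1// mulr_gt0.
Qed.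

Definition r_init (H0 V0 : R -> R) x := rinv (H0 (clamp l x)) (V0 (clamp l x)).
Definition s_init (H0 V0 : R -> R) x := sinv (H0 (clamp l x)) (V0 (clamp l x)).

Record near_data d (H0 V0 : R -> R) : Prop := {
  nd_H : forall x, x \in `[0, l] -> `|H0 x - Hs| <= d;
  nd_V : forall x, x \in `[0, l] -> `|V0 x - Vs| <= d;
  nd_Hl : lip_itv d l H0;
  nd_Vl : lip_itv d l V0;
  nd_comp : H0 0 * V0 0 = Hs * Vs }.

(** [cs / 2] is the lower bound for sqrt(g H) that makes it a Lipschitz
    function of H. *)
Lemma near_depth m d H0 V0 : small_data m -> near_data d H0 V0 -> ratio * d = m ->
  forall x, x \in `[0, l] -> 0 <= H0 x /\ (cs / 2) ^+ 2 <= g * H0 x.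
Proof.
move=> sm nd dm x xl.
have d0 : 0 <= d by apply: le_trans (nd_H nd xl).
have d_m : d <= m by rewrite -dm ler_peMl.
have dH : Hs / 2 <= H0 x.
  have := nd_H nd xl; have := sd_depth sm; rewrite ler_norml => ? /andP[? _]; lra.
split; first by apply: le_trans dH; rewrite divr_ge0// ltW.
rewrite expr_div_n sqr_sqrtr ?mulr_ge0 ?(ltW g0) ?(ltW Hs0)// -mulrA.
apply: ler_wpM2l; first exact: ltW.
by apply: le_trans dH; rewrite expr2; move: Hs0; lra.
Qed.

Lemma init_bounds m d H0 V0 : small_data m -> near_data d H0 V0 -> ratio * d = m ->
  [/\ klip m (r_init H0 V0), klip m (s_init H0 V0),
      forall x, `|r_init H0 V0 x| <= m & forall x, `|s_init H0 V0 x| <= m].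
Proof.
move=> sm nd dm.
have k0 : 0 < cs / 2 by rewrite divr_gt0.
have cl x : clamp l x \in `[0, l] by apply: clamp_in; exact: ltW.
have dp x : (cs / 2) ^+ 2 <= g * H0 (clamp l x).
  by have [] := near_depth sm nd dm (cl x).
have d0 : 0 <= d by apply: le_trans (nd_H nd (cl 0)).
have sq x v : `|Num.sqrt (g * H0 (clamp l x)) - Num.sqrt (g * v)| <= g * `|H0 (clamp l x) - v| / (cs / 2).
  apply: le_trans (sqrt_near _ k0 (dp x)) _.
  by rewrite -mulrBr normrM (gtr0_norm g0).
have gc u w : 0 <= u -> w <= u -> g * w / (cs / 2) <= g * u / (cs / 2).
  by move=> u0 wu; apply: ler_wpM2r; [rewrite invr_ge0 ltW|apply: ler_wpM2l => //; exact: ltW].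
have E u : ratio * d * u = d * u + 2 * (g * (d * u) / (cs / 2)).
  by rewrite /ratio; field; rewrite gt_eqF.
have Hl x y : `|H0 (clamp l x) - H0 (clamp l y)| <= d * `|x - y|.
  apply: le_trans (nd_Hl nd (cl x) (cl y)) _; apply: ler_wpM2l => //; exact: clamp_lip.
have Vl x y : `|V0 (clamp l x) - V0 (clamp l y)| <= d * `|x - y|.
  apply: le_trans (nd_Vl nd (cl x) (cl y)) _; apply: ler_wpM2l => //; exact: clamp_lip.
have two (u v : R) : `|u| <= v -> `|2 * u| <= 2 * v.
  by move=> uv; rewrite normrM ger0_norm//; exact: ler_wpM2l.
have lipsq x y : `|2 * (Num.sqrt (g * H0 (clamp l x)) - Num.sqrt (g * H0 (clamp l y)))|
    <= 2 * (g * (d * `|x - y|) / (cs / 2)).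
  by apply: two; apply: le_trans (sq _ _) _; apply: gc => //; exact: mulr_ge0.
have bdsq x : `|2 * (Num.sqrt (g * H0 (clamp l x)) - cs)| <= 2 * (g * (d * 1) / (cs / 2)).
  apply: two; apply: le_trans (sq x Hs) _; apply: gc; rewrite mulr1//.
  exact: (nd_H nd (cl x)).
split.
- move=> x y; rewrite -dm E /r_init /rinv.
  set q := Num.sqrt (g * H0 (clamp l x)); set q' := Num.sqrt (g * H0 (clamp l y)).
  have -> : V0 (clamp l x) - Vs + 2 * (q - cs) - (V0 (clamp l y) - Vs + 2 * (q' - cs))
    = (V0 (clamp l x) - V0 (clamp l y)) + 2 * (q - q') by ring.
  by apply: le_trans (ler_normD _ _) _; apply: lerD; [exact: Vl|exact: lipsq].
- move=> x y; rewrite -dm E /s_init /sinv.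
  set q := Num.sqrt (g * H0 (clamp l x)); set q' := Num.sqrt (g * H0 (clamp l y)).
  have -> : V0 (clamp l x) - Vs - 2 * (q - cs) - (V0 (clamp l y) - Vs - 2 * (q' - cs))
    = (V0 (clamp l x) - V0 (clamp l y)) - 2 * (q - q') by ring.
  by apply: le_trans (ler_normB _ _) _; apply: lerD; [exact: Vl|exact: lipsq].
- move=> x; rewrite -dm -[ratio * d]mulr1 E /r_init /rinv.
  by apply: le_trans (ler_normD _ _) _; apply: lerD => //; rewrite mulr1; exact: (nd_V nd (cl x)).
- move=> x; rewrite -dm -[ratio * d]mulr1 E /s_init /sinv.
  by apply: le_trans (ler_normB _ _) _; apply: lerD => //; rewrite mulr1; exact: (nd_V nd (cl x)).
Qed.

Let clamp0l : clamp l 0 = 0. Proof. by rewrite clamp_id// ltW. Qed.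
Let clampll : clamp l l = l. Proof. by rewrite clamp_id// ltW. Qed.

(** Extinction takes place at t1 + 2 l / a, which is at most l / c + l / c. *)
Lemma invariants_exist m d H0 V0 : small_data m -> near_data d H0 V0 -> ratio * d = m ->
  let v0 := sinv (H0 l) (V0 l) in
  exists r s : R -> R -> R,
  [/\ forall x, x \in `[0, l] ->
        [/\ 0 <= H0 x, r 0 x = rinv (H0 x) (V0 x) & s 0 x = sinv (H0 x) (V0 x)],
      forall T, 0 <= T ->
        csol l Lam lam mu phi (ctrl v0) 0 T (2 * slope m) (2 * slope m * Lam)
          (2 * slope m * (1 + 2 * (2 * slope m * Lam))) m r s &
      forall t x, 2 * l / c <= t -> r t x = 0 /\ s t x = 0].
Proof.
move=> sm nd dm v0.
have [rk sk rm sm'] := init_bounds sm nd dm.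
have m0 := sd_gt0 sm.
have lc := ltW l0.
have W := control_system Vs0 a0 eta0 l0 K0 gamma0 gamma1 etaV etaa v0.
have v0m : `|v0| <= m.
  by have := sm' l; rewrite /s_init clampll.
have in0 : 0 \in `[0, l] by rewrite in_itv/= lexx.
have nb x : x \in `[0, l] -> `|rinv (H0 x) (V0 x)| <= eta /\ `|sinv (H0 x) (V0 x)| <= eta.
  rewrite in_itv/= => /andP[x0 xl].
  have := rm x; have := sm' x; rewrite /r_init /s_init clamp_id// => h1 h2.
  by split; apply: le_trans (ltW (sd_eta sm)).
have weak u : klip m u -> klip (slope m) u.
  by move=> uk x y; apply: le_trans (uk x y) _; apply: ler_wpM2r => //; exact: slope_ge.
have st0 : st l phi (ctrl v0) 0 (slope m) m (r_init H0 V0) (s_init H0 V0).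
  split => //.
  - by move=> x; rewrite /r_init clampK.
  - by move=> x; rewrite /s_init clampK.
  - exact: weak.
  - exact: weak.
  - rewrite /r_init /s_init clamp0l; have [n1 n2] := nb 0 in0.
    apply/(inflow_phi Vs0 a0 eta0 etaV etaa n1 n2).
    have [H00 _] := near_depth sm nd dm in0.
    by have [_] := inflow_inv Vs g0 Hs0 (V0 0) H00; apply; exact: nd_comp nd.
  - by rewrite /s_init clampll /boundary_control maxxx control0.
pose t1 := m `^ (1 - gamma) / ((1 - gamma) * K).
have q0 : 0 < (1 - gamma) * K by rewrite mulr_gt0// subr_gt0.
have t10 : 0 <= t1 by rewrite divr_ge0 ?powR_ge0// ltW.
have Sm t : `|ctrl v0 t| <= m.
  by apply: le_trans v0m; apply: control_le => //; rewrite le_max lexx.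
have S0 t : t1 <= t -> ctrl v0 t = 0.
  move=> tt; rewrite /boundary_control control_extinct// le_max; apply/orP; right.
  apply: le_trans tt; apply: ler_wpM2r; first by rewrite invr_ge0 ltW.
  by apply: ge0_ler_powR; rewrite ?nnegrE ?subr_ge0 ?(ltW gamma1) ?(ltW m0).
have st_gt0 : 0 < tstep by rewrite divr_gt0// mulr_gt0.
have LamH : Lam * (2 * tstep) <= l.
  by rewrite /tstep le_eqVlt; apply/orP; left; apply/eqP; field; rewrite gt_eqF.
have a2 : 2 * l / a = l / c by rewrite /a; field; rewrite gt_eqF.
have t1c : t1 <= l / c := sd_time sm.
have sp : 0 <= slope m by apply: le_trans (slope_ge m); exact: ltW.
have small : 4 * slope m * (t1 + 2 * l / a + 2 * tstep) <= 1.
  apply: le_trans (sd_slope sm); apply: ler_wpM2l; first exact: mulr_ge0.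
  by rewrite lerD2r lerD2r.
have sgL : K * `|v0| `^ gamma <= a * slope m.
  apply: le_trans (_ : K * m `^ gamma <= _).
    apply: ler_wpM2l; first exact: ltW.
    by apply: ge0_ler_powR; rewrite ?nnegrE ?(ltW gamma0) ?(ltW m0).
  rewrite /slope mulrDr mulrCA divff ?gt_eqF// mulr1 lerDr; exact: mulr_ge0 (ltW a0) (ltW m0).
have [r [s [init cs_ ext]]] := csol_exists W st0 Sm S0 t10 st_gt0 LamH small sgL.
exists r, s; split.
- move=> x xl; have [H0x _] := near_depth sm nd dm xl.
  have [-> ->] := init x; move: xl; rewrite in_itv/= => /andP[x0 xl].
  by rewrite /r_init /s_init clamp_id.
- exact: cs_.
- move=> t x tt; apply: ext; apply: le_trans tt; rewrite a2.
  have -> : 2 * l / c = l / c + l / c by ring.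
  by rewrite lerD2r.
Qed.

Lemma near_dataP d H0 V0 : is_Lip l H0 -> is_Lip l V0 -> H0 0 * V0 0 = Hs * Vs ->
  (Lip2_norm l (fun x => (H0 x - Hs)%R) (fun x => (V0 x - Vs)%R) < d%:E)%E ->
  near_data d H0 V0.
Proof.
have shift k M u : lip_itv M l (fun x => u x - k) <-> lip_itv M l u.
  by split=> h x y xl yl; have := h x y xl yl; rewrite opprB addrA subrK.
move=> /is_LipP[L1 L10 H1] /is_LipP[L2 L20 V1] comp; rewrite /Lip2_norm gt_max => /andP[h1 h2].
have [H2 H3] := Lip_norm_lt l0 L10 (proj2 (shift Hs _ _) H1) h1.
have [V2 V3] := Lip_norm_lt l0 L20 (proj2 (shift Vs _ _) V1) h2.
split => //; [exact: (proj1 (shift Hs _ _))|exact: (proj1 (shift Vs _ _))].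
Qed.

Definition amplification := 4 * cs / g + 2.

Let ampl_H : 0 <= 4 * cs / g.
Proof. by rewrite divr_ge0 ?mulr_ge0// ltW. Qed.

Lemma ampl_gt0 : 0 < amplification.
Proof. by rewrite /amplification ltr_wpDl. Qed.

Lemma state_near m r s : `|r| <= m -> `|s| <= m -> m <= eta ->
  `|depth r s - Hs| <= 4 * cs / g * m /\ `|velocity r s - Vs| <= m.
Proof.
move=> rm sm meta; have m0 : 0 <= m := le_trans (normr_ge0 _) rm.
have ec := cs_eta Vs0 a0 etaa.
split; last first.
  rewrite /velocity addrAC subrr add0r normrM [`|2^-1|]ger0_norm ?invr_ge0// ler_pdivrMr//.
  by apply: le_trans (ler_normD _ _) _; rewrite mulr_natr mulr2n; exact: lerD.
have q1 : `|celerity r s - cs| <= m.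
  rewrite /celerity addrAC subrr add0r normrM [`|4^-1|]ger0_norm ?invr_ge0// ler_pdivrMr//.
  apply: le_trans (ler_normB _ _) _; apply: le_trans (lerD rm sm) _; lra.
have q2 : `|celerity r s + cs| <= 4 * cs.
  have -> : celerity r s + cs = (celerity r s - cs) + 2 * cs by ring.
  apply: le_trans (ler_normD _ _) _; rewrite [`|2 * cs|]ger0_norm ?mulr_ge0 ?(ltW csp)//.
  by move: q1 csp meta ec; lra.
have -> : depth r s - Hs = (celerity r s - cs) * (celerity r s + cs) / g.
  rewrite /depth -subr_sqr mulrBl; congr (_ - _).
  by rewrite sqr_sqrtr ?mulr_ge0 ?(ltW g0) ?(ltW Hs0)// mulrC mulKf// gt_eqF.
rewrite !normrM normfV (gtr0_norm g0).
have -> : 4 * cs / g * m = m * (4 * cs) / g by ring.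
apply: ler_wpM2r; first by rewrite invr_ge0 ltW.
exact: ler_pM.
Qed.

Lemma state_lip L r s r' s' d : `|r| <= eta -> `|s| <= eta -> `|r'| <= eta -> `|s'| <= eta ->
  `|r - r'| <= 2 * L * d -> `|s - s'| <= 2 * L * d ->
  `|depth r s - depth r' s'| <= 4 * cs / g * L * d /\
  `|velocity r s - velocity r' s'| <= 2 * L * d.
Proof.
move=> re se re' se' rr ss; have ec := cs_eta Vs0 a0 etaa.
split; last first.
  have -> : velocity r s - velocity r' s' = ((r - r') + (s - s')) / 2 by rewrite /velocity; field.
  rewrite normrM [`|2^-1|]ger0_norm ?invr_ge0// ler_pdivrMr//.
  by apply: le_trans (ler_normD _ _) _; rewrite mulr_natr mulr2n; exact: lerD.
have q1 : `|celerity r s - celerity r' s'| <= L * d.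
  have -> : celerity r s - celerity r' s' = ((r - r') - (s - s')) / 4 by rewrite /celerity; field.
  rewrite normrM [`|4^-1|]ger0_norm ?invr_ge0// ler_pdivrMr//.
  apply: le_trans (ler_normB _ _) _; apply: le_trans (lerD rr ss) _; lra.
have q2 : `|celerity r s + celerity r' s'| <= 4 * cs.
  rewrite gtr0_norm; last first.
    exact: (addr_gt0 (celerity_gt0 Vs0 a0 eta0 etaa re se) (celerity_gt0 Vs0 a0 eta0 etaa re' se')).
  move: re se re' se' ec; rewrite !ler_norml /celerity.
  move=> /andP[? ?] /andP[? ?] /andP[? ?] /andP[? ?]; lra.
have -> : depth r s - depth r' s' =
    (celerity r s - celerity r' s') * (celerity r s + celerity r' s') / g.
  by rewrite /depth -subr_sqr mulrBl.
rewrite !normrM normfV (gtr0_norm g0).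
have -> : 4 * cs / g * L * d = (L * d) * (4 * cs) / g by ring.
apply: ler_wpM2r; first by rewrite invr_ge0 ltW.
exact: ler_pM.
Qed.

Lemma well_posed m d H0 V0 : small_data m -> near_data d H0 V0 -> ratio * d = m ->
  exists H V : R * R -> R,
  [/\ global_solution g l K gamma Hs Vs H0 V0 H V,
      forall T H' V', 0 < T -> closed_loop_solution g l K gamma Hs Vs H0 V0 T H' V' ->
        forall t x, 0 <= t -> t <= T -> 0 <= x -> x <= l ->
          H' (t, x) = H (t, x) /\ V' (t, x) = V (t, x),
      forall t x, 2 * l / c <= t -> H (t, x) = Hs /\ V (t, x) = Vs &
      forall t, 0 <= t ->
        [/\ forall x, `|H (t, x) - Hs| <= 4 * cs / g * slope m,
            forall x, `|V (t, x) - Vs| <= slope m,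
            klip (4 * cs / g * slope m) (fun x => H (t, x)) &
            klip (2 * slope m) (fun x => V (t, x))]].
Proof.
move=> sm nd dm; have [r [s [init w ext]]] := invariants_exist sm nd dm.
have meta := sd_eta sm.
have sl0 : 0 <= slope m by apply: le_trans (slope_ge m); exact: ltW (sd_gt0 sm).
have L0 : 0 <= 2 * slope m by exact: mulr_ge0.
have Lt0 : 0 <= 2 * slope m * Lam by apply: mulr_ge0 => //; exact: ltW.
have C0 : 0 <= 2 * slope m * (1 + 2 * (2 * slope m * Lam)).
  by apply: mulr_ge0 => //; apply: addr_ge0 => //; exact: mulr_ge0.
exists (fun p => depth (r p.1 p.2) (s p.1 p.2)), (fun p => velocity (r p.1 p.2) (s p.1 p.2)).
split=> /=.
- move=> T T0; exact: (csol_closed_loop g0 Hs0 Vs0 a0 eta0 l0 K0 gamma0 gamma1 etaV etaa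
    T0 L0 Lt0 C0 (ltW meta) (w T (ltW T0)) init erefl).
- move=> T H' V' T0 sol; exact: (closed_loop_unique g0 Hs0 Vs0 a0 eta0 l0 K0 gamma0 gamma1
    etaV etaa T0 L0 Lt0 C0 meta (w T (ltW T0)) init erefl sol).
- move=> t x tt; have [-> ->] := ext t x tt.
  rewrite /depth /velocity /celerity subrr addr0 !mul0r !addr0; split=> //.
  by rewrite sqr_sqrtr ?mulr_ge0 ?(ltW g0) ?(ltW Hs0)// mulrC mulKf// gt_eqF.
move=> t t0; have wt := w t t0.
have rm x : `|r t x| <= m := cs_rm wt x t0 (lexx t).
have sm' x : `|s t x| <= m := cs_sm wt x t0 (lexx t).
have re x : `|r t x| <= eta := le_trans (rm x) (ltW meta).
have se x : `|s t x| <= eta := le_trans (sm' x) (ltW meta).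
split=> [x|x|x y|x y].
- have [h _] := state_near (rm x) (sm' x) (ltW meta); apply: le_trans h _.
  by apply: ler_wpM2l => //; exact: slope_ge.
- have [_ h] := state_near (rm x) (sm' x) (ltW meta); apply: le_trans h _.
  exact: slope_ge.
- by have [] := state_lip (re x) (se x) (re y) (se y) (cs_rx wt t0 (lexx t) x y)
    (cs_sx wt t0 (lexx t) x y).
- by have [] := state_lip (re x) (se x) (re y) (se y) (cs_rx wt t0 (lexx t) x y)
    (cs_sx wt t0 (lexx t) x y).
Qed.

Lemma lip_itv_shift k M (u : R -> R) : klip M u -> lip_itv M l (fun x => u x - k).
Proof. by move=> uM x y _ _; rewrite opprB addrA subrK; exact: uM. Qed.

(** By uniqueness any global solution is the one constructed, whose values and
    slopes are bounded by a multiple of [slope m] at all times. *)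
Lemma stable : Lip_stable g l K gamma Hs Vs.
Proof.
move=> e e0; pose e' := e / (2 * amplification).
have e'0 : 0 < e' by rewrite divr_gt0// mulr_gt0// ampl_gt0.
have [m m0 /(_ m m0 (lexx m)) [sm se]] := small_dataP e'0.
exists (m / ratio); first exact: divr_gt0.
move=> H0 V0 H0L V0L comp nrm.
have nd := near_dataP H0L V0L comp nrm.
have dm : ratio * (m / ratio) = m by rewrite mulrC divfK// gt_eqF.
have [H [V [glob uniq _ near]]] := well_posed sm nd dm.
split; first by exists H, V.
move=> H' V' glob'.
have sl0 : 0 <= slope m by apply: le_trans (slope_ge m); exact: ltW.
have bound u : 0 <= u -> u <= amplification * slope m -> u + u <= e.
  move=> u0 hu; have : amplification * slope m <= amplification * e'.
    by apply: ler_wpM2l => //; exact: ltW ampl_gt0.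
  have -> : amplification * e' = e / 2 by rewrite /e'; field; rewrite gt_eqF// ampl_gt0.
  lra.
apply: Linfty_norm_le; first exact: ltW.
move=> t /=; rewrite in_itv/= andbT => t0.
have t1 : 0 < t + 1 by rewrite ltr_pwDr.
have tt : t <= t + 1 by rewrite lerDl.
have eqs x : x \in `[0, l] -> H' (t, x) = H (t, x) /\ V' (t, x) = V (t, x).
  rewrite in_itv/= => /andP[x0 xl]; exact: uniq t1 (glob' _ t1) t x t0 tt x0 xl.
have [bH bV lH lV] := near t t0.
have BH : 0 <= 4 * cs / g * slope m by exact: mulr_ge0.
have BH' : 4 * cs / g * slope m <= amplification * slope m.
  by apply: ler_wpM2r => //; rewrite /amplification lerDl.
have BV' : 2 * slope m <= amplification * slope m.
  by apply: ler_wpM2r => //; rewrite /amplification lerDr.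
have BV : 0 <= 2 * slope m by exact: mulr_ge0.
have NH : (Lip_norm l (fun x => (H' (t, x) - Hs)%R) <= e%:E)%E.
  apply: le_trans (_ : (_ <= (4 * cs / g * slope m + 4 * cs / g * slope m)%:E)%E) _.
    apply: Lip_norm_le => //.
      by move=> x y xl yl; rewrite (eqs x xl).1 (eqs y yl).1; exact: (lip_itv_shift Hs lH).
    by move=> x xl; rewrite (eqs x xl).1.
  by rewrite lee_fin; exact: bound.
have NV : (Lip_norm l (fun x => (V' (t, x) - Vs)%R) <= e%:E)%E.
  apply: le_trans (_ : (_ <= (2 * slope m + 2 * slope m)%:E)%E) _.
    apply: Lip_norm_le => //.
      by move=> x y xl yl; rewrite (eqs x xl).2 (eqs y yl).2; exact: (lip_itv_shift Vs lV).
    move=> x xl; rewrite (eqs x xl).2; apply: le_trans (bV x) _.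
    by rewrite ler_peMl// ler1n.
  by rewrite lee_fin; exact: bound.
rewrite gee0_abs; first by rewrite /Lip2_norm ge_max NH NV.
by rewrite /Lip2_norm le_max adde_ge0// Linfty_norm_ge0.
Qed.
End main.

Theorem theorem4 (R : realType) (g : R) (hg : 0 < g) :
  exists tstar : R -> R -> R -> R -> R -> R -> R,
  forall l K gamma Hs Vs c : R,
    0 < l -> 0 < K -> 0 < gamma -> gamma < 1 ->
    0 < Hs -> 0 < Vs -> Vs < Num.sqrt (g * Hs) ->
    0 < c -> 2 * c < Num.sqrt (g * Hs) - Vs ->
    [/\ tstar Hs Vs c delta K gamma @[delta --> 0^'+] --> 0,
        exists2 delta0 : R, 0 < delta0 &
          forall delta : R, 0 < delta -> delta <= delta0 ->
          forall H0 V0 : R -> R, is_Lip l H0 -> is_Lip l V0 ->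
            (Order.max (Lip_norm l (fun x => (H0 x - Hs)%R))
                       (Lip_norm l (fun x => (V0 x - Vs)%R)) < delta%:E)%E ->
            H0 0 * V0 0 = Hs * Vs ->
          forall T : R, 0 < T ->
          exists H V : R * R -> R,
            [/\ closed_loop_solution g l K gamma Hs Vs H0 V0 T H V,
                forall H' V' : R * R -> R,
                  closed_loop_solution g l K gamma Hs Vs H0 V0 T H' V' ->
                  forall t x : R, t \in `[0, T] -> x \in `[0, l] ->
                    H' (t, x) = H (t, x) /\ V' (t, x) = V (t, x) &
                forall t x : R, t \in `[0, T] ->
                  2 * l / c + tstar Hs Vs c delta K gamma <= t ->
                  x \in `]0, l[ ->
                  H (t, x) = Hs /\ V (t, x) = Vs] &
        Lip_stable g l K gamma Hs Vs].
Proof.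
(* the extinction time of the control fits in the gap between the actual speeds
   and c *)
exists (fun _ _ _ _ _ _ => 0) => l K gamma Hs Vs c l0 K0 gamma0 gamma1 Hs0 Vs0 _ c0 sub.
have rat0 : 0 < ratio g Hs by rewrite /ratio ltr_wpDr// divr_ge0 ?mulr_ge0// ltW// sqrtr_gt0 mulr_gt0.
split; first exact: cvg_cst; last exact: (stable hg l0 K0 gamma0 gamma1 Hs0 Vs0 c0 sub).
have [m1 m10 small] := small_dataP hg l0 K0 gamma0 gamma1 Hs0 Vs0 c0 sub ltr01.
exists (m1 / ratio g Hs); first exact: divr_gt0.
move=> d d0 d1 H0 V0 H0L V0L nrm comp T T0.
have dm : 0 < ratio g Hs * d by exact: mulr_gt0.
have dm1 : ratio g Hs * d <= m1 by rewrite mulrC -ler_pdivlMr.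
have [sm _] := small _ dm dm1.
have nd := near_dataP l0 H0L V0L comp nrm.
have [H [V [glob uniq rest _]]] := well_posed hg l0 K0 gamma0 gamma1 Hs0 Vs0 c0 sub sm nd erefl.
exists H, V; split; first exact: glob.
- move=> H' V' sol t x; rewrite !in_itv/= => /andP[t0 tT] /andP[x0 xl].
  exact: uniq T0 sol t x t0 tT x0 xl.
- by move=> t x _; rewrite addr0 => tt _; exact: rest.
Qed.
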